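(* Let $M\ge 2$, $d_1,\dots,d_M\in\mathbb{N}_{>0}$, $d=\sum_{m=1}^M d_m$, and write $\mathbb{R}^d=\times_{m=1}^M\mathbb{R}^{d_m}$. Let $\mathcal P$ be a class of Borel probability measures on $\mathbb{R}^d$ containing the $d$-dimensional Gaussian distributions. For $m\in\{1,\dots,M\}$ let $k_m:\mathbb{R}^{d_m}\times\mathbb{R}^{d_m}\to\mathbb{R}$ be a kernel and let $k=\otimes_{m=1}^M k_m$ be the product kernel on $\mathbb{R}^d$. (i) Suppose there is a common $\gamma>0$ such that, for every $m$, $k_m(\mathbf x_m,\mathbf x_m')=e^{-\frac{\gamma}{2}\|\mathbf x_m-\mathbf x_m'\|_{\mathbb{R}^{d_m}}^2}$ for all $\mathbf x_m,\mathbf x_m'\in\mathbb{R}^{d_m}$. Then, with $c=\dfrac{\gamma}{2(2\gamma+1)^{\frac d4+1}}>0$, for every integer $n\ge 2$, $$\inf_{\hat F_n}\ \sup_{\mathbb{P}\in\mathcal P}\ \mathbb{P}^n\left\{\left|\mathrm{HSIC}_k(\mathbb{P})-\hat F_n\right|\ge \frac{c}{\sqrt n}\right\}\ \ge\ \frac{1-\sqrt{5/8}}{2}.$$ (ii) Suppose instead that every $k_m$ ($m\in\{1,\dots,M\}$) is a continuous bounded translation-invariant characteristic kernel. Then there exists a constant $c>0$ such that, for every integer $n\ge 2$, $$\inf_{\hat F_n}\ \sup_{\mathbb{P}\in\mathcal P}\ \mathbb{P}^n\left\{\left|\mathrm{HSIC}_k(\mathbb{P})-\hat F_n\right|\ge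 \frac{c}{\sqrt n}\right\}\ \ge\ \frac{1-\sqrt{5/8}}{2}.$$ In both cases the infimum is over all estimators $\hat F_n$ of $\mathrm{HSIC}_k(\mathbb{P})$ based on $n$ i.i.d. samples from $\mathbb{P}$.
   Context: A kernel on $\mathbb{R}^d$ is a function $k:\mathbb{R}^d\times\mathbb{R}^d\to\mathbb{R}$ for which there are a Hilbert space $\mathcal H$ and a map $\phi:\mathbb{R}^d\to\mathcal H$ with $k(\mathbf x,\mathbf x')=\langle\phi(\mathbf x),\phi(\mathbf x')\rangle_{\mathcal H}$ for all $\mathbf x,\mathbf x'$; its reproducing kernel Hilbert space (RKHS) is denoted $\mathcal H_k$ and its canonical feature map is $\phi_k(\mathbf x)=k(\cdot,\mathbf x)\in\mathcal H_k$. All kernels are assumed measurable and bounded. A kernel is translation-invariant if $k(\mathbf x,\mathbf x')=\kappa(\mathbf x-\mathbf x')$ for some positive definite function $\kappa:\mathbb{R}^d\to\mathbb{R}$, where positive definite means $\sum_{i,j=1}^n c_ic_j\kappa(\mathbf x_i-\mathbf x_j)\ge 0$ for all $n\in\mathbb{N}_{>0}$, $c_i\in\mathbb{R}$, $\mathbf x_i\in\mathbb{R}^d$. For a Borel probability measure $\mathbb{P}$ on $\mathbb{R}^d$ the mean embedding is the Bochner integral $\mu_k(\mathbb{P})=\int_{\mathbb{R}^d}\phi_k(\mathbf x)\,\mathrm d\mathbb{P}(\mathbf x)\in\mathcal H_k$. The kernel $k$ is characteristic if $\mathbb{P}\mapsto\mu_k(\mathbb{P})$ is injective on Borel probability measures.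 The product kernel is $\left(\otimes_{m=1}^M k_m\right)\left((\mathbf x_m)_{m=1}^M,(\mathbf x_m')_{m=1}^M\right)=\prod_{m=1}^M k_m(\mathbf x_m,\mathbf x_m')$. For a Borel probability measure $\mathbb{P}$ on $\mathbb{R}^d=\times_{m=1}^M\mathbb{R}^{d_m}$, let $\mathbb{P}_m$ be its marginal on $\mathbb{R}^{d_m}$ and $\otimes_{m=1}^M\mathbb{P}_m$ the product of the marginals. The Hilbert-Schmidt independence criterion is $$\mathrm{HSIC}_k(\mathbb{P})=\left\|\mu_k(\mathbb{P})-\mu_k\left(\otimes_{m=1}^M\mathbb{P}_m\right)\right\|_{\mathcal H_k}.$$ $\mathbb{P}^n$ is the $n$-fold product measure of $\mathbb{P}$ on $(\mathbb{R}^d)^n$. An estimator $\hat F_n$ of $\mathrm{HSIC}_k(\mathbb{P})$ based on $n$ samples is a real-valued measurable function on $(\mathbb{R}^d)^n$. $\|\cdot\|_{\mathbb{R}^{d}}$ is the Euclidean norm. *)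

(* Defs.v *)
From HB Require Import structures.
From mathcomp Require Import all_boot all_order all_algebra.
From mathcomp Require Import all_classical all_reals all_analysis.
From mathcomp Require Import measurable_realfun.

Set Implicit Arguments.
Unset Strict Implicit.
Unset Printing Implicit Defensive.

Import Order.TTheory GRing.Theory Num.Theory.
Import numFieldNormedType.Exports.

Local Open Scope classical_set_scope.
Local Open Scope ring_scope.

(* Borel sigma-algebra on matrices; R^n is 'rV[R]_n. *)
HB.instance Definition _ (R : realType) (m n : nat) :=
  @isMeasurable.Build (sigma_display (@open 'M[R]_(m, n))) 'M[R]_(m, n)
    <<s @open 'M[R]_(m, n) >> (@sigma_algebra0 _ setT (@open 'M[R]_(m, n)))
    (@sigma_algebraC _ (@open 'M[R]_(m, n)))
    (@sigma_algebra_bigcup _ setT (@open 'M[R]_(m, n))).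

Section borel_matrix.
Context {R : realType} {m n : nat}.

Lemma open_measurable_mx (U : set 'M[R]_(m, n)) : open U -> measurable U.
Proof. by move=> oU; exact: sub_sigma_algebra. Qed.

Lemma continuous_measurable_mx m' n' (f : 'M[R]_(m, n) -> 'M[R]_(m', n')) :
  continuous f -> measurable_fun setT f.
Proof.
move=> /continuousP cf; apply: (measurability (@open 'M[R]_(m', n'))) => //.
by move=> _ [U oU <-]; rewrite setTI; apply: open_measurable_mx; exact: cf.
Qed.

Lemma measurable_coord (i : 'I_m) (j : 'I_n) :
  measurable_fun setT (fun A : 'M[R]_(m, n) => A i j).
Proof.
apply: (measurability _ (RGenOInfty.measurableE R)) => _ [_ [x ->] <-].
rewrite setTI; apply: open_measurable_mx.
have /continuousP := @coord_continuous R m n i j; apply.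
by rewrite set_itvoy; exact: open_gt.
Qed.

Lemma measurable_mxP d (T : measurableType d) (f : T -> 'M[R]_(m, n)) :
  (forall i j, measurable_fun setT (fun x => f x i j)) -> measurable_fun setT f.
Proof.
move=> mf; apply: (measurability (@open 'M[R]_(m, n))) => // _ [U oU <-].
rewrite setTI.
pose box (p : 'M[rat]_(m, n) * nat) : set 'M[R]_(m, n) :=
  [set A | forall i j, `|ratr (p.1 i j) - A i j| < p.2.+1%:R^-1].
have -> : U = \bigcup_(p in [set p | box p `<=` U]) box p.
  apply/seteqP; split => [A UA|A [p pU /pU//]].
  have /nbhs_ballP[e e0 eU] : nbhs A U by exact: open_nbhs_nbhs.
  have e20 : 0 < e / 2 by rewrite divr_gt0.
  have [N _ /(_ N (leqnn N)) Ne] : \forall k \near \oo, (k.+1%:R^-1 : R) < e / 2.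
    exact: near_infty_natSinv_lt (PosNum e20).
  have rdense i j : {q : rat | `|ratr q - A i j| < N.+1%:R^-1}.
    apply: cid; have N0 : 0 < (N.+1%:R^-1 : R) by rewrite invr_gt0.
    have : A i j - N.+1%:R^-1 < A i j + N.+1%:R^-1.
      by rewrite ltrBlDr -addrA ltrDl addr_gt0.
    move=> /rat_in_itvoo[q]; rewrite in_itv /= => /andP[q1 q2].
    by exists q; rewrite ltr_distl q1.
  exists (\matrix_(i, j) sval (rdense i j), N).
    move=> B /= bB; apply: eU; split => // i j /=.
    move: (bB i j); rewrite mxE; move: (svalP (rdense i j)) => h1 h2.
    rewrite /ball /= (splitr e) -(subrKA (ratr (sval (rdense i j)))).
    rewrite (le_lt_trans (ler_normD _ _))// ltrD//.
      by rewrite distrC (lt_trans h1).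
    by rewrite (lt_trans h2).
  by move=> i j /=; rewrite mxE; exact: svalP (rdense i j).
have mbox p : measurable (f @^-1` box p).
  have -> : f @^-1` box p = \bigcap_(i in [set: 'I_m]) \bigcap_(j in [set: 'I_n])
      (fun x => f x i j) @^-1` `]ratr (p.1 i j) - p.2.+1%:R^-1,
                                 ratr (p.1 i j) + p.2.+1%:R^-1[.
    apply/seteqP; split => x /=.
      by move=> bx i _ j _; move: (bx i j); rewrite distrC ltr_distl /= in_itv.
    move=> bx i j; move: (bx i I j I).
    by rewrite distrC ltr_distl /= in_itv.
  apply: fin_bigcap_measurable => // i _; apply: fin_bigcap_measurable => // j _.
  by rewrite -[X in measurable X]setTI; apply: mf.
rewrite preimage_bigcup bigcup_mkcond.
apply: countable_bigcupT_measurable => [|p]; first exact: countableP.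
by case: ifPn.
Qed.

End borel_matrix.

Section iid.
Context {d : measure_display} {T : measurableType d} {R : realType}.

Definition tuple_cons n (z : T * n.-tuple T) : n.+1.-tuple T :=
  [tuple of z.1 :: z.2].

Lemma measurable_tuple_cons n : measurable_fun setT (@tuple_cons n).
Proof. exact: measurable_cons. Qed.

HB.instance Definition _ n :=
  isMeasurableFun.Build _ _ _ _ (@tuple_cons n) (@measurable_tuple_cons n).

Fixpoint iid (P : probability T R) (n : nat) : probability (n.-tuple T) R :=
  match n with
  | 0%N => dirac [tuple]
  | n'.+1 => distribution (P \x iid P n')%E (@tuple_cons n')
  end.

Lemma iid_box (P : probability T R) n (A : 'I_n -> set T) :
  (forall i, measurable (A i)) ->
  iid P n [set t | forall i, A i (tnth t i)] = (\prod_(i < n) P (A i))%E.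
Proof.
elim: n A => [|n IHn] A mA.
  rewrite big_ord0 /= diracE mem_set//=; by case.
have mB : measurable [set t : n.-tuple T | forall i, A (lift ord0 i) (tnth t i)].
  have -> : [set t : n.-tuple T | forall i, A (lift ord0 i) (tnth t i)] =
    \bigcap_(i in [set: 'I_n]) (@tnth n T ^~ i) @^-1` A (lift ord0 i).
    by apply/seteqP; split => t /= h i; [move=> _; exact: h | exact: h].
  apply: fin_bigcap_measurable => // i _.
  by rewrite -[X in measurable X]setTI; exact: measurable_tnth.
rewrite big_ord_recl -IHn// -product_measure1E//=.
congr (_ _); apply/seteqP; split => -[x t] /=.
- move=> h; split => [|i]; first exact: (h ord0).
  by have := h (lift ord0 i); rewrite tnthS.
- move=> [hx ht] i; case: (unliftP ord0 i) => [j ->|->//].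
  by rewrite tnthS; exact: ht.
Qed.

End iid.

Section blocks.
Context {R : realType} {M : nat} {d : 'I_M -> nat}.
Local Notation D := (\sum_(m < M) d m)%N.

(* R^D is the product of the R^(d m), with projections submxrow. *)
Definition block (m : 'I_M) (x : 'rV[R]_D) : 'rV[R]_(d m) := submxrow x m.

Lemma measurable_block m : measurable_fun setT (block m).
Proof.
apply: measurable_mxP => i j.
apply: (eq_measurable_fun (fun x : 'rV[R]_D => x i (tagnat.Rank m j))).
  by move=> x _; rewrite /block mxE.
exact: measurable_coord.
Qed.

HB.instance Definition _ m :=
  isMeasurableFun.Build _ _ _ _ (block m) (@measurable_block m).

Definition diag_blocks (t : M.-tuple 'rV[R]_D) : 'rV[R]_D :=
  \mxrow_(m < M) block m (tnth t m).

Lemma measurable_diag_blocks : measurable_fun setT diag_blocks.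
Proof.
apply: measurable_mxP => i j.
apply: (eq_measurable_fun
  ((fun x : 'rV[R]_D => x i (tagnat.Rank (tagnat.sig1 j) (tagnat.sig2 j))) \o
   (fun t : M.-tuple 'rV[R]_D => tnth t (tagnat.sig1 j)))).
  by move=> t _; rewrite /diag_blocks /block !mxE.
apply: measurableT_comp; first exact: measurable_coord.
exact: measurable_tnth.
Qed.

HB.instance Definition _ :=
  isMeasurableFun.Build _ _ _ _ diag_blocks (@measurable_diag_blocks).

Definition marginal (P : probability 'rV[R]_D R) (m : 'I_M) :
  probability 'rV[R]_(d m) R := distribution P (block m).

(* The product of the marginals of P, as the law of the vector whose m-th block
   is the m-th block of the m-th of M independent draws from P. *)
Definition prod_marginals (P : probability 'rV[R]_D R) :
  probability 'rV[R]_D R := distribution (iid P M) diag_blocks.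

Lemma prod_marginals_box (P : probability 'rV[R]_D R)
    (A : forall m, set 'rV[R]_(d m)) :
  (forall m, measurable (A m)) ->
  prod_marginals P [set x | forall m, A m (block m x)] =
  (\prod_(m < M) marginal P m (A m))%E.
Proof.
move=> mA; rewrite -(@iid_box _ _ _ P M (fun m => block m @^-1` A m)); last first.
  by move=> m; rewrite -[X in measurable X]setTI; exact: measurable_block.
have bdE t m : block m (diag_blocks t) = block m (tnth t m).
  by rewrite /diag_blocks {1}/block mxrowK.
by congr (iid P M _); apply/seteqP; split => t /= h m; move: (h m); rewrite bdE.
Qed.

End blocks.

Section gaussian.
Context {R : realType} {n : nat}.

Definition affine_row (mu : 'rV[R]_n) (A : 'M[R]_n) (z : n.-tuple (measurableTypeR R)) :
  'rV[R]_n := mu + (\row_j tnth z j) *m A.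

Lemma measurable_affine_row mu A : measurable_fun setT (affine_row mu A).
Proof.
apply: measurable_mxP => i j.
apply: (eq_measurable_fun
  (fun z : n.-tuple (measurableTypeR R) => mu i j + \sum_(l < n) tnth z l * A l j)).
  move=> z _; rewrite /affine_row !mxE; congr (_ + _).
  by apply: eq_bigr => l _; rewrite mxE.
apply: measurable_funD => //; apply: measurable_sum => l.
apply: measurable_funM => //; exact: measurable_tnth.
Qed.

HB.instance Definition _ mu A :=
  isMeasurableFun.Build _ _ _ _ (affine_row mu A) (@measurable_affine_row mu A).

(* Law of mu + Z A with Z standard normal in R^n, i.e. N(mu, A^T A); A ranges
   over unitmx to give the nondegenerate Gaussian distributions. *)
Definition gaussian (mu : 'rV[R]_n) (A : 'M[R]_n) : probability 'rV[R]_n R :=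
  distribution (iid (@normal_prob R 0 1) n) (affine_row mu A).

End gaussian.

Record hilbert (R : realType) := Hilbert {
  hilbert_sort :> completeNormedModType R;
  inner : hilbert_sort -> hilbert_sort -> R;
  innerC : forall u v, inner u v = inner v u;
  inner_linear : forall a u v w,
    inner (a *: u + v) w = a * inner u w + inner v w;
  innerE : forall u, inner u u = `|u| ^+ 2 }.

Section bochner.
Context {d : measure_display} {T : measurableType d} {R : realType}
  {H : completeNormedModType R}.

Definition simple_integral (P : probability T R) (s : T -> H) : H :=
  \sum_(v \in range s) fine (P (s @^-1` [set v])) *: v.

Definition is_bochner_integral (P : probability T R) (f : T -> H) (v : H) :=
  exists s : nat -> {fimfun T >-> H},
    [/\ forall n w, measurable (s n @^-1` [set w]),
        forall x, s n x @[n --> \oo] --> f x,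
        (\int[P]_x `|f x - s n x|%:E)%E @[n --> \oo] --> 0%E &
        simple_integral P (s n) @[n --> \oo] --> v].

(* Unspecified if f is not Bochner integrable. *)
Definition bochner_integral (P : probability T R) (f : T -> H) : H :=
  get [set v | is_bochner_integral P f v].

End bochner.

Section kernels.
Context {R : realType}.

(* A Hilbert space of functions on T with reproducing kernel k: its elements are
   functions on T through the linear injection rkhs_eval.  Any two such spaces
   are isometric, through an isometry exchanging the two maps feature. *)
Record rkhs (T : Type) (k : T -> T -> R) := RKHS {
  rkhs_hilbert :> hilbert R;
  rkhs_eval : rkhs_hilbert -> T -> R;
  rkhs_eval_linear : forall a f g x,
    rkhs_eval (a *: f + g) x = a * rkhs_eval f x + rkhs_eval g x;
  rkhs_eval_inj : injective rkhs_eval;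
  feature : T -> rkhs_hilbert;
  featureE : forall x y, rkhs_eval (feature x) y = k y x;
  reproducing : forall f x, rkhs_eval f x = inner f (feature x) }.

Definition hilbert_kernel (T : Type) (k : T -> T -> R) :=
  exists (H : hilbert R) (phi : T -> H),
    forall x y, k x y = inner (phi x) (phi y).

Definition kernel_bounded (T : Type) (k : T -> T -> R) :=
  exists C, forall x y, `|k x y| <= C.

Definition kernel_measurable d (T : measurableType d) (k : T -> T -> R) :=
  measurable_fun setT (fun z : T * T => k z.1 z.2).

Definition kernel_continuous (T : topologicalType) (k : T -> T -> R) :=
  continuous (fun z : T * T => k z.1 z.2).

Definition positive_definite (V : zmodType) (kappa : V -> R) :=
  forall n (c : 'I_n -> R) (x : 'I_n -> V), (0 < n)%N ->
    0 <= \sum_(i < n) \sum_(j < n) c i * c j * kappa (x i - x j).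

Definition translation_invariant (V : zmodType) (k : V -> V -> R) :=
  exists2 kappa, positive_definite kappa & forall x y, k x y = kappa (x - y).

Definition mean_embedding d (T : measurableType d) (k : T -> T -> R)
    (H : rkhs k) (P : probability T R) : H :=
  bochner_integral P (@feature T k H).

(* Measures are compared on measurable sets only, as a probability is a
   function on all sets. *)
Definition characteristic_kernel d (T : measurableType d) (k : T -> T -> R)
    (H : rkhs k) :=
  forall P Q : probability T R, mean_embedding H P = mean_embedding H Q ->
    forall A, measurable A -> P A = Q A.

Definition enorm n (x : 'rV[R]_n) : R := Num.sqrt (\sum_(i < n) x 0 i ^+ 2).

Definition gaussian_kernel n (gamma : R) (x y : 'rV[R]_n) : R :=
  expR (- (gamma / 2) * enorm (x - y) ^+ 2).

Section product.
Context {M : nat} {d : 'I_M -> nat}.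
Local Notation D := (\sum_(m < M) d m)%N.

Definition prod_kernel (k : forall m, 'rV[R]_(d m) -> 'rV[R]_(d m) -> R)
    (x y : 'rV[R]_D) : R := \prod_(m < M) k m (block m x) (block m y).

Definition HSIC (k : 'rV[R]_D -> 'rV[R]_D -> R) (H : rkhs k)
    (P : probability 'rV[R]_D R) : R :=
  `|mean_embedding H P - mean_embedding H (prod_marginals P)|.

End product.
End kernels.

(* inf over estimators F, sup over P in PP, of P^n { |theta P - F| >= eps }. *)
Definition minimax_risk d (T : measurableType d) (R : realType) (n : nat)
    (PP : set (probability T R)) (theta : probability T R -> R) (eps : R) :
    \bar R :=
  ereal_inf [set ereal_sup [set iid P n [set t | eps <= `|theta P - F t|]
                           | P in PP]
            | F in [set F : n.-tuple T -> R | measurable_fun setT F]].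

(* Main.v *)
(* Fix coordinates i and j in two different blocks and let P a be the centered
   Gaussian law with unit variances in which only the coordinates i and j are
   correlated, with correlation a.  The product of the marginals of P a is P 0,
   so the HSIC of P a is the distance between the embeddings of P a and P 0.
   The chi-square divergence of P a from P 0 is a^2 / (1 - a^2), so for
   a^2 <= 1/n the two n-fold products overlap enough for a two-point bound, and
   it remains to bound the distance below by a constant times a.

   The difference X - Y of independent X ~ P a and Y ~ P b has a law depending on
   a + b only, so for a translation-invariant kernel <mu (P a), mu (P b)> =
   K (a + b) for some even function K.  For Gaussian kernels K is explicit.  In
   general, positivity of squared norms makes K midpoint convex, and pairing
   mu (P a) - mu (P 0) with mu (P (3/4)) - mu (P (-3/4)) gives
   K (3/4 + a) - K (3/4 - a), which convexity bounds below by a multiple of a,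
   the slope being positive as soon as mu (P (1/8)) <> mu (P (-1/8)).  That last
   fact holds because each characteristic translation-invariant kernel k_m also
   separates finite signed measures, so the product kernel separates signed
   measures that have a density with respect to a common law on rectangles. *)

Require Import Defs.
From HB Require Import structures.
From mathcomp Require Import all_boot all_order all_algebra.
From mathcomp Require Import all_classical all_reals all_analysis.
From mathcomp Require Import measurable_realfun ring lra zify.

Set Implicit Arguments.
Unset Strict Implicit.
Unset Printing Implicit Defensive.

Import Order.TTheory GRing.Theory Num.Theory.
Import numFieldNormedType.Exports.

Local Open Scope classical_set_scope.
Local Open Scope ring_scope.

(** The squared distance between the embeddings of [P a] and [P 0] is the second difference K (2 a)
    - 2 K a + K 0, and convexity alone gives it no lower bound of order a^2. Pairing with a fixed
    vector replaces it by a first difference taken around 3/4, where the slope of K is at least its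
    mean slope over [0, 1/4]. Evenness of K makes that mean slope a multiple of a squared norm, that
    of mu (P (1/8)) - mu (P (-1/8)). Since only midpoint convexity is established, slopes are
    compared along grids of step 1 / (4 p), and a is taken of that form. The Gaussian laws are
    images of independent standard normal variables, and their densities on the whole space are
    relative to [P 0]. Integrals thus reduce to iterated one-dimensional integrals of nonnegative
    functions, exchanged by Tonelli; a bounded kernel of unknown sign is first shifted by its bound.
    The two-point argument yields the value 1/8, which exceeds (1 - sqrt (5/8)) / 2. *)

(** * Densities, and laws on tuples and rows determined by boxes *)

Section density.
Context d (T : measurableType d) (R : realType).
Variables (mu nu : {measure set T -> \bar R}) (g : T -> R).
Hypotheses (mg : measurable_fun setT g) (g0 : forall x, 0 <= g x).
Hypothesis nuE : forall A, measurable A -> nu A = (\int[mu]_(x in A) (g x)%:E)%E.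

Import HBNNSimple.

Lemma ge0_integral_density (f : T -> \bar R) :
  measurable_fun setT f -> (forall x, 0 <= f x)%E ->
  (\int[nu]_x f x = \int[mu]_x (f x * (g x)%:E))%E.
Proof.
move=> mf f0; pose f_ := nnsfun_approx measurableT mf.
have f_f x : ((f_ n x)%:E @[n --> \oo] --> f x)%E.
  by apply: cvg_nnsfun_approx => // ? _; exact: f0.
have nd_f x m n : (m <= n)%N -> f_ m x <= f_ n x.
  by move=> mn; exact/lefP/nd_nnsfun_approx.
transitivity (limn (fun n => \int[nu]_x (f_ n x)%:E)%E).
  rewrite -monotone_convergence//.
  - by apply: eq_integral => y _; apply/esym/cvg_lim.
  - by move=> n; exact/measurable_EFinP/measurable_funP.
  - by move=> n y _; rewrite lee_fin.
  - by move=> y _ m n mn; rewrite lee_fin nd_f.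
transitivity (limn (fun n => \int[mu]_x ((f_ n x)%:E * (g x)%:E))%E); last first.
  rewrite -monotone_convergence//.
  - apply: eq_integral => y _; apply/cvg_lim => //.
    by apply: cvgeZr => //; exact: f_f.
  - move=> n; apply: emeasurable_funM; last exact/measurable_EFinP.
    exact/measurable_EFinP/measurable_funP.
  - by move=> n y _; rewrite mule_ge0// lee_fin.
  - by move=> y _ m n mn; rewrite lee_wpmul2r ?lee_fin ?nd_f.
congr (limn _); apply/funext => n.
under eq_integral do rewrite fimfunE -fsumEFin//.
rewrite ge0_integral_fsum//; last 2 first.
- by move=> r; exact/measurable_EFinP/measurable_funM.
- by move=> r x _; exact: nnfun_muleindic_ge0.
under [RHS]eq_integral.
  move=> x _; rewrite fimfunE -fsumEFin//.
  rewrite ge0_mule_fsuml; last by move=> r; exact: nnfun_muleindic_ge0.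
  over.
rewrite ge0_integral_fsum//; last 2 first.
- move=> r; apply: emeasurable_funM; last exact/measurable_EFinP.
  exact/measurable_EFinP/measurable_funM.
- by move=> r x _; apply: mule_ge0; [exact: nnfun_muleindic_ge0|rewrite lee_fin].
apply: eq_fsbigr => r; rewrite inE => -[t _ rE].
rewrite integralZl_indic_nnsfun// integral_indic//= setIT nuE//.
under [RHS]eq_integral do rewrite EFinM -muleA.
rewrite ge0_integralZl//; last 3 first.
- by apply: emeasurable_funM; apply/measurable_EFinP.
- by move=> x _; rewrite mule_ge0 ?lee_fin.
- by rewrite -rE lee_fin.
congr (_ * _)%E; rewrite integral_mkcond; apply: eq_integral => x _.
by rewrite muleC epatch_indic.
Qed.

End density.

Section tuple_box.
Context d (T : measurableType d) (R : realType) (n : nat).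

Definition tuple_box (A : 'I_n -> set T) : set (n.-tuple T) :=
  [set t | forall i, A i (tnth t i)].

Lemma measurable_tuple_box A :
  (forall i, measurable (A i)) -> measurable (tuple_box A).
Proof.
move=> mA; have -> : tuple_box A =
    \bigcap_(i in [set: 'I_n]) (@tnth n T ^~ i) @^-1` A i.
  by apply/seteqP; split => t /= h i; [move=> _; exact: h | exact: h].
apply: fin_bigcap_measurable => // i _.
by rewrite -[X in measurable X]setTI; exact: measurable_tnth.
Qed.

(** Boxes are stable under intersection and generate the product sigma-algebra, since a cylinder
    over one coordinate is a box with all other sides equal to [setT]. *)
Lemma tuple_box_unique (m1 m2 : probability (n.-tuple T) R) :
  (forall A, (forall i, measurable (A i)) ->
    m1 (tuple_box A) = m2 (tuple_box A)) ->
  forall B, measurable B -> m1 B = m2 B.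
Proof.
move=> m12; pose G := [set tuple_box A | A in [set A | forall i, measurable (A i)]].
have boxT : tuple_box (fun=> setT) = setT by apply/seteqP; split => t.
apply: (measure_unique G (fun=> setT)).
- apply/seteqP; split; last first.
    apply: smallest_sub; first exact: sigma_algebra_measurable.
    by move=> _ [A mA <-]; exact: measurable_tuple_box.
  apply: smallest_sub; first exact: smallest_sigma_algebra.
  elim/big_ind : _ => [//|B C BG CG X [/BG//|/CG//]|i _ _ [B mB <-]].
  apply: sub_sigma_algebra; exists (fun j => if j == i then B else setT).
    by move=> j /=; case: ifP.
  apply/seteqP; split => [t h|t [_ Bt] j /=].
    by split => //; have := h i; rewrite /= eqxx.
  by case: eqP => // ->.
- move=> _ _ [A mA <-] [B mB <-]; exists (fun i => A i `&` B i) => /=.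
    by move=> i; exact: measurableI.
  apply/seteqP; split => t /=.
    by move=> h; split => i; have [] := h i.
  by move=> [h1 h2] i; split; [exact: h1|exact: h2].
- by move=> _; exists (fun=> setT).
- by rewrite bigcup_const.
- by move=> _ [A mA <-]; exact: m12.
- by move=> _; apply: le_lt_trans (ltry 1); rewrite probability_le1.
Qed.

End tuple_box.

Lemma measurable_row_box (R : realType) n (B : 'I_n -> set (measurableTypeR R)) :
  (forall l, measurable (B l)) -> measurable [set x : 'rV[R]_n | forall l, B l (x 0 l)].
Proof.
move=> mB.
rewrite (_ : [set x | _] = \bigcap_(l in [set: 'I_n]) (fun x : 'rV[R]_n => x 0 l) @^-1` B l).
  apply: fin_bigcap_measurable; first exact: finite_finset.
  by move=> l _; rewrite -[X in measurable X]setTI; apply: measurable_coord; last exact: mB.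
by apply/seteqP; split => x /= h l; [move=> _; exact: h|exact: h].
Qed.

(** Rows carry the Borel sigma-algebra and tuples the product one; a bijection measurable in both
    directions carries the claim over to [tuple_box_unique]. *)
Lemma row_box_unique (R : realType) n (m1 m2 : probability 'rV[R]_n R) :
  (forall A : 'I_n -> set (measurableTypeR R), (forall i, measurable (A i)) ->
    m1 [set x | forall i, A i (x 0 i)] = m2 [set x | forall i, A i (x 0 i)]) ->
  forall B, measurable B -> m1 B = m2 B.
Proof.
move=> m12.
pose toT (x : 'rV[R]_n) : n.-tuple (measurableTypeR R) := [tuple x 0 i | i < n].
pose ofT (t : n.-tuple (measurableTypeR R)) : 'rV[R]_n := \row_i tnth t i.
have toTK : cancel toT ofT.
  by move=> x; apply/rowP => i; rewrite mxE tnth_mktuple.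
have mto : measurable_fun setT toT.
  apply/measurable_fun_tnthP => i.
  apply: (eq_measurable_fun (fun x : 'rV[R]_n => x 0 i)).
    by move=> x _; rewrite /= tnth_mktuple.
  exact: measurable_coord.
have mof : measurable_fun setT ofT.
  apply: measurable_mxP => i j.
  apply: (eq_measurable_fun (fun t : n.-tuple (measurableTypeR R) => tnth t j)).
    by move=> x _; rewrite /= mxE.
  exact: measurable_tnth.
pose toX := HB.pack_for {mfun 'rV[R]_n >-> n.-tuple (measurableTypeR R)} toT
  (isMeasurableFun.Build _ _ _ _ toT mto).
move=> B mB.
have BE : B = toX @^-1` (ofT @^-1` B).
  by apply/seteqP; split => x /=; rewrite toTK.
rewrite BE; apply: (@tuple_box_unique _ (measurableTypeR R) R n
  (distribution m1 toX) (distribution m2 toX)); last first.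
  by rewrite -[X in measurable X]setTI; exact: mof.
move=> A mA; have toE : toX @^-1` tuple_box A = [set x | forall i, A i (x 0 i)].
  by apply/seteqP; split => x /= h i; have := h i; rewrite tnth_mktuple.
change (m1 (toX @^-1` tuple_box A) = m2 (toX @^-1` tuple_box A)).
by rewrite toE; exact: m12.
Qed.

Section iid_theory.
Context d (T : measurableType d) (R : realType) (P : probability T R).

Lemma iid_tuple_box n (A : 'I_n -> set T) : (forall i, measurable (A i)) ->
  iid P n (tuple_box A) = (\prod_(i < n) P (A i))%E.
Proof. exact: iid_box. Qed.

Definition upd n (i : 'I_n) (t : n.-tuple T) (x : T) : n.-tuple T :=
  [tuple if l == i then x else tnth t l | l < n].

Lemma tnth_upd n i t x (l : 'I_n) :
  tnth (upd i t x) l = if l == i then x else tnth t l.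
Proof. by rewrite tnth_mktuple. Qed.

Lemma measurable_upd n (i : 'I_n) :
  measurable_fun setT (fun z : n.-tuple T * T => upd i z.1 z.2).
Proof.
apply/measurable_fun_tnthP => l.
apply: (eq_measurable_fun
  (fun z : n.-tuple T * T => if l == i then z.2 else tnth z.1 l)).
  by move=> z _; rewrite /= tnth_upd.
case: (l == i); first exact: measurable_snd.
exact: (measurableT_comp (measurable_tnth l) measurable_fst).
Qed.

Lemma iid_map n (g : 'I_n -> T -> T) :
  (forall i, measurable_fun setT (g i)) ->
  (forall i A, measurable A -> P (g i @^-1` A) = P A) ->
  forall B, measurable B ->
  iid P n ((fun t => [tuple g i (tnth t i) | i < n]) @^-1` B) = iid P n B.
Proof.
move=> mg Pg.
set G := fun t => _.
have mG : measurable_fun setT G.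
  apply/measurable_fun_tnthP => l.
  apply: (eq_measurable_fun (fun t : n.-tuple T => g l (tnth t l))).
    by move=> z _; rewrite /= tnth_mktuple.
  by apply: measurableT_comp => //; exact: measurable_tnth.
pose X := HB.pack_for {mfun n.-tuple T >-> n.-tuple T} G
  (isMeasurableFun.Build _ _ _ _ G mG).
move=> B mB; apply: (@tuple_box_unique _ T R n (distribution (iid P n) X)) => // A mA.
change (iid P n (X @^-1` tuple_box A) = iid P n (tuple_box A)).
rewrite (_ : X @^-1` tuple_box A = tuple_box (fun i => g i @^-1` A i)); last first.
  by apply/seteqP; split => t /= h i; have := h i; rewrite tnth_mktuple.
rewrite !iid_tuple_box//; first by apply: eq_bigr => i _; exact: Pg.
by move=> i; rewrite -[X in measurable X]setTI; exact: mg.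
Qed.

(** Resampling one entry leaves the law of an i.i.d. tuple unchanged. This isolates a coordinate at
    any position without reordering the tuple, and is how the correlated pair is later extracted
    from a Gaussian vector. *)
Lemma ge0_integral_iid_upd n (i : 'I_n) (f : n.-tuple T -> \bar R) :
  measurable_fun setT f -> (forall t, 0 <= f t)%E ->
  (\int[iid P n]_t f t = \int[iid P n]_t \int[P]_x f (upd i t x))%E.
Proof.
move=> mf f0.
pose U z := upd i z.1 z.2.
pose X := HB.pack_for {mfun (n.-tuple T * T)%type >-> n.-tuple T} U
  (isMeasurableFun.Build _ _ _ _ U (measurable_upd i)).
transitivity (\int[distribution (iid P n \x P)%E X]_t f t)%E.
  apply: eq_measure_integral => B mB _; apply: tuple_box_unique => //= A mA.
  change (iid P n (tuple_box A) = (iid P n \x P)%E (X @^-1` tuple_box A)).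
  rewrite iid_tuple_box//.
  have -> : X @^-1` tuple_box A =
      tuple_box (fun l => if l == i then setT else A l) `*` A i.
    apply/seteqP; split => -[t x] /=.
      move=> h; split; last by have := h i; rewrite tnth_upd eqxx.
      by move=> l /=; have := h l; rewrite tnth_upd; case: ifP.
    move=> [h1 h2] l; have := h1 l; rewrite tnth_upd.
    by case: eqP => [->|].
  rewrite [LHS](bigD1 i)//= product_measure1E//; last first.
    by apply: measurable_tuple_box => l; case: ifP.
  set p := (X in (_ = X * _)%E).
  have -> : p = (\prod_(l < n) P (if l == i then setT else A l))%E.
    by apply: iid_tuple_box => l; case: ifP.
  rewrite [X in (_ = X * _)%E](bigD1 i)//= eqxx probability_setT mul1e muleC; congr (_ * _)%E.
  by apply: eq_bigr => l /negbTE ->.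
rewrite ge0_integral_distribution// fubini_tonelli1//; last by move=> z; exact: f0.
by apply: measurableT_comp => //; exact: measurable_upd.
Qed.

Lemma ge0_integral_iidS n (f : n.+1.-tuple T -> \bar R) :
  measurable_fun setT f -> (forall t, 0 <= f t)%E ->
  (\int[iid P n.+1]_t f t = \int[P]_x \int[iid P n]_t f (tuple_cons (x, t)))%E.
Proof.
move=> mf f0; rewrite /= ge0_integral_distribution// fubini_tonelli1//; last by move=> z; exact: f0.
by apply: measurableT_comp.
Qed.

Lemma ge0_integral_iid_prod n (f : 'I_n -> T -> R) :
  (forall i, measurable_fun setT (f i)) -> (forall i x, 0 <= f i x) ->
  (\int[iid P n]_t (\prod_(i < n) f i (tnth t i))%:E =
   \prod_(i < n) \int[P]_x (f i x)%:E)%E.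
Proof.
elim: n f => [|n IHn] f mf f0.
  under eq_integral do rewrite big_ord0.
  by rewrite big_ord0 integral_cst//= probability_setT mule1.
have mprod m (h : 'I_m -> T -> R) : (forall i, measurable_fun setT (h i)) ->
    measurable_fun setT (fun t : m.-tuple T => (\prod_(i < m) h i (tnth t i))%:E).
  move=> mh; apply/measurable_EFinP; apply: measurable_prod => i _.
  by apply: measurableT_comp => //; exact: measurable_tnth.
rewrite ge0_integral_iidS; [|exact: mprod|by move=> t; rewrite lee_fin prodr_ge0].
rewrite big_ord_recl.
have fE x (t : n.-tuple T) :
    (\prod_(i < n.+1) f i (tnth (tuple_cons (x, t)) i))%:E =
    ((f ord0 x)%:E * (\prod_(i < n) f (lift ord0 i) (tnth t i))%:E)%E.
  rewrite -EFinM big_ord_recl; congr (_ * _)%:E.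
  by apply: eq_bigr => i _; rewrite tnthS.
rewrite (eq_integral (fun x => ((f ord0 x)%:E *
  \prod_(i < n) \int[P]_x (f (lift ord0 i) x)%:E)%E)); last first.
  move=> x _; under eq_integral do rewrite fE.
  rewrite ge0_integralZl//; last 3 first.
    + by apply: (mprod _ (fun i => f (lift ord0 i))) => i; exact: mf.
    + by move=> t _; rewrite lee_fin prodr_ge0.
    + by rewrite lee_fin f0.
  by rewrite (IHn (fun i => f (lift ord0 i))).
rewrite /= ge0_integralZr//.
- exact/measurable_EFinP.
- by move=> x _; rewrite lee_fin.
- by apply: prode_ge0 => i _; apply: integral_ge0 => x _; rewrite lee_fin.
Qed.

End iid_theory.

Section iid_density.
Context d (T : measurableType d) (R : realType) (P Q : probability T R) (g : T -> R).
Hypotheses (mg : measurable_fun setT g) (g0 : forall x, 0 <= g x).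
Hypothesis QE : forall A, measurable A -> Q A = (\int[P]_(x in A) (g x)%:E)%E.

Lemma ge0_integral_iid_density n (f : n.-tuple T -> \bar R) :
  measurable_fun setT f -> (forall t, 0 <= f t)%E ->
  (\int[iid Q n]_t f t =
   \int[iid P n]_t (f t * (\prod_(i < n) g (tnth t i))%:E))%E.
Proof.
elim: n f => [|n IHn] f mf f0.
  by apply: eq_integral => t _; rewrite big_ord0 mule1.
have mprod m : measurable_fun setT (fun t : m.-tuple T => \prod_(i < m) g (tnth t i)).
  apply: measurable_prod => i _.
  by apply: measurableT_comp => //; exact: measurable_tnth.
have prod0 m (t : m.-tuple T) : 0 <= \prod_(i < m) g (tnth t i).
  by apply: prodr_ge0.
rewrite !ge0_integral_iidS//; last 2 first.
- by apply: emeasurable_funM; [exact: mf|apply/measurable_EFinP; exact: mprod].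
- by move=> t; apply: mule_ge0; rewrite ?lee_fin.
have mfc : measurable_fun setT (f \o @tuple_cons _ T n).
  by apply: measurableT_comp.
have mfx x : measurable_fun setT (fun t : n.-tuple T => f (tuple_cons (x, t))).
  apply: (measurableT_comp mfc); exact: pair1_measurable.
rewrite (@ge0_integral_density _ _ _ P Q g)//; last 2 first.
- by apply: (measurable_fun_fubini_tonelli_F (f \o @tuple_cons _ T n)) => // z; exact: f0.
- by move=> x; exact: integral_ge0.
apply: eq_integral => x _.
rewrite IHn// -ge0_integralZr//; last 3 first.
- by apply: emeasurable_funM; [exact: mfx|apply/measurable_EFinP; exact: mprod].
- by move=> t _; apply: mule_ge0; rewrite ?lee_fin.
- by rewrite lee_fin.
apply: eq_integral => t _.
rewrite big_ord_recl -muleA; congr (_ * _)%E.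
rewrite muleC -EFinM; congr (_ * _)%:E.
by apply: eq_bigr => i _; rewrite tnthS.
Qed.

End iid_density.

Ltac meas_step :=
  match goal with
  | |- measurable_fun _ (fun _ => ?c) => exact: measurable_cst
  | |- measurable_fun _ (fun z => z) => exact: measurable_id
  | |- measurable_fun _ (fun z => (@?f z, @?g z)) => apply: measurable_fun_pair
  | |- measurable_fun _ (fun z => (@?f z + - @?g z)%R) =>
    apply: (@measurable_funB _ _ _ _ f g)
  | |- measurable_fun _ (fun z => (@?f z + @?g z)%R) =>
    apply: (@measurable_funD _ _ _ _ f g)
  | |- measurable_fun _ (fun z => (@?f z * @?g z)%R) =>
    apply: (@measurable_funM _ _ _ _ f g)
  | |- measurable_fun _ (fun z => (@?f z ^+ ?n)%R) =>
    apply: (@measurable_funX _ _ _ _ f n)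
  | |- measurable_fun _ (fun z => (- @?f z)%R) =>
    apply: (@measurable_funN _ _ _ _ f)
  | |- measurable_fun _ (+%R ?c) => apply: (@measurable_funD _ _ _ _ (fun=> c) id)
  | |- measurable_fun _ ( *%R ?c) => apply: (@measurable_funM _ _ _ _ (fun=> c) id)
  | |- measurable_fun _ id => exact: measurable_id
  | |- measurable_fun _ fst => exact: measurable_fst
  | |- measurable_fun _ snd => exact: measurable_snd
  | |- measurable_fun _ (fun z => z.1) => exact: measurable_fst
  | |- measurable_fun _ (fun z => z.2) => exact: measurable_snd
  | |- measurable_fun _ (fun z => (@?f z).1) =>
    refine (measurableT_comp measurable_fst (_ : measurable_fun _ f))
  | |- measurable_fun _ (fun z => (@?f z).2) =>
    refine (measurableT_comp measurable_snd (_ : measurable_fun _ f))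
  end.
Ltac meas := repeat meas_step.

Notation image_measure :=
  measure_function_pushforward__canonical__measure_function_Measure.

(** * Gaussian integrals on the line and in the plane *)

Section gaussian_line.
Context (R : realType).
Local Notation N := (@normal_prob R 0 1).
Local Notation mu := (@lebesgue_measure R).
Local Notation T := (measurableTypeR R).

Lemma ge0_integral_normal (f : T -> \bar R) :
  measurable_fun setT f -> (forall x, 0 <= f x)%E ->
  (\int[N]_x f x = \int[mu]_x (f x * (normal_pdf 0 1 x)%:E))%E.
Proof.
move=> mf f0.
apply: (@ge0_integral_density _ T R mu N (normal_pdf 0 1)) => //.
- exact: measurable_normal_pdf.
- by move=> x; exact: normal_pdf_ge0.
Qed.

(** The image of q times Lebesgue measure under x -> p + q x gives every interval ]a, b] its length,
    hence is Lebesgue measure. *)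
Lemma ge0_integral_affine (p q : R) (f : T -> \bar R) : 0 < q ->
  measurable_fun setT f -> (forall x, 0 <= f x)%E ->
  (\int[mu]_x f x = q%:E * \int[mu]_x f (p + q * x)%R)%E.
Proof.
move=> q0 mf f0; pose g (x : T) : T := p + q * x.
have mg : measurable_fun setT g by rewrite /g; meas.
pose q' : {nonneg R} := NngNum (ltW q0).
transitivity (\int[mscale q' (image_measure mu mg)]_x f x)%E.
  apply: eq_measure_integral => A mA _.
  apply: lebesgue_measure_unique => // _ [[a b]] _ <-.
  change (mu `]a, b] = (q%:E * mu (g @^-1` `]a, b]))%E).
  have -> : g @^-1` `]a, b] = `](a - p) / q, (b - p) / q]%classic.
    apply/seteqP; split => x /=; rewrite !in_itv /= /g;
      by rewrite ltr_pdivrMr// ler_pdivlMr// ltrBlDl lerBrDl (mulrC x).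
  rewrite !lebesgue_measure_itv /= !lte_fin ltr_pM2r ?invr_gt0// ltrD2r.
  case: ifPn => ab; last by rewrite mule0.
  rewrite -!EFinB -EFinM; congr EFin; field; exact: lt0r_neq0.
rewrite ge0_integral_mscale// ge0_integral_pushforward//.
Qed.

Lemma normal_pdf01E (x : R) : normal_pdf 0 1 x = normal_peak 1 * expR (- (x ^+ 2) / 2).
Proof.
rewrite normal_pdfE ?oner_neq0//= /normal_fun; congr (_ * expR _).
by rewrite subr0 expr1n.
Qed.

Lemma integral_normal_expR (A B C : R) : 0 < 1 + A ->
  (\int[N]_u (expR (- (A * u ^+ 2 + 2 * B * u + C) / 2))%:E =
   ((Num.sqrt (1 + A))^-1 * expR (B ^+ 2 / (2 * (1 + A)) - C / 2))%:E)%E.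
Proof.
move=> A0; have A1 : 1 + A != 0 by exact: lt0r_neq0.
rewrite ge0_integral_normal//; last first.
  apply/measurable_EFinP; apply: measurableT_comp => //.
  by meas.
(* Completing the square: the integrand times the standard normal density is the constant [K] below
   times the normal density of mean [m] and standard deviation [s]. *)
pose m := - B / (1 + A); pose s := (Num.sqrt (1 + A))^-1.
have s0 : 0 < s by rewrite invr_gt0 sqrtr_gt0.
set K := (X in _ = X%:E).
have sE : s ^+ 2 = (1 + A)^-1 by rewrite exprVn sqr_sqrtr// ltW.
have peakE : @normal_peak R 1 = normal_peak s * s.
  rewrite /normal_peak expr1n mul1r sE.
  have -> : (1 + A)^-1 * pi *+ 2 = s ^+ 2 * (pi *+ 2).
    by rewrite sE -[in LHS]mulr_natr -[in RHS]mulr_natr mulrA.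
  rewrite sqrtrM ?sqr_ge0// sqrtr_sqr gtr0_norm// invfM mulrAC mulVf ?mul1r//.
  exact: lt0r_neq0.
under eq_integral.
  move=> u _.
  have -> : ((expR (- (A * u ^+ 2 + 2 * B * u + C) / 2))%:E *
      (normal_pdf 0 1 u)%:E)%E = (K%:E * (normal_pdf m s u)%:E)%E.
    rewrite -!EFinM normal_pdf01E normal_pdfE ?lt0r_neq0//= peakE /K -/s /normal_fun.
    congr EFin; set X := normal_peak s.
    transitivity (X * s * (expR (- (A * u ^+ 2 + 2 * B * u + C) / 2) * expR (- u ^+ 2 / 2))).
      by rewrite mulrCA.
    transitivity (X * s * (expR (B ^+ 2 / (2 * (1 + A)) - C / 2) *
        expR (- (u - m) ^+ 2 / (s ^+ 2 *+ 2)))); last by ring.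
    congr (_ * _); rewrite -!expRD; congr expR.
    rewrite -mulr_natr sE /m; field.
    by rewrite ?A1 //.
  over.
rewrite ge0_integralZl//; last 3 first.
- by apply/measurable_EFinP; exact: measurable_normal_pdf.
- by move=> x _; rewrite lee_fin normal_pdf_ge0.
- by rewrite lee_fin /K mulr_ge0 ?expR_ge0// ltW.
by rewrite integral_normal_pdf mule1.
Qed.

(** The weight on the right is the density of N(p, q^2) relative to N(0, 1). *)
Lemma ge0_integral_normal_affine (p q : R) (f : T -> \bar R) : 0 < q ->
  measurable_fun setT f -> (forall x, 0 <= f x)%E ->
  (\int[N]_x f (p + q * x)%R =
   \int[N]_x (f x * (q^-1 * expR (- ((x - p) ^+ 2 / q ^+ 2 - x ^+ 2) / 2))%:E))%E.
Proof.
move=> q0 mf f0; have q1 : q != 0 by exact: lt0r_neq0.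
have mw : measurable_fun setT (fun x : T => q^-1 * expR (- ((x - p) ^+ 2 / q ^+ 2 - x ^+ 2) / 2)).
  by apply: measurable_funM => //; apply: measurableT_comp => //; meas.
have w0 (x : R) : 0 <= q^-1 * expR (- ((x - p) ^+ 2 / q ^+ 2 - x ^+ 2) / 2).
  by rewrite mulr_ge0 ?expR_ge0// invr_ge0 ltW.
have mpdf := @measurable_normal_pdf R 0 1.
have pdf0 := @normal_pdf_ge0 R 0 1.
rewrite ge0_integral_normal//; last first.
  by apply: (measurableT_comp mf); meas.
rewrite ge0_integral_normal//; last 2 first.
- by apply: emeasurable_funM; [exact: mf|apply/measurable_EFinP; exact: mw].
- by move=> x; apply: mule_ge0; rewrite ?lee_fin.
have mall : measurable_fun setT (fun x : T => (f x * (q^-1 * expR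
    (- ((x - p) ^+ 2 / q ^+ 2 - x ^+ 2) / 2))%:E * (normal_pdf 0 1 x)%:E)%E).
  apply: emeasurable_funM; last by apply/measurable_EFinP; exact: mpdf.
  by apply: emeasurable_funM; [exact: mf|apply/measurable_EFinP; exact: mw].
rewrite [RHS](@ge0_integral_affine p q)//; last first.
  by move=> x; rewrite !mule_ge0 ?lee_fin.
have maff : measurable_fun setT (fun x : T => p + q * x : T) by meas.
rewrite -ge0_integralZl//; last 3 first.
- exact: (measurableT_comp mall maff).
- by move=> x _; rewrite !mule_ge0 ?lee_fin.
- by rewrite lee_fin ltW.
apply: eq_integral => x _.
rewrite -[in RHS]muleA [RHS]muleCA -!EFinM !normal_pdf01E; congr (_ * _%:E)%E.
transitivity (normal_peak 1 * (expR (- ((p + q * x - p) ^+ 2 / q ^+ 2 -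
   (p + q * x) ^+ 2) / 2) * expR (- (p + q * x) ^+ 2 / 2))).
  by rewrite -expRD; congr (_ * expR _); field.
by field.
Qed.

(** Two one-dimensional substitutions replace a planar change of variables. For fixed y, u = c x + s
    y brings in the weight w u y and turns the second coordinate into (y - s u) / c. As c^2 + s^2 =
    1, w is the relative density of a pair with correlation s and so is symmetric; for fixed u, the
    same weight is therefore absorbed by the substitution y = s u + c v. *)
Lemma ge0_integral_normal_rotation (c s : R) (f : T * T -> \bar R) :
  0 < c -> c ^+ 2 + s ^+ 2 = 1 ->
  measurable_fun setT f -> (forall z, 0 <= f z)%E ->
  (\int[N]_x \int[N]_y f (c * x + s * y, - s * x + c * y)%R =
   \int[N]_x \int[N]_y f (x, y))%E.
Proof.
move=> c0 cs1 mf f0; have c1 : c != 0 by exact: lt0r_neq0.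
pose w (u v : R) : R := c^-1 * expR (- ((u - s * v) ^+ 2 / c ^+ 2 - u ^+ 2) / 2).
have wC u v : w u v = w v u.
  rewrite /w; congr (_ * expR (- _ / 2)); apply/eqP; rewrite -subr_eq0.
  have -> : (u - s * v) ^+ 2 / c ^+ 2 - u ^+ 2 - ((v - s * u) ^+ 2 / c ^+ 2 - v ^+ 2)
    = (1 - (c ^+ 2 + s ^+ 2)) * (u ^+ 2 - v ^+ 2) / c ^+ 2 by field.
  by rewrite cs1 subrr !mul0r.
have rotE (x y : R) : - s * x + c * y = (y - s * (s * y + c * x)) / c.
  transitivity (((c ^+ 2 + s ^+ 2) * y - s * (s * y + c * x)) / c).
    by field.
  by rewrite cs1 mul1r.
have w0 u v : 0 <= w u v by rewrite mulr_ge0 ?expR_ge0// invr_ge0 ltW.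
have mw : measurable_fun setT (fun z : T * T => w z.1 z.2).
  by apply: measurable_funM => //; apply: measurableT_comp => //; meas.
have mg : measurable_fun setT (fun z : T * T => f (z.1, (z.2 - s * z.1) / c)).
  by apply: (measurableT_comp mf); meas.
have mfrot : measurable_fun setT (fun z : T * T => f (c * z.1 + s * z.2, - s * z.1 + c * z.2)).
  by apply: (measurableT_comp mf); meas.
have mswap : measurable_fun setT (fun z : T * T => (z.2, z.1)) by meas.
transitivity (\int[N]_y \int[N]_x (f (x, ((y - s * x) / c)%R) * (w x y)%:E))%E.
  etransitivity; first exact: (fubini_tonelli _ mfrot).
  apply: eq_integral => y _.
  rewrite -(@ge0_integral_normal_affine (s * y) c (fun x => f (x, (y - s * x) / c)))//.
    apply: eq_integral => x _; congr f; congr pair; first exact: addrC.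
    exact: rotE.
  by apply: (measurableT_comp mf); meas.
etransitivity; first apply: (fubini_tonelli
    (fun z : T * T => f (z.2, ((z.1 - s * z.2) / c)%R) * (w z.2 z.1)%:E)%E).
- apply: emeasurable_funM; first exact: (measurableT_comp mg mswap).
  by apply/measurable_EFinP; exact: (measurableT_comp mw mswap).
- by move=> z; rewrite mule_ge0 ?lee_fin.
apply: eq_integral => x _.
under eq_integral do rewrite wC.
rewrite -(@ge0_integral_normal_affine (s * x) c (fun y => f (x, (y - s * x) / c)))//.
  by apply: eq_integral => y _; congr f; congr pair; field.
by apply: (measurableT_comp mf); meas.
Qed.

(** After the rotation that sends (p, q) / r to the first axis, the integrand depends on the first
    coordinate only. *)
Lemma ge0_integral_normalD (p q : R) (h : T -> \bar R) : 0 < p ->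
  measurable_fun setT h -> (forall z, 0 <= h z)%E ->
  (\int[N]_x \int[N]_y h (p * x + q * y)%R =
   \int[N]_x h (Num.sqrt (p ^+ 2 + q ^+ 2) * x)%R)%E.
Proof.
move=> p0 mh h0; set r := Num.sqrt _.
have pq0 : 0 < p ^+ 2 + q ^+ 2 by rewrite ltr_pwDl ?sqr_ge0// exprn_gt0.
have r0 : 0 < r by rewrite sqrtr_gt0.
have r1 : r != 0 by exact: lt0r_neq0.
have rE : r ^+ 2 = p ^+ 2 + q ^+ 2 by rewrite sqr_sqrtr// ltW.
have := @ge0_integral_normal_rotation (p / r) (q / r) (fun z => h (r * z.1)) _ _ _ _.
rewrite /= => H.
transitivity (\int[N]_x \int[N]_y h (r * (p / r * x + q / r * y))%R)%E.
  by apply: eq_integral => x _; apply: eq_integral => y _; congr h; field.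
rewrite H//.
- by apply: eq_integral => x _; rewrite integral_cst//= probability_setT mule1.
- by rewrite divr_gt0.
- by rewrite !expr_div_n -mulrDl -rE divff// expf_neq0.
- by apply: (measurableT_comp mh); meas.
Qed.

End gaussian_line.

(** * Correlated Gaussian pairs *)

Section bivariate.
Context (R : realType).
Local Notation N := (@normal_prob R 0 1).
Local Notation T := (measurableTypeR R).

Definition cocorr (a : R) : R := Num.sqrt (1 - a ^+ 2).

Lemma cocorr_gt0 a : a ^+ 2 < 1 -> 0 < cocorr a.
Proof. by move=> a1; rewrite sqrtr_gt0 subr_gt0. Qed.

Lemma cocorr_sqr a : a ^+ 2 < 1 -> cocorr a ^+ 2 = 1 - a ^+ 2.
Proof. by move=> a1; rewrite sqr_sqrtr// subr_ge0 ltW. Qed.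

(* Density at [(x, y)] of the centered Gaussian law on the plane with unit
   variances and correlation [a], relative to the standard Gaussian law. *)
Definition corr_density (a x y : R) : R :=
  (cocorr a)^-1 * expR (- ((y - a * x) ^+ 2 / cocorr a ^+ 2 - y ^+ 2) / 2).

Lemma corr_density_ge0 a x y : 0 <= corr_density a x y.
Proof. by rewrite mulr_ge0 ?expR_ge0// invr_ge0 sqrtr_ge0. Qed.

Lemma measurable_corr_density a :
  measurable_fun setT (fun z : T * T => corr_density a z.1 z.2).
Proof.
by apply: measurable_funM => //; apply: measurableT_comp => //; meas.
Qed.

(** This second moment is one plus the chi-square divergence a^2 / (1 - a^2). Both integrals are
    instances of [integral_normal_expR]: squaring doubles the exponent, so the coefficient of y^2 is
    2 / s^2 - 2, and what remains is again quadratic in x. *)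
Lemma integral_corr_density_sqr (a : R) : a ^+ 2 < 1 ->
  (\int[N]_x \int[N]_y (corr_density a x y ^+ 2)%:E = ((1 - a ^+ 2)^-1)%:E)%E.
Proof.
move=> a1; set s := cocorr a; have s0 : 0 < s by exact: cocorr_gt0.
have s1 : s != 0 by exact: lt0r_neq0.
have sE : s ^+ 2 = 1 - a ^+ 2 by exact: cocorr_sqr.
have a20 : 0 < 1 + a ^+ 2 by rewrite ltr_pwDl ?sqr_ge0.
have a21 : 1 + a ^+ 2 != 0 by exact: lt0r_neq0.
have s2 : 1 - a ^+ 2 != 0 by rewrite -sE expf_neq0.
pose A : R := 2 / s ^+ 2 - 2.
have AE : 1 + A = (1 + a ^+ 2) / s ^+ 2 by rewrite /A sE; field.
have A0 : 0 < 1 + A by rewrite AE divr_gt0// exprn_gt0.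
have inner x : (\int[N]_y (corr_density a x y ^+ 2)%:E =
    ((s * Num.sqrt (1 + a ^+ 2))^-1 *
     expR (- (- (2 * a ^+ 2 / (1 + a ^+ 2)) * x ^+ 2 + 2 * 0 * x + 0) / 2))%:E)%E.
  pose B : R := - (2 * a * x / s ^+ 2); pose C : R := 2 * a ^+ 2 * x ^+ 2 / s ^+ 2.
  rewrite (eq_integral (fun y : T => ((s ^- 2)%:E *
      (expR (- (A * y ^+ 2 + 2 * B * y + C) / 2))%:E)%E)); last first.
    move=> y _; rewrite -EFinM /corr_density -/s exprMn exprVn -expRM_natl.
    by congr (_ * expR _)%:E; rewrite /A /B /C; field.
  rewrite ge0_integralZl//; last 2 first.
  - by apply/measurable_EFinP; apply: measurableT_comp => //; meas.
  - by rewrite lee_fin invr_ge0 sqr_ge0.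
  rewrite integral_normal_expR// -EFinM mulrA AE; congr (_ * expR _)%:E.
    rewrite sqrtrM ?ltW// sqrtrV ?sqr_ge0// sqrtr_sqr gtr0_norm//.
    by field; rewrite s1 gt_eqF// sqrtr_gt0.
  rewrite /B /C sE; field.
  by rewrite s2 a21.
under eq_integral do rewrite inner.
under eq_integral do rewrite EFinM.
rewrite ge0_integralZl//; last 2 first.
- by apply/measurable_EFinP; apply: measurableT_comp => //; meas.
- by rewrite lee_fin invr_ge0 mulr_ge0 ?sqrtr_ge0// ltW.
have BE : 1 + - (2 * a ^+ 2 / (1 + a ^+ 2)) = s ^+ 2 / (1 + a ^+ 2) by rewrite sE; field.
rewrite integral_normal_expR BE; last by rewrite divr_gt0// exprn_gt0.
rewrite expr0n /= !mul0r subrr expR0 mulr1 -EFinM -sE.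
rewrite sqrtrM ?sqr_ge0// sqrtrV ?ltW// sqrtr_sqr gtr0_norm//.
congr EFin; field; by rewrite s1 gt_eqF// sqrtr_gt0.
Qed.

Definition normal2 : probability (T * T)%type R := (N \x N)%E.
Local Notation N2 := normal2.

Lemma ge0_integral_normal2 (f : T * T -> \bar R) :
  measurable_fun setT f -> (forall z, 0 <= f z)%E ->
  (\int[N2]_z f z = \int[N]_x \int[N]_y f (x, y))%E.
Proof. exact: fubini_tonelli1. Qed.

Lemma ge0_integral_corr (a : R) (f : T * T -> \bar R) : a ^+ 2 < 1 ->
  measurable_fun setT f -> (forall z, 0 <= f z)%E ->
  (\int[N2]_z f (z.1, (a * z.1 + cocorr a * z.2)%R) =
   \int[N2]_z (f z * (corr_density a z.1 z.2)%:E))%E.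
Proof.
move=> a1 mf f0.
etransitivity; first apply: ge0_integral_normal2.
- by apply: (measurableT_comp mf); meas.
- by move=> z; exact: f0.
etransitivity; last first.
  symmetry; apply: ge0_integral_normal2.
- apply: emeasurable_funM; first exact: mf.
  by apply/measurable_EFinP; exact: measurable_corr_density.
- by move=> z; rewrite mule_ge0 ?lee_fin ?corr_density_ge0.
apply: eq_integral => x _.
rewrite (@ge0_integral_normal_affine _ (a * x) (cocorr a) (fun y => f (x, y)))//.
  exact: cocorr_gt0.
by apply: (measurableT_comp mf); meas.
Qed.

(** Rotate the two first coordinates x, x' by 45 degrees into u, w: then x - x' = sqrt 2 u and a x -
    b x' = (a + b) / sqrt 2 u + (a - b) / sqrt 2 w. The terms independent of u merge into one
    Gaussian variable of variance (a - b)^2 / 2 + (1 - a^2) + (1 - b^2) = 2 - (a + b)^2 / 2, so a -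
    b disappears. *)
Lemma ge0_integral_corr_sub (a b : R) (f : T * T -> \bar R) :
  a ^+ 2 < 1 -> b ^+ 2 < 1 ->
  measurable_fun setT f -> (forall z, 0 <= f z)%E ->
  (\int[N2]_z \int[N2]_z' f (z.1 - z'.1,
      (a * z.1 + cocorr a * z.2) - (b * z'.1 + cocorr b * z'.2))%R =
   \int[N]_u \int[N]_w f (Num.sqrt 2 * u,
      (a + b) / Num.sqrt 2 * u + Num.sqrt (2 - (a + b) ^+ 2 / 2) * w)%R)%E.
Proof.
move=> a1 b1 mf f0.
pose r2 : R := (Num.sqrt 2)^-1.
have s20 : 0 < Num.sqrt 2 :> R by rewrite sqrtr_gt0.
have r20 : 0 < r2 by rewrite invr_gt0.
have s22 : Num.sqrt 2 ^+ 2 = 2 :> R by rewrite sqr_sqrtr.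
have r22 : r2 ^+ 2 = 2^-1 by rewrite /r2 exprVn s22.
set s := cocorr a; set s' := cocorr b.
have s0 : 0 < s by exact: cocorr_gt0.
pose F (q : (T * T) * (T * T)) : \bar R := f (q.1.1 - q.1.2,
  (a * q.1.1 + s * q.2.1) - (b * q.1.2 + s' * q.2.2)).
have mF : measurable_fun setT F by apply: (measurableT_comp mf); meas.
have F0 q : (0 <= F q)%E by exact: f0.
have mFp p : measurable_fun setT (fun y => F (p, y)).
  exact: (measurableT_comp mF (pair1_measurable p)).
pose G (p : T * T) : \bar R := (\int[N2]_y F (p, y))%E.
have mG : measurable_fun setT G.
  exact: (measurable_fun_fubini_tonelli_F F mF F0).
have G0 p : (0 <= G p)%E by exact: integral_ge0.
transitivity (\int[N]_x \int[N]_x' G (x, x'))%E.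
  pose F' (q : (T * T) * (T * T)) := F ((q.1.1, q.2.1), (q.1.2, q.2.2)).
  have mF' : measurable_fun setT F' by apply: (measurableT_comp mF); meas.
  have F'0 q : (0 <= F' q)%E by exact: f0.
  have mF'1 p : measurable_fun setT (fun y => F' (p, y)).
    exact: (measurableT_comp mF' (pair1_measurable p)).
  etransitivity; first apply: ge0_integral_normal2.
  - exact: (measurable_fun_fubini_tonelli_F F' mF' F'0).
  - by move=> z; apply: integral_ge0 => z' _; exact: f0.
  apply: eq_integral => x _.
  pose F3 (q : (T * T) * T) := F ((x, q.1.2), (q.1.1, q.2)).
  have mF3 : measurable_fun setT F3 by apply: (measurableT_comp mF); meas.
  have F30 q : (0 <= F3 q)%E by exact: f0.
  pose F4 (p : T * T) : \bar R := (\int[N]_y' F3 (p, y'))%E.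
  transitivity (\int[N]_y \int[N]_x' F4 (y, x'))%E.
    apply: eq_integral => y _; apply: ge0_integral_normal2; first exact: (mF'1 (x, y)).
    by move=> z; exact: f0.
  etransitivity.
    apply: (fubini_tonelli F4) => [|p]; last first.
      by apply: integral_ge0 => z' _; exact: f0.
    exact: (measurable_fun_fubini_tonelli_F F3 mF3 F30).
  apply: eq_integral => x' _; symmetry; apply: ge0_integral_normal2; first exact: (mFp (x, x')).
  by move=> z; exact: f0.
have r2E : r2 ^+ 2 + r2 ^+ 2 = 1 by rewrite r22; field.
etransitivity.
  symmetry; exact: (@ge0_integral_normal_rotation _ r2 r2 G r20 r2E mG G0).
apply: eq_integral => u _.
pose h (z : T) : \bar R := f (Num.sqrt 2 * u, (a + b) * r2 * u + z).
have mh : measurable_fun setT h by apply: (measurableT_comp mf); meas.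
have h0 z : (0 <= h z)%E by exact: f0.
pose beta := (a - b) * r2.
pose H (z : T) : \bar R := (\int[N]_y h (z - s' * y)%R)%E.
have mH : measurable_fun setT H.
  apply: (measurable_fun_fubini_tonelli_F (fun z : T * T => h (z.1 - s' * z.2))) => [|z].
    by apply: (measurableT_comp mh); meas.
  exact: h0.
have H0 z : (0 <= H z)%E by exact: integral_ge0.
transitivity (\int[N]_w \int[N]_y H (beta * w + s * y)%R)%E.
  apply: eq_integral => w _.
  rewrite /G ge0_integral_normal2; [|exact: mFp|by move=> z; exact: f0].
  apply: eq_integral => y _; apply: eq_integral => y' _.
  rewrite /F /h /=; congr f; congr pair.
    have -> : Num.sqrt 2 = 2 * r2 by rewrite -[X in _ = X * _]s22 expr2 mulfK// lt0r_neq0.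
    ring.
  rewrite /beta; ring.
etransitivity.
  apply: (fubini_tonelli (fun z : T * T => H (beta * z.1 + s * z.2))) => [|z].
    by apply: (measurableT_comp mH); meas.
  exact: H0.
(* [ge0_integral_normalD] asks for a positive first coefficient; [beta] may vanish or be negative,
   so [s] is moved to the front. *)
transitivity (\int[N]_y \int[N]_w H (s * y + beta * w)%R)%E.
  by apply: eq_integral => y _; apply: eq_integral => w _; rewrite addrC.
rewrite ge0_integral_normalD//.
set r := Num.sqrt (s ^+ 2 + _).
have r0 : 0 < r by rewrite sqrtr_gt0 ltr_pwDl ?sqr_ge0// exprn_gt0.
transitivity (\int[N]_x \int[N]_y h (r * x + (- s') * y)%R)%E.
  by apply: eq_integral => x _; apply: eq_integral => y _; rewrite mulNr.
rewrite ge0_integral_normalD//.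
apply: eq_integral => w _; congr f; congr (_, _ + Num.sqrt _ * _).
rewrite sqr_sqrtr; last by rewrite addr_ge0 ?sqr_ge0.
by rewrite sqrrN !cocorr_sqr// /beta exprMn r22; field.
Qed.

End bivariate.

(** * Gaussian vectors with one correlated pair of coordinates *)

Section corr_gauss.
Context (R : realType) (n : nat) (i j : 'I_n) (ij : i != j).
Local Notation N := (@normal_prob R 0 1).
Local Notation T := (measurableTypeR R).
Local Notation N2 := (@normal2 R).

Definition shear_mx (p q : R) : 'M[R]_n :=
  \matrix_(l, m) if m == j then (l == i)%:R * p + (l == j)%:R * q else (l == m)%:R.

Lemma mul_row_shear (x : 'rV[R]_n) p q l :
  (x *m shear_mx p q) 0 l = if l == j then x 0 i * p + x 0 j * q else x 0 l.
Proof.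
rewrite mxE; case: eqP => [->|/eqP lj].
  rewrite (bigD1 i)//= (bigD1 j) 1?eq_sym//= !mxE !eqxx [j == i]eq_sym (negbTE ij).
  rewrite big1 => [|m /andP[mi mj]]; first by rewrite !mul1r !mul0r !addr0 add0r.
  by rewrite !mxE eqxx (negbTE mi) (negbTE mj) !mul0r addr0 mulr0.
rewrite (bigD1 l)//= !mxE (negbTE lj) eqxx mulr1 big1 ?addr0// => m ml.
by rewrite !mxE (negbTE lj) (negbTE ml) mulr0.
Qed.

Lemma shear_mx_unit p q : q != 0 -> shear_mx p q \in unitmx.
Proof.
move=> q0; suff /mulmx1_unit[] : shear_mx p q *m shear_mx (- p / q) (q^-1) = 1%:M by [].
apply/row_matrixP => k; rewrite row_mul rowE; apply/rowP => l.
rewrite mul_row_shear -!rowE !mxE ?eqxx; case: eqP => [->|/eqP lj].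
  by rewrite (negbTE ij); field.
by [].
Qed.

Definition corr_mx (a : R) : 'M[R]_n := shear_mx a (cocorr a).

Definition corr_gauss (a : R) : probability 'rV[R]_n R := gaussian 0 (corr_mx a).

(** Separates the correlated pair from the other coordinates, which under [corr_gauss] are standard
    normal and independent of it. *)
Definition put (t : 'rV[R]_n) (x y : R) : 'rV[R]_n :=
  \row_l if l == i then x else if l == j then y else t 0 l.

Definition row_of_tuple (t : n.-tuple T) : 'rV[R]_n := \row_l tnth t l.

Lemma put_i t x y : put t x y 0 i = x. Proof. by rewrite mxE eqxx. Qed.

Lemma put_j t x y : put t x y 0 j = y.
Proof. by rewrite mxE eq_sym (negbTE ij) eqxx. Qed.

Lemma affine_row_corr a t : affine_row 0 (corr_mx a) t =
  put (row_of_tuple t) (tnth t i) (a * tnth t i + cocorr a * tnth t j).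
Proof.
apply/rowP => l; rewrite /affine_row add0r mul_row_shear !mxE.
case: eqP => [->|lj]; first by rewrite eq_sym (negbTE ij) !(mulrC (tnth _ _)).
by case: eqP => // ->.
Qed.

Lemma measurable_row_of_tuple : measurable_fun setT row_of_tuple.
Proof.
apply: measurable_mxP => k l.
apply: (eq_measurable_fun (fun t : n.-tuple T => tnth t l)); last exact: measurable_tnth.
by move=> x _; rewrite /row_of_tuple mxE.
Qed.

Lemma measurable_put d' (X : measurableType d') (r : X -> 'rV[R]_n) (x y : X -> T) :
  measurable_fun setT r -> measurable_fun setT x -> measurable_fun setT y ->
  measurable_fun setT (fun z => put (r z) (x z) (y z)).
Proof.
move=> mr mx my; apply: measurable_mxP => k l.
apply: (eq_measurable_fun
  (fun z => if l == i then x z else if l == j then y z else r z k l)).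
  by move=> z _; rewrite /put mxE ord1.
case: (l == i) => //; case: (l == j) => //.
exact: (measurableT_comp (measurable_coord k l) mr).
Qed.

(** Resampling entries [j] and [i] of the underlying normal tuple exposes the pair; the outer [t]
    keeps its entries there, but [put] overwrites them. *)
Lemma ge0_integral_corr_gauss a (f : 'rV[R]_n -> \bar R) :
  measurable_fun setT f -> (forall x, 0 <= f x)%E ->
  (\int[corr_gauss a]_x f x = \int[iid N n]_t \int[N2]_z
     f (put (row_of_tuple t) z.1 (a * z.1 + cocorr a * z.2)))%E.
Proof.
move=> mf f0; rewrite ge0_integral_distribution//.
pose F t := f (affine_row 0 (corr_mx a) t).
have mF : measurable_fun setT F.
  by apply: measurableT_comp => //; exact: measurable_affine_row.
have F0 t : (0 <= F t)%E by exact: f0.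
pose F2 (z : n.-tuple T * T) := F (upd j z.1 z.2).
have mF2 : measurable_fun setT F2 by exact: (measurableT_comp mF (measurable_upd j)).
have F20 z : (0 <= F2 z)%E by exact: f0.
transitivity (\int[iid N n]_t F t)%E; first by [].
etransitivity; first exact: (@ge0_integral_iid_upd _ T R N n j F mF F0).
etransitivity; first apply: (@ge0_integral_iid_upd _ T R N n i).
- exact: (measurable_fun_fubini_tonelli_F F2 mF2 F20).
- by move=> t; apply: integral_ge0 => z _; exact: f0.
apply: eq_integral => t _.
etransitivity; last (symmetry; apply: ge0_integral_normal2).
- apply: eq_integral => x _; apply: eq_integral => y _.
  rewrite /F affine_row_corr !tnth_upd !eqxx (negbTE ij) /=.
  congr f; apply/rowP => l; rewrite !mxE.
  by case: eqP => // /eqP li; case: eqP => // /eqP lj; rewrite !tnth_upd (negbTE li) (negbTE lj).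
- apply: (measurableT_comp mf); apply: measurable_put; [exact: measurable_cst|by meas..].
- by move=> z; exact: f0.
Qed.

Lemma ge0_integral_corr_gauss_density a (f : 'rV[R]_n -> \bar R) : a ^+ 2 < 1 ->
  measurable_fun setT f -> (forall x, 0 <= f x)%E ->
  (\int[corr_gauss a]_x f x = \int[iid N n]_t \int[N2]_z
     (f (put (row_of_tuple t) z.1 z.2) * (corr_density a z.1 z.2)%:E))%E.
Proof.
move=> a1 mf f0; etransitivity; first exact: ge0_integral_corr_gauss.
apply: eq_integral => t _.
apply: (ge0_integral_corr a1 (f := fun z => f (put (row_of_tuple t) z.1 z.2))).
  by apply: (measurableT_comp mf); apply: measurable_put; [exact: measurable_cst|meas..].
by move=> z; exact: f0.
Qed.

Lemma corr_density0 x y : corr_density 0 x y = 1 :> R.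
Proof.
have c01 : cocorr 0 = 1 :> R by rewrite /cocorr expr0n subr0 sqrtr1.
by rewrite /corr_density c01 mul0r subr0 expr1n divr1 subrr oppr0 mul0r expR0 invr1 mulr1.
Qed.

Lemma sqr0_lt1 : 0 ^+ 2 < 1 :> R. Proof. by rewrite expr0n. Qed.

Lemma ge0_integral_corr_gauss0 (f : 'rV[R]_n -> \bar R) :
  measurable_fun setT f -> (forall x, 0 <= f x)%E ->
  (\int[corr_gauss 0]_x f x = \int[iid N n]_t \int[N2]_z
     f (put (row_of_tuple t) z.1 z.2))%E.
Proof.
move=> mf f0.
etransitivity; first exact: (ge0_integral_corr_gauss_density sqr0_lt1 mf f0).
by apply: eq_integral => t _; apply: eq_integral => z _; rewrite corr_density0 mule1.
Qed.

Definition corr_ratio a (x : 'rV[R]_n) : R := corr_density a (x 0 i) (x 0 j).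

Lemma corr_ratio_ge0 a x : 0 <= corr_ratio a x.
Proof. exact: corr_density_ge0. Qed.

Lemma measurable_corr_ratio a : measurable_fun setT (corr_ratio a).
Proof.
have m : measurable_fun setT (fun x : 'rV[R]_n => (x 0 i : T, x 0 j : T)).
  by apply: measurable_fun_pair; exact: measurable_coord.
exact: (measurableT_comp (measurable_corr_density a) m).
Qed.

(** Only the pair of coordinates [i], [j] depends on [a], so the planar density is also the density
    on the whole space relative to [corr_gauss 0]. *)
Lemma ge0_integral_corr_ratio a (f : 'rV[R]_n -> \bar R) : a ^+ 2 < 1 ->
  measurable_fun setT f -> (forall x, 0 <= f x)%E ->
  (\int[corr_gauss a]_x f x = \int[corr_gauss 0]_x (f x * (corr_ratio a x)%:E))%E.
Proof.
move=> a1 mf f0; etransitivity; first exact: (ge0_integral_corr_gauss_density a1 mf f0).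
etransitivity; last (symmetry; apply: ge0_integral_corr_gauss0).
- apply: eq_integral => t _; apply: eq_integral => z _.
  by rewrite /corr_ratio put_i put_j.
- by apply: emeasurable_funM; [exact: mf|apply/measurable_EFinP; exact: measurable_corr_ratio].
- by move=> x; rewrite mule_ge0 ?lee_fin ?corr_ratio_ge0.
Qed.

Lemma corr_gaussE a A : a ^+ 2 < 1 -> measurable A ->
  corr_gauss a A = (\int[corr_gauss 0]_(x in A) (corr_ratio a x)%:E)%E.
Proof.
move=> a1 mA; transitivity (\int[corr_gauss a]_x (\1_A x)%:E)%E.
  by rewrite integral_indic// setIT.
etransitivity; first apply: (ge0_integral_corr_ratio a1).
- by apply/measurable_EFinP; exact: measurable_indic.
- by move=> x; rewrite lee_fin.
rewrite [RHS]integral_mkcond; apply: eq_integral => x _.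
by rewrite muleC epatch_indic.
Qed.

Lemma integral_corr_ratio_sqr a : a ^+ 2 < 1 ->
  (\int[corr_gauss 0]_x (corr_ratio a x ^+ 2)%:E = ((1 - a ^+ 2)^-1)%:E)%E.
Proof.
move=> a1; rewrite ge0_integral_corr_gauss0//; last 2 first.
- apply/measurable_EFinP; apply: measurable_funX; exact: measurable_corr_ratio.
- by move=> x; rewrite lee_fin sqr_ge0.
under eq_integral.
  move=> t _; under eq_integral do rewrite /corr_ratio put_i put_j.
  rewrite ge0_integral_normal2; last 2 first.
  + by apply/measurable_EFinP; apply: measurable_funX; exact: measurable_corr_density.
  + by move=> z; rewrite lee_fin sqr_ge0.
  rewrite /= integral_corr_density_sqr//; over.
by rewrite integral_cst//= probability_setT mule1.
Qed.

End corr_gauss.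

Lemma measurable_rowB (R : realType) n :
  measurable_fun setT (fun z : 'rV[R]_n * 'rV[R]_n => z.1 - z.2).
Proof.
apply: measurable_mxP => k l.
apply: (eq_measurable_fun (fun z : 'rV[R]_n * 'rV[R]_n => z.1 k l - z.2 k l)).
  by move=> z _; rewrite !mxE.
apply: measurable_funB.
- exact: (measurableT_comp (measurable_coord k l) measurable_fst).
- exact: (measurableT_comp (measurable_coord k l) measurable_snd).
Qed.

Lemma normal_probN (R : realType) (A : set (measurableTypeR R)) : measurable A ->
  @normal_prob R 0 1 (-%R @^-1` A) = @normal_prob R 0 1 A.
Proof.
move=> mA; pose T := measurableTypeR R.
have mopp : measurable_fun setT (-%R : T -> T) by exact: oppr_measurable.
pose f (x : T) : \bar R := ((\1_A x)%:E * (normal_pdf 0 1 x)%:E)%E.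
have mf : measurable_fun setT f.
  apply: emeasurable_funM; apply/measurable_EFinP; first exact: measurable_indic.
  exact: measurable_normal_pdf.
have f0 x : (0 <= f x)%E by rewrite mule_ge0// lee_fin ?normal_pdf_ge0.
have E (B : set T) : measurable B -> normal_prob 0 1 B =
    (\int[@lebesgue_measure R]_x ((\1_B x)%:E * (normal_pdf 0 1 x)%:E))%E.
  move=> mB; rewrite /normal_prob integral_mkcond; apply: eq_integral => x _.
  by rewrite muleC epatch_indic.
rewrite !E//; last by rewrite -[X in measurable X]setTI; exact: mopp.
transitivity (\int[image_measure (@lebesgue_measure R) mopp]_x f x)%E; last first.
  by apply: eq_measure_integral => B mB _; exact: lebesgue_measureN.
etransitivity; last first.
  symmetry; apply: (ge0_integral_pushforward mopp (@lebesgue_measure R) measurableT mf).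
  by move=> x _; exact: f0.
rewrite preimage_setT.
apply: eq_integral => x _; rewrite /f /= !normal_pdf01E sqrrN.
by congr (_%:E * _)%E; rewrite !indicE.
Qed.

Section corr_gauss_laws.
Context (R : realType) (n : nat) (i j : 'I_n) (ij : i != j).
Local Notation N := (@normal_prob R 0 1).
Local Notation T := (measurableTypeR R).
Local Notation N2 := (@normal2 R).
Local Notation P := (@corr_gauss R n i j).
Local Notation put := (@put R n i j).

Lemma put_sub t t' x x' y y' : put t x y - put t' x' y' = put (t - t') (x - x') (y - y').
Proof. by apply/rowP => l; rewrite !mxE; case: eqP => // _; case: eqP. Qed.

Lemma ge0_integral_corr_gauss_sub a b (f : 'rV[R]_n -> \bar R) :
  a ^+ 2 < 1 -> b ^+ 2 < 1 ->
  measurable_fun setT f -> (forall x, 0 <= f x)%E ->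
  (\int[P a]_x \int[P b]_y f (x - y)%R = \int[iid N n]_t \int[iid N n]_t'
    \int[N]_u \int[N]_w f (put (row_of_tuple t - row_of_tuple t') (Num.sqrt 2 * u)
      ((a + b) / Num.sqrt 2 * u + Num.sqrt (2 - (a + b) ^+ 2 / 2) * w))%R)%E.
Proof.
move=> a1 b1 mf f0.
pose F (z : 'rV[R]_n * 'rV[R]_n) := f (z.1 - z.2).
have mF : measurable_fun setT F by exact: (measurableT_comp mf (@measurable_rowB R n)).
have F0 z : (0 <= F z)%E by exact: f0.
etransitivity; first apply: (ge0_integral_corr_gauss ij).
- exact: (measurable_fun_fubini_tonelli_F F mF F0).
- by move=> x; apply: integral_ge0 => y _; exact: f0.
apply: eq_integral => t _.
pose Z c t' (z : T * T) := put (row_of_tuple t') z.1 (c * z.1 + cocorr c * z.2).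
have mZ c t' : measurable_fun setT (Z c t').
  by apply: measurable_put; [exact: measurable_cst|meas..].
transitivity (\int[N2]_z \int[iid N n]_t' \int[N2]_z' f (Z a t z - Z b t' z')%R)%E.
  apply: eq_integral => z _; apply: (ge0_integral_corr_gauss ij).
    exact: (measurableT_comp mF (pair1_measurable (Z a t z))).
  by move=> x; exact: f0.
pose F3 (q : ((T * T) * n.-tuple T) * (T * T)) := f (Z a t q.1.1 - Z b q.1.2 q.2)%R.
have mF3 : measurable_fun setT F3.
  have mp : measurable_fun setT (fun q : ((T * T) * n.-tuple T) * (T * T) =>
      (Z a t q.1.1, Z b q.1.2 q.2)); last exact: (measurableT_comp mF mp).
  apply: measurable_fun_pair; apply: measurable_put.
  - exact: measurable_cst.
  - by meas.
  - by meas.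
  - apply: (measurableT_comp (@measurable_row_of_tuple R n)).
    by meas.
  - by meas.
  - by meas.
have F30 q : (0 <= F3 q)%E by exact: f0.
pose F4 (p : (T * T) * n.-tuple T) : \bar R := (\int[N2]_z' F3 (p, z'))%E.
etransitivity.
  apply: (fubini_tonelli (m1 := N2) (m2 := iid N n) F4) => [|p]; last first.
    by apply: integral_ge0 => z' _; exact: f0.
  exact: (measurable_fun_fubini_tonelli_F F3 mF3 F30).
apply: eq_integral => t' _.
pose g (p : T * T) := f (put (row_of_tuple t - row_of_tuple t') p.1 p.2).
transitivity (\int[N2]_z \int[N2]_z' g (z.1 - z'.1,
      (a * z.1 + cocorr a * z.2) - (b * z'.1 + cocorr b * z'.2))%R)%E.
  apply: eq_integral => z _; apply: eq_integral => z' _.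
  by rewrite /F3 /Z put_sub.
apply: (ge0_integral_corr_sub a1 b1).
  by apply: (measurableT_comp mf); apply: measurable_put; [exact: measurable_cst|meas..].
by move=> p; exact: f0.
Qed.

(** An event that ignores entry [i] sees [a] only through entry [j], which is a x + sqrt (1 - a^2) y
    and has variance 1 for every [a]. *)
Lemma corr_gauss_free_i a A : a ^+ 2 < 1 -> measurable A ->
  (forall t x x' y, A (put t x y) -> A (put t x' y)) -> P a A = P 0 A.
Proof.
move=> a1 mA Ai.
have mI : measurable_fun setT (fun x : 'rV[R]_n => (\1_A x)%:E : \bar R).
  by apply/measurable_EFinP; exact: measurable_indic.
have I0 x : (0 <= (\1_A x)%:E :> \bar R)%E by rewrite lee_fin.
have PE c : P c A = (\int[P c]_x (\1_A x)%:E)%E by rewrite integral_indic// setIT.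
rewrite !PE.
etransitivity; first exact: (@ge0_integral_corr_gauss R n i j ij a (fun x => (\1_A x)%:E) mI I0).
etransitivity; last (symmetry; exact: (@ge0_integral_corr_gauss0 R n i j ij (fun x => (\1_A x)%:E) mI I0)).
apply: eq_integral => t _.
pose h (y : T) : \bar R := (\1_A (put (row_of_tuple t) 0 y))%:E.
have hE x y : (\1_A (put (row_of_tuple t) x y))%:E = h y.
  rewrite /h !indicE; congr ((nat_of_bool _)%:R)%:E; apply/idP/idP; rewrite !inE; exact: Ai.
have mh : measurable_fun setT h.
  have mp : measurable_fun setT (fun y : T => put (row_of_tuple t) 0 y);
    last exact: (measurableT_comp mI mp).
  apply: measurable_put; [exact: measurable_cst|exact: measurable_cst|exact: measurable_id].
have h0 y : (0 <= h y)%E by exact: I0.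
under eq_integral do rewrite hE.
under [RHS]eq_integral do rewrite hE.
etransitivity; first apply: ge0_integral_normal2.
- by apply: (measurableT_comp mh); meas.
- by move=> z; exact: h0.
etransitivity; last (symmetry; apply: ge0_integral_normal2); last 2 first.
- by apply: (measurableT_comp mh); meas.
- by move=> z; exact: h0.
etransitivity.
  apply: (fubini_tonelli (fun z : T * T => h (a * z.1 + cocorr a * z.2))) => [|z].
    by apply: (measurableT_comp mh); meas.
  exact: h0.
transitivity (\int[N]_y \int[N]_x h (cocorr a * y + a * x)%R)%E.
  by apply: eq_integral => y _; apply: eq_integral => x _; rewrite addrC.
etransitivity; first exact: (ge0_integral_normalD _ (cocorr_gt0 a1) mh h0).
rewrite cocorr_sqr// subrK sqrtr1.
by rewrite /= integral_cst//= probability_setT mule1; apply: eq_integral => x _; rewrite mul1r.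
Qed.

Lemma corr_gauss_free_j a A : a ^+ 2 < 1 -> measurable A ->
  (forall t x y y', A (put t x y) -> A (put t x y')) -> P a A = P 0 A.
Proof.
move=> a1 mA Aj.
have mI : measurable_fun setT (fun x : 'rV[R]_n => (\1_A x)%:E : \bar R).
  by apply/measurable_EFinP; exact: measurable_indic.
have I0 x : (0 <= (\1_A x)%:E :> \bar R)%E by rewrite lee_fin.
have PE c : P c A = (\int[P c]_x (\1_A x)%:E)%E by rewrite integral_indic// setIT.
rewrite !PE.
etransitivity; first exact: (@ge0_integral_corr_gauss R n i j ij a (fun x => (\1_A x)%:E) mI I0).
etransitivity; last (symmetry; exact: (@ge0_integral_corr_gauss0 R n i j ij (fun x => (\1_A x)%:E) mI I0)).
apply: eq_integral => t _; apply: eq_integral => z _.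
rewrite !indicE; congr ((nat_of_bool _)%:R)%:E; apply/idP/idP; rewrite !inE; exact: Aj.
Qed.

Lemma corr_gauss0_box (A : 'I_n -> set T) : (forall l, measurable (A l)) ->
  P 0 [set x | forall l, A l (x 0 l)] = (\prod_(l < n) N (A l))%E.
Proof.
move=> mA; rewrite -(@iid_tuple_box _ T R N n A mA).
congr (iid N n _); apply/seteqP; split => t /= h l; have := h l;
  rewrite affine_row_corr // !mxE; case: eqP => [->//|_]; case: eqP => [->|//];
  by rewrite /cocorr expr0n subr0 sqrtr1 mul0r add0r mul1r.
Qed.

Definition flip_row (S : pred 'I_n) (x : 'rV[R]_n) : 'rV[R]_n :=
  \row_l if S l then - x 0 l else x 0 l.

(** The signs are flipped on the independent normals behind the vector, whose joint law is symmetric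
    in each coordinate. As [S] contains [j] but not [i], the flip passes through the shear at the
    cost of the sign of [a]. *)
Lemma corr_gauss_flip (S : pred 'I_n) a A : ~~ S i -> S j -> measurable A ->
  P (- a) A = P a (flip_row S @^-1` A).
Proof.
move=> Si Sj mA.
pose g (l : 'I_n) (x : T) : T := if S l then - x else x.
have mg l : measurable_fun setT (g l).
  by rewrite /g; case: (S l); [exact: oppr_measurable|exact: measurable_id].
have gN l B : measurable B -> N (g l @^-1` B) = N B.
  by move=> mB; rewrite /g; case: (S l) => //; exact: normal_probN.
have mB : measurable ((affine_row 0 (corr_mx i j (- a))) @^-1` A).
  by rewrite -[X in measurable X]setTI; exact: measurable_affine_row.
rewrite [LHS]/(P (- a) A) /corr_gauss.
transitivity (iid N n ((affine_row 0 (corr_mx i j (- a))) @^-1` A)); first by [].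
rewrite -(iid_map mg gN mB); congr (iid N n _).
have E t : affine_row 0 (corr_mx i j (- a)) [tuple g l (tnth t l) | l < n] =
    flip_row S (affine_row 0 (corr_mx i j a) t).
  rewrite !affine_row_corr//; apply/rowP => l; rewrite !mxE !tnth_mktuple /g.
  rewrite (negbTE Si) Sj; case: eqP => [->|_]; first by rewrite (negbTE Si).
  case: eqP => [->|_]//; rewrite Sj /cocorr sqrrN; ring.
by apply/seteqP; split => t /=; rewrite E.
Qed.

End corr_gauss_laws.

Section blocks_of_corr_gauss.
Context (R : realType) (M : nat) (d : 'I_M -> nat).
Local Notation D := (\sum_(m < M) d m)%N.
Variables (i j : 'I_D).
Hypothesis bij : tagnat.sig1 i != tagnat.sig1 j.
Local Notation N := (@normal_prob R 0 1).
Local Notation T := (measurableTypeR R).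
Local Notation P := (@corr_gauss R D i j).

Lemma blockE (m : 'I_M) (x : 'rV[R]_D) l : block m x 0 l = x 0 (tagnat.Rank m l).
Proof. by rewrite /block mxE. Qed.

Lemma neq_sig1 : i != j.
Proof. by apply: contraNneq bij => ->. Qed.

(** A block contains at most one of the coordinates [i] and [j], so no marginal sees the
    correlation. It is enough to compare boxes, whose sides are grouped by block. *)
Lemma prod_marginals_corr_gauss a A : a ^+ 2 < 1 -> measurable A ->
  prod_marginals (P a) A = P 0 A.
Proof.
move=> a1; apply: row_box_unique => B mB.
have ij := neq_sig1.
rewrite (corr_gauss0_box ij mB).
pose C m : set 'rV[R]_(d m) := [set y | forall l, B (tagnat.Rank m l) (y 0 l)].
have mC m : measurable (C m).
  exact: (@measurable_row_box R (d m) (fun l => B (tagnat.Rank m l)) (fun l => mB _)).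
transitivity (prod_marginals (P a) [set x | forall m, C m (block m x)]).
  congr (prod_marginals (P a) _); apply/seteqP; split => x /= h.
    by move=> m l; rewrite blockE.
  by move=> l; have := h (tagnat.sig1 l) (tagnat.sig2 l); rewrite blockE tagnat.sig2K.
rewrite prod_marginals_box// [RHS](partition_big (fun l : 'I_D => tagnat.sig1 l) predT)//=.
apply: eq_bigr => m _.
(* The event on block [m] becomes a box of the whole space, unconstrained outside the block, so that
   [corr_gauss_free_i] or [corr_gauss_free_j] applies to it. *)
pose Bm l := if tagnat.sig1 l == m then B l else [set: T].
have mBm l : measurable (Bm l) by rewrite /Bm; case: ifP.
pose E := [set x : 'rV[R]_D | forall l, Bm l (x 0 l)].
have EE : block m @^-1` C m = E.
  apply/seteqP; split => x /= h.
    move=> l; rewrite /Bm; case: eqP => // lm; move: h; rewrite -lm => h.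
    by have := h (tagnat.sig2 l); rewrite blockE tagnat.sig2K.
  by move=> l; have := h (tagnat.Rank m l); rewrite /Bm tagnat.Rank1K eqxx blockE.
transitivity (P a E); first by rewrite -EE.
have mE : measurable E by exact: (measurable_row_box mBm).
have PE : P a E = P 0 E.
  have [im|im] := boolP (tagnat.sig1 i == m).
    apply: corr_gauss_free_j => //= t x y y' h l; have := h l.
    rewrite /Bm !mxE; case: (eqVneq l i) => // _; case: (eqVneq l j) => // ->.
    by rewrite -(eqP im) eq_sym (negbTE bij).
  apply: corr_gauss_free_i => //= t x x' y h l; have := h l.
  by rewrite /Bm !mxE; case: (eqVneq l i) => // ->; rewrite (negbTE im).
rewrite PE (corr_gauss0_box ij mBm) [RHS]big_mkcond /=; apply: eq_bigr => l _.
by rewrite /Bm; case: ifP => //; rewrite probability_setT.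
Qed.

End blocks_of_corr_gauss.

(** * The two-point lower bound on the minimax risk *)

(** Bernoulli's inequality at exponent n only gives 0; at exponent n / 2, and then squared, it gives
    exactly 1/4 for even n. For n = 2 m + 1 and x = 1 / n it reduces the claim to (1 - x) (1 + x)^2
    >= 1, which holds for x <= 1/3. *)
Lemma quarter_le_expr (R : realFieldType) (n : nat) : (2 <= n)%N ->
  4^-1 <= (1 - n%:R^-1) ^+ n :> R.
Proof.
move=> n2.
have bern (m : nat) (x : R) : 0 <= x -> x <= 1 -> 1 - m%:R * x <= (1 - x) ^+ m.
  move=> x0 x1; elim: m => [|m IH]; first by rewrite mul0r subr0 expr0.
  rewrite exprS; apply: le_trans (ler_wpM2l _ IH); last by rewrite subr_ge0.
  have : 0 <= m%:R * x ^+ 2 by rewrite mulr_ge0 ?sqr_ge0.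
  by rewrite -natr1; nra.
have n0 : 0 < n%:R :> R by rewrite ltr0n (leq_trans _ n2).
have n1 : n%:R != 0 :> R by exact: lt0r_neq0.
have x0 : 0 <= n%:R^-1 :> R by rewrite invr_ge0 ltW.
have x1 : n%:R^-1 <= 1 :> R by rewrite invf_le1// ler1n (leq_trans _ n2).
set m := n./2; set x := n%:R^-1 in x0 x1 *.
have b := bern m x x0 x1.
have nE : n%:R = (odd n)%:R + 2 * m%:R :> R.
  by rewrite -{1}(odd_double_half n) natrD -muln2 natrM mulrC.
have nx : n%:R * x = 1 by rewrite divff.
rewrite -{1}(odd_double_half n) -/m exprD -mul2n mulnC exprM.
have m0 : 0 <= m%:R :> R by [].
have m1 : 1 <= m%:R :> R by rewrite ler1n half_gt0.
have b2 : (1 - m%:R * x) ^+ 2 <= ((1 - x) ^+ m) ^+ 2.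
  have : 0 <= 1 - m%:R * x.
    move: nx nE; case: (odd n) => /=; rewrite ?mulr1n ?mulr0n; nra.
  by move=> h; rewrite ler_sqr// nnegrE ?exprn_ge0// subr_ge0.
case: (odd n) nE => /= nE; rewrite ?expr0 ?expr1 ?mul1r.
  have mx : m%:R * x = (1 - x) / 2 by move: nx; rewrite nE; lra.
  have xE : x = (1 + 2 * m%:R)^-1 by rewrite -nE.
  apply: le_trans (ler_wpM2l _ b2); last by rewrite subr_ge0.
  rewrite mx.
  have x3 : x <= 3^-1.
    rewrite xE lef_pV2 ?posrE; lra.
  nra.
have mx : m%:R * x = 2^-1 by move: nx; rewrite nE; lra.
by apply: le_trans b2; rewrite mx; lra.
Qed.

(** The two-point argument produces 1/8; this connects it to the constant of the theorem. *)
Lemma le_cam_const (R : realType) : (1 - Num.sqrt (5 / 8)) / 2 <= 8^-1 :> R.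
Proof.
have : 3 / 4 <= Num.sqrt (5 / 8) :> R; last lra.
rewrite -[leLHS]ger0_norm; last by lra.
by rewrite -sqrtr_sqr ler_wsqrtr//; lra.
Qed.

Section two_points.
Context d (T : measurableType d) (R : realType).
Variables (P0 P1 : probability T R) (g : T -> R) (n : nat).
Hypotheses (mg : measurable_fun setT g) (g0 : forall x, 0 <= g x).
Hypothesis P1E : forall A, measurable A -> P1 A = (\int[P0]_(x in A) (g x)%:E)%E.
Hypothesis n2 : (2 <= n)%N.
Hypothesis g2 : (\int[P0]_x (g x ^+ 2)%:E <= ((1 - n%:R^-1)^-1)%:E)%E.

(* [min(1, L) >= L / 2 - L ^ 2 / 16] for the likelihood ratio [L] of the two
   product measures, whose second moment is at most [(1 - 1/n) ^ - n <= 4]. *)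
Lemma two_points_iid (A0 A1 : set (n.-tuple T)) : measurable A0 -> measurable A1 ->
  A0 `|` A1 = setT -> ((4^-1)%:E <= iid P0 n A0 + iid P1 n A1)%E.
Proof.
move=> mA0 mA1 A01.
pose L (t : n.-tuple T) := \prod_(i < n) g (tnth t i).
have mL : measurable_fun setT L.
  apply: measurable_prod => i _.
  by apply: measurableT_comp => //; exact: measurable_tnth.
have L0 t : 0 <= L t by exact: prodr_ge0.
have P1n := @ge0_integral_iid_density _ T R P0 P1 g mg g0 P1E n.
have intL : (\int[iid P0 n]_t (L t)%:E = 1)%E.
  have := P1n (fun=> 1%E) (measurable_cst _) (fun=> lee01).
  rewrite integral_cst//= probability_setT mule1 => ->.
  by apply: eq_integral => t _; rewrite mul1e.
have intL2 : (\int[iid P0 n]_t (L t ^+ 2)%:E <= 4%:E)%E.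
  under eq_integral do rewrite -prodrXl.
  rewrite (@ge0_integral_iid_prod _ T R P0 n (fun=> fun x => g x ^+ 2)); last 2 first.
  - by move=> _; exact: measurable_funX.
  - by move=> _ x; exact: sqr_ge0.
  have n0 : 0 < 1 - n%:R^-1 :> R.
    by rewrite subr_gt0 invf_lt1 ?ltr1n// ltr0n ltnW.
  have le4 : (1 - n%:R^-1) ^- n <= 4 :> R.
    rewrite -[leRHS]invrK lef_pV2 ?posrE ?invr_gt0 ?exprn_gt0//.
    exact: quarter_le_expr.
  have I0 : (0 <= \int[P0]_x (g x ^+ 2)%:E)%E.
    by apply: integral_ge0 => x _; rewrite lee_fin sqr_ge0.
  move: g2 I0; case: (integral _ _ _) => //= r; rewrite !lee_fin => rn r0.
  rewrite prodEFin lee_fin prodr_const card_ord.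
  by apply: le_trans le4; rewrite -exprVn lerXn2r// nnegrE// invr_ge0 ltW.
have A1E : iid P1 n A1 = (\int[iid P0 n]_t (\1_A1 t * L t)%:E)%E.
  transitivity (\int[iid P1 n]_t (\1_A1 t)%:E)%E; first by rewrite integral_indic// setIT.
  rewrite P1n//; last by apply/measurable_EFinP.
have A0E : iid P0 n A0 = (\int[iid P0 n]_t (\1_A0 t)%:E)%E by rewrite integral_indic// setIT.
have mI0 : measurable_fun setT (fun t => (\1_A0 t)%:E : \bar R) by exact/measurable_EFinP.
have mI1 : measurable_fun setT (fun t => (\1_A1 t * L t)%:E : \bar R).
  by apply/measurable_EFinP; exact: measurable_funM.
have I1 t : (0 <= (\1_A1 t * L t)%:E :> \bar R)%E by rewrite lee_fin mulr_ge0.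
have mL2 : measurable_fun setT (fun t => (16^-1 * L t ^+ 2)%:E : \bar R).
  by apply/measurable_EFinP; apply: measurable_funM => //; exact: measurable_funX.
rewrite A0E A1E -ge0_integralD//.
set I := (X in (_ <= X)%E).
have half : ((2^-1)%:E <= I + (16^-1)%:E * 4%:E)%E.
  apply: (@le_trans _ _ (\int[iid P0 n]_t ((\1_A0 t)%:E + (\1_A1 t * L t)%:E)
    + (16^-1)%:E * \int[iid P0 n]_t (L t ^+ 2)%:E)%E); last first.
    by rewrite leeD2l// lee_wpmul2l// lee_fin.
  rewrite -ge0_integralZl//; last 2 first.
  - by apply/measurable_EFinP; exact: measurable_funX.
  - by move=> t _; rewrite lee_fin sqr_ge0.
  have mJ : measurable_fun setT (fun t => (\1_A0 t)%:E + (\1_A1 t * L t)%:E : \bar R)%E.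
    exact: emeasurable_funD.
  have J0 t : setT t -> (0 <= (\1_A0 t)%:E + (\1_A1 t * L t)%:E :> \bar R)%E.
    by move=> _; rewrite adde_ge0// lee_fin.
  have K0 t : setT t -> (0 <= (16^-1)%:E * (L t ^+ 2)%:E :> \bar R)%E.
    by move=> _; rewrite mule_ge0// lee_fin ?sqr_ge0.
  rewrite -(ge0_integralD _ measurableT J0 mJ K0 mL2).
  have -> : ((2^-1)%:E = \int[iid P0 n]_t ((2^-1)%:E * (L t)%:E) :> \bar R)%E.
    have mLE : measurable_fun setT (fun t => (L t)%:E : \bar R) by exact/measurable_EFinP.
    by rewrite ge0_integralZl// ?intL ?mule1 ?lee_fin// => t _; rewrite lee_fin.
  apply: ge0_le_integral => //.
  - by move=> t _; rewrite mule_ge0 ?lee_fin.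
  - by apply: measurable_funeM; exact/measurable_EFinP.
  - by apply: emeasurable_funD => //; exact: emeasurable_funD.
  move=> t _; rewrite -!EFinM -!EFinD lee_fin !indicE.
  have : (t \in A0) || (t \in A1).
    by have : [set: n.-tuple T] t by []; rewrite -A01 => -[]/mem_set ->; rewrite ?orbT.
  have := L0 t; move: (L t) => l l0.
  (* On [A0] the claim follows from 1 - l / 2 + l^2 / 16 = (l - 4)^2 / 16, where 1/16 is the least
     coefficient that makes this quadratic nonnegative; on [A1] from l >= l / 2. *)
  have := sqr_ge0 (l - 4); case: (t \in A0); case: (t \in A1) => //=; nra.
clearbody I; case: I half => [r| |]//=.
- move=> h; rewrite lee_fin.
  have {h} : 2^-1 <= r + 16^-1 * 4 by rewrite -lee_fin; exact: h.
  by lra.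
- by move=> _; exact: leey.
Qed.

(** Le Cam's argument: the two values of [theta] are at least 2 eps apart, so every estimate misses
    one of them by eps. The two error events thus cover the sample space, their probabilities add up
    to at least 1/4, and one of them is at least 1/8. *)
Lemma minimax_two_points (PP : set (probability T R)) (theta : probability T R -> R) (eps : R) :
  PP P0 -> PP P1 -> theta P0 = 0 -> 2 * eps <= theta P1 ->
  (((1 - Num.sqrt (5 / 8)) / 2)%:E <= minimax_risk n PP theta eps)%E.
Proof.
move=> PP0 PP1 th0 th1; apply: le_ereal_inf_tmp => _ [F mF <-].
set S := [set _ | _ in _].
pose A Q := [set t | eps <= `|theta Q - F t|].
have mA Q : measurable (A Q).
  have mh : measurable_fun setT (fun t => `|theta Q - F t|).
    apply: measurableT_comp; first exact: normr_measurable.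
    exact: measurable_funB.
  rewrite (_ : A Q = setT `&` (fun t => `|theta Q - F t|) @^-1` `[eps, +oo[).
    by apply: mh => //; exact: measurable_itv.
  by apply/seteqP; split => t /=; rewrite in_itv/= andbT => //; case.
have S0 : (iid P0 n (A P0) <= ereal_sup S)%E by apply: ereal_sup_ubound; exists P0.
have S1 : (iid P1 n (A P1) <= ereal_sup S)%E by apply: ereal_sup_ubound; exists P1.
have := two_points_iid (mA P0) (mA P1) _.
have AT : A P0 `|` A P1 = setT.
  apply/seteqP; split => // t _; rewrite /A /= th0 sub0r normrN.
  have [?|h] := leP eps `|F t|; first by left.
  right; move: h; rewrite ltr_norml => /andP[h1 h2].
  by apply: le_trans (ler_norm _); lra.
move=> /(_ AT) h.
have : ((4^-1)%:E <= ereal_sup S + ereal_sup S)%E by apply: le_trans h _; exact: leeD.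
have : (((1 - Num.sqrt (5 / 8)) / 2)%:E <= (8^-1)%:E :> \bar R)%E by rewrite lee_fin le_cam_const.
case: (ereal_sup S) => [r| |] //=; rewrite ?leey// !lee_fin; lra.
Qed.

End two_points.

(** * Inner products and Bochner integrals *)

Section inner_product.
Context (R : realType) (H : hilbert R).
Implicit Types u v w : H.

Lemma innerDl u v w : inner (u + v) w = inner u w + inner v w.
Proof. by rewrite -[u in LHS]scale1r inner_linear mul1r. Qed.

Lemma inner0l w : inner 0 w = 0.
Proof. by apply: (addrI (inner 0 w)); rewrite -innerDl !addr0. Qed.

Lemma innerZl a u w : inner (a *: u) w = a * inner u w.
Proof. by rewrite -[a *: u]addr0 inner_linear inner0l addr0. Qed.

Lemma innerBl u v w : inner (u - v) w = inner u w - inner v w.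
Proof. by rewrite innerDl -scaleN1r innerZl mulN1r. Qed.

Lemma innerBr u v w : inner u (v - w) = inner u v - inner u w.
Proof. by rewrite innerC innerBl !(innerC u). Qed.

Lemma innerZr a u w : inner u (a *: w) = a * inner u w.
Proof. by rewrite innerC innerZl innerC. Qed.

Lemma inner_ge0 u : 0 <= inner u u.
Proof. by rewrite innerE sqr_ge0. Qed.

Lemma sqr_normB u v : `|u - v| ^+ 2 = inner u u - 2 * inner u v + inner v v.
Proof. by rewrite -innerE innerBl !innerBr (innerC v u); ring. Qed.

Lemma ler_inner u v : inner u v <= `|u| * `|v|.
Proof.
have [->|v0] := eqVneq v 0.
  by rewrite innerC inner0l normr0 mulr0.
have nv : 0 < `|v| by rewrite normr_gt0.
have [->|u0] := eqVneq u 0; first by rewrite inner0l normr0 mul0r.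
have nu : 0 < `|u| by rewrite normr_gt0.
have := inner_ge0 (`|v| *: u - `|u| *: v).
rewrite innerBl !innerBr !innerZl !innerZr !innerE (innerC v u).
have -> : `|v| * (`|v| * `|u| ^+ 2) - `|v| * (`|u| * inner u v) -
    (`|u| * (`|v| * inner u v) - `|u| * (`|u| * `|v| ^+ 2)) =
    2 * (`|u| * `|v|) * (`|u| * `|v| - inner u v) by ring.
by rewrite pmulr_rge0 ?mulr_gt0// subr_ge0.
Qed.

Lemma ler_norm_inner u v : `|inner u v| <= `|u| * `|v|.
Proof.
rewrite ler_norml ler_inner andbT lerNl -mulN1r -innerZl scaleN1r.
by rewrite -normrN ler_inner.
Qed.

Lemma inner_sum I (r : seq I) (F : I -> H) w :
  inner (\sum_(k <- r) F k) w = \sum_(k <- r) inner (F k) w.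
Proof.
elim: r => [|k r IH]; first by rewrite !big_nil inner0l.
by rewrite !big_cons innerDl IH.
Qed.

End inner_product.

Section bochner_integral.
Context d (T : measurableType d) (R : realType) (H : hilbert R).
Variable P : probability T R.

Section simple.
Variable s : {fimfun T >-> H}.
Hypothesis ms : forall w, measurable (s @^-1` [set w]).

(** [phi] is arbitrary because the pair of simple functions takes finitely many values, each on a
    measurable piece. *)
Lemma measurable_simple2 (s' : {fimfun T >-> H}) (phi : H -> H -> R) :
  (forall w, measurable (s' @^-1` [set w])) ->
  measurable_fun setT (fun x => phi (s x) (s' x)).
Proof.
move=> ms' _ Y mY; rewrite setTI.
rewrite (_ : _ @^-1` Y = \bigcup_(v in range s) \bigcup_(w in range s' `&` [set w | Y (phi v w)])
    (s @^-1` [set v] `&` s' @^-1` [set w])).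
  apply: fin_bigcup_measurable => // v _; apply: fin_bigcup_measurable.
    by apply: finite_setIl.
  by move=> w _; exact: measurableI.
apply/seteqP; split => [x Yx|x [v _ [w [_ Yw] [/= sv sw]]]]; last by rewrite /= sv sw.
exists (s x); first by exists x.
by exists (s' x) => //; split => //; exists x.
Qed.

Lemma measurable_simple (phi : H -> R) : measurable_fun setT (phi \o s).
Proof. exact: (@measurable_simple2 s (fun v _ => phi v) ms). Qed.

Lemma integrable_simple (phi : H -> R) : P.-integrable setT (EFin \o (phi \o s)).
Proof.
pose C := \sum_(v \in range s) `|phi v|.
apply: (@le_integrable _ _ _ _ _ measurableT _ (cst C%:E)) => //.
- by apply/measurable_EFinP; exact: measurable_simple.
- move=> x _ /=; rewrite lee_fin [leRHS]ger0_norm; last first.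
    by rewrite /C fsbig_finite//=; apply: sumr_ge0.
  rewrite /C (fsbigD1 (s x))//=; last by exists x.
  by rewrite lerDl fsbig_finite//=; [apply: sumr_ge0|exact: finite_setD].
- by apply: finite_measure_integrable_cst.
Qed.

Lemma inner_simple_integral u :
  inner (simple_integral P s) u = \int[P]_x inner (s x) u.
Proof.
have fs : finite_set (range s) by [].
rewrite /simple_integral fsbig_finite// inner_sum.
rewrite /Rintegral; under eq_integral => x _.
  rewrite (_ : inner (s x) u = \sum_(v <- finmap.enum_fset (fset_set (range s))) inner v u * \1_(s @^-1` [set v]) x).
    rewrite -sumEFin; over.
  rewrite -fsbig_finite// (fsbigD1 (s x))//=; last by exists x.
  rewrite indicE mem_set// mulr1 fsbig1 ?addr0// => v [_ /= vs].
  by rewrite indicE memNset ?mulr0// => sv; apply: vs; rewrite /= -sv.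
have mI v : P.-integrable setT (fun x => (inner v u * \1_(s @^-1` [set v]) x)%:E).
  rewrite (_ : (fun _ => _) = (fun x => (inner v u)%:E * (\1_(s @^-1` [set v]) x)%:E)%E)//.
  by apply: integrableZl => //; exact: integrable_indic.
rewrite integral_sum//.
have E v : (\int[P]_x (inner v u * \1_(s @^-1` [set v]) x)%:E =
    (fine (P (s @^-1` [set v])) * inner v u)%:E)%E.
  under eq_integral do rewrite EFinM.
  rewrite integralZl//; last exact: integrable_indic.
  by rewrite integral_indic// setIT EFinM muleC fineK ?fin_num_measure.
rewrite (eq_bigr _ (fun v _ => E v)).
by rewrite sumEFin /=; apply: eq_bigr => v _; rewrite innerZl.
Qed.

End simple.

Section limit.
Variables (f : T -> H) (v : H) (s : nat -> {fimfun T >-> H}).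
Hypothesis ms : forall n w, measurable (s n @^-1` [set w]).
Hypothesis s_f : forall x, s n x @[n --> \oo] --> f x.

Lemma cvg_inner (g : nat -> H) (w u : H) :
  g n @[n --> \oo] --> w -> inner (g n) u @[n --> \oo] --> inner w u.
Proof.
move=> gw; apply/cvgrPdist_le => e e0.
have e1 : 0 < e / (1 + `|u|) by rewrite divr_gt0// ltr_pwDl.
move/cvgrPdist_le : gw => /(_ _ e1); apply: filterS => n h.
rewrite -innerBl; apply: le_trans (ler_norm_inner _ _) _.
apply: (@le_trans _ _ (e / (1 + `|u|) * `|u|)); first exact: ler_wpM2r.
have u1 : 0 < 1 + `|u| by rewrite ltr_pwDl.
rewrite mulrAC ler_pdivrMr// ler_pM2l// lerDr//.
Qed.

Lemma measurable_inner_limit u : measurable_fun setT (fun x => inner (f x) u).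
Proof.
apply: (@measurable_fun_cvg _ _ _ _ (fun n x => inner (s n x) u)).
- by move=> n; exact: (@measurable_simple (s n) (ms n) (fun v => inner v u)).
- by move=> x _; exact: cvg_inner.
Qed.

Lemma measurable_norm_limit n : measurable_fun setT (fun x => `|f x - s n x|).
Proof.
apply: (@measurable_fun_cvg _ _ _ _ (fun m x => `|s m x - s n x|)).
- by move=> m; exact: (@measurable_simple2 (s m) (ms m) (s n) (fun v w => `|v - w|) (ms n)).
- by move=> x _; apply: cvg_norm; apply: cvgB => //; exact: cvg_cst.
Qed.

Hypothesis L1 : (\int[P]_x `|f x - s n x|%:E)%E @[n --> \oo] --> 0%E.

(** Convergence to 0 among extended reals makes the distances finite only from some rank on, hence
    the [near] in the conclusion. *)
Lemma L1_fine : exists2 a : nat -> R, a @ \oo --> (0 : R) &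
  \forall n \near \oo, (\int[P]_x `|f x - s n x|%:E = (a n)%:E)%E.
Proof.
exists (fun n => fine (\int[P]_x `|f x - s n x|%:E)%E).
  by move/fine_cvgP : L1 => [].
by move/fine_cvgP : L1 => [+ _]; apply: filterS => n h; rewrite fineK.
Qed.

Lemma integrable_inner_limit u : P.-integrable setT (fun x => (inner (f x) u)%:E).
Proof.
have [a _ [N _ /(_ N (leqnn N)) aN]] := L1_fine.
have iN : P.-integrable setT (fun x => (`|f x - s N x| * `|u|)%:E).
  rewrite (_ : (fun _ => _) = (fun x => `|u|%:E * `|f x - s N x|%:E)%E); last first.
    by apply/funext => x; rewrite -EFinM mulrC.
  apply: integrableZl => //; apply/integrableP; split.
    by apply/measurable_EFinP; exact: measurable_norm_limit.
  by under eq_integral do rewrite /= normr_id; rewrite aN ltry.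
have isN := @integrable_simple (s N) (ms N) (fun v => `|v| * `|u|).
apply: (@le_integrable _ _ _ _ _ measurableT _
  (fun x => (`|f x - s N x| * `|u|)%:E + (`|s N x| * `|u|)%:E)%E).
- by apply/measurable_EFinP; exact: measurable_inner_limit.
- move=> x _; rewrite /= lee_fin [leRHS]ger0_norm; last by rewrite addr_ge0 ?mulr_ge0.
  rewrite -mulrDl; apply: le_trans (ler_norm_inner _ _) _; rewrite ler_wpM2r//.
  by rewrite -[X in `|X|](subrK (s N x)) ler_normD.
- by apply: integrableD.
Qed.

Lemma inner_simple_limit n u r : (\int[P]_x `|f x - s n x|%:E = r%:E)%E ->
  `|\int[P]_x inner (f x) u - inner (simple_integral P (s n)) u| <= r * `|u|.
Proof.
move=> hr; have i1 := integrable_inner_limit u.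
have i2 := @integrable_simple (s n) (ms n) (fun v => inner v u).
rewrite inner_simple_integral// -RintegralB//.
have iB : P.-integrable setT (EFin \o (fun x => inner (f x) u - inner (s n x) u)).
  exact: (integrableB _ i1 i2).
apply: le_trans (le_normr_Rintegral _ iB) _ => //.
have iN : P.-integrable setT (fun x => `|f x - s n x|%:E).
  apply/integrableP; split.
    by apply/measurable_EFinP; exact: measurable_norm_limit.
  by under eq_integral do rewrite /= normr_id; rewrite hr ltry.
have iN2 : P.-integrable setT (EFin \o (fun x => `|f x - s n x| * `|u|)).
  rewrite (_ : _ \o _ = (fun x => `|u|%:E * `|f x - s n x|%:E)%E); last first.
    by apply/funext => x; rewrite /= -EFinM mulrC.
  exact: integrableZl.
apply: (@le_trans _ _ (\int[P]_x (`|f x - s n x| * `|u|))).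
  apply: le_Rintegral => //.
  - exact: (integrable_norm iB).
  - by move=> x _; rewrite -innerBl ler_norm_inner.
by rewrite RintegralZr// /Rintegral hr.
Qed.

(** The weak characterization of the Bochner integral, through which all later statements on
    embeddings become statements on real integrals. *)
Lemma inner_bochner_limit u : simple_integral P (s n) @[n --> \oo] --> v ->
  inner v u = \int[P]_x inner (f x) u.
Proof.
move=> /(@cvg_inner _ _ u) Iv; have [a a0 aE] := L1_fine.
apply: (cvg_unique (@Rhausdorff R) Iv) => /=.
apply/cvgrPdist_le => e e0.
have e1 : 0 < e / (1 + `|u|) by rewrite divr_gt0// ltr_pwDl.
move/cvgrPdist_le : a0 => /(_ _ e1) a0.
near=> n.
have u1 : 0 < 1 + `|u| by rewrite ltr_pwDl.
apply: le_trans (@inner_simple_limit n u (a n) _) _; first by near: n.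
apply: (@le_trans _ _ (e / (1 + `|u|) * `|u|)).
  apply: ler_wpM2r => //; apply: le_trans (ler_norm _) _.
  have : `|0 - a n| <= e / (1 + `|u|) by near: n.
  by rewrite sub0r normrN.
by rewrite mulrAC ler_pdivrMr// ler_pM2l// lerDr.
Unshelve. all: by end_near. Qed.

(** The norm estimate comes from the weak one: testing the difference u of two simple integrals
    against u itself gives |u|^2 <= (a N + a n) |u|. *)
Lemma is_cvg_simple_integral : cvg (simple_integral P (s n) @[n --> \oo]).
Proof.
have [a a0 aE] := L1_fine.
apply/cauchy_cvgP/cauchy_exP => e e0.
have e1 : 0 < e / 4 by rewrite divr_gt0.
move/cvgrPdist_lt : a0 => /(_ _ e1) a0.
have [N _ aN] : \forall n \near \oo, (\int[P]_x `|f x - s n x|%:E = (a n)%:E)%E /\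
    `|0 - a n| < e / 4.
  by near=> n; split; near: n.
exists (simple_integral P (s N)), N => // n Nn.
rewrite /= -ball_normE /=.
set u := simple_integral P (s N) - simple_integral P (s n).
have [u0|u0] := eqVneq u 0; first by rewrite u0 normr0.
have un : 0 < `|u| by rewrite normr_gt0.
have [aN1 aN2] := aN N (leqnn N).
have [an1 an2] := aN n Nn.
have h1 := @inner_simple_limit N u (a N) aN1.
have h2 := @inner_simple_limit n u (a n) an1.
have : `|u| ^+ 2 <= (a N + a n) * `|u|.
  rewrite -innerE {1}/u innerBl.
  move: h1 h2; rewrite !ler_norml => /andP[h1 h1'] /andP[h2 h2'].
  rewrite mulrDl; lra.
rewrite expr2 ler_pM2r// => /le_lt_trans; apply.
by move: aN2 an2; rewrite !sub0r !normrN !ltr_norml => /andP[_ ?] /andP[_ ?]; lra.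
Unshelve. all: by end_near. Qed.

End limit.

End bochner_integral.

(** * Mean embeddings of bounded continuous kernels *)

Lemma finite_rows (R : realType) n (A : set R) : finite_set A ->
  finite_set [set x : 'rV[R]_n | forall l, A (x 0 l)].
Proof.
move=> /finite_seqP[s ->].
pose e (c : {ffun 'I_n -> 'I_(size s)}) : 'rV[R]_n := \row_l nth 0 s (c l).
apply: (@sub_finite_set _ _ (e @` setT)); last exact: finite_image.
move=> x /= xs.
have xs' l : (index (x ord0 l) s < size s)%N by rewrite index_mem; exact: xs.
exists [ffun l => Ordinal (xs' l)] => //; apply/rowP => l.
by rewrite mxE ffunE /= nth_index//; exact: xs.
Qed.

Lemma cvg_row (R : realType) n (T : Type) (F : set_system T) {FF : Filter F}
    (g : T -> 'rV[R]_n) (x : 'rV[R]_n) :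
  (forall l, g m 0 l @[m --> F] --> x 0 l) -> g m @[m --> F] --> x.
Proof.
move=> gx; apply/cvg_ballP => e e0.
have H : forall l, \forall m \near F, ball (x 0 l) e (g m 0 l).
  by move=> l; move/cvg_ballP : (gx l); apply.
have : \forall m \near F, forall l, ball (x 0 l) e (g m 0 l).
  exact: filter_forall.
apply: filterS => m h; split => // k l; rewrite ord1; exact: h.
Qed.

Section row_simple_approx.
Import HBSimple.

(** Finite-valued approximations of the identity: composed with a continuous feature map they give
    simple functions converging to it pointwise. *)
Lemma row_simple_approx (R : realType) n : exists q : nat -> 'rV[R]_n -> 'rV[R]_n,
  [/\ forall m, finite_set (range (q m)), forall m, measurable_fun setT (q m) &
      forall x, q m x @[m --> \oo] --> x].
Proof.
have [g gcvg] := approximation_sfun (@measurableT _ (measurableTypeR R))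
  (@EFin_measurable R setT).
exists (fun m x => \row_l g m (x 0 l)); split.
- move=> m; apply: (sub_finite_set _ (@finite_rows R n (range (g m)) _)) => //.
  by move=> _ [x _ <-] l /=; rewrite mxE; exists (x 0 l).
- move=> m; apply: measurable_mxP => i l.
  apply: (eq_measurable_fun (fun x : 'rV[R]_n => g m (x 0 l))).
    by move=> x _; rewrite mxE.
  have mg : measurable_fun setT (g m : measurableTypeR R -> R) by exact: measurable_funP.
  exact: (measurableT_comp mg (measurable_coord 0 l)).
- move=> x; apply: cvg_row => l.
  under eq_cvg do rewrite mxE.
  have := gcvg (x 0 l) I.
  by move=> /fine_cvg /=.
Qed.

End row_simple_approx.

Section mean_embedding.
Context (R : realType) (n : nat) (k : 'rV[R]_n -> 'rV[R]_n -> R) (H : rkhs k).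
Hypotheses (kc : kernel_continuous k) (kb : kernel_bounded k) (km : kernel_measurable k).
Local Notation phi := (@feature R _ k H).

Lemma inner_feature x y : inner (phi x) (phi y) = k x y.
Proof. by rewrite innerC -reproducing featureE. Qed.

Lemma kernel_sym x y : k x y = k y x.
Proof. by rewrite -!inner_feature innerC. Qed.

Lemma normB_feature x y : `|phi x - phi y| = Num.sqrt (k x x - 2 * k x y + k y y).
Proof. by rewrite -!inner_feature -sqr_normB sqrtr_sqr normr_id. Qed.

Lemma cvg_feature (q : nat -> 'rV[R]_n) x :
  q m @[m --> \oo] --> x -> phi (q m) @[m --> \oo] --> phi x.
Proof.
move=> qx; apply/cvgrPdist_le => e e0.
have kcvg (u v : nat -> 'rV[R]_n) : u m @[m --> \oo] --> x -> v m @[m --> \oo] --> x ->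
    k (u m) (v m) @[m --> \oo] --> k x x.
  move=> ux vx.
  have kx : k z.1 z.2 @[z --> (x, x)] --> k x x by exact: (@kc (x, x)).
  exact: (cvg_comp (fun m => (u m, v m)) (fun z => k z.1 z.2) (cvg_pair ux vx) kx).
have : Num.sqrt (k x x - 2 * k x (q m) + k (q m) (q m)) @[m --> \oo] --> (0 : R).
  rewrite -[X in _ --> X]sqrtr0; apply: (cvg_comp _ Num.sqrt); last exact: sqrt_continuous.
  have -> : 0 = k x x - 2 * k x x + k x x :> R by ring.
  apply: cvgD; last exact: kcvg.
  apply: cvgB; first exact: cvg_cst.
  by apply: cvgMr; apply: kcvg => //; exact: cvg_cst.
move/cvgrPdist_le => /(_ e e0); apply: filterS => m.
by rewrite sub0r normrN normB_feature [X in X <= _ -> _]ger0_norm ?sqrtr_ge0.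
Qed.

(** [mean_embedding] is selected by [get], so it is a Bochner integral as soon as one exists.
    Continuity of [k] gives pointwise convergence of the simple functions, and boundedness of [k]
    bounds the norm of the features, hence domination. *)
Lemma feature_bochner (P : probability 'rV[R]_n R) :
  is_bochner_integral P phi (mean_embedding H P).
Proof.
have [q [fq mq qx]] := row_simple_approx R n.
have fs m : finite_set (range (phi \o q m)).
  apply: (@sub_finite_set _ _ (phi @` range (q m))).
    by move=> _ [x _ <-]; exists (q m x) => //; exists x.
  by apply: finite_image.
pose s m : {fimfun 'rV[R]_n >-> H} := HB.pack_for {fimfun 'rV[R]_n >-> H} (phi \o q m)
  (FiniteImage.Build _ _ (phi \o q m) (fs m)).
have ms m w : measurable (s m @^-1` [set w]).
  rewrite (_ : _ @^-1` _ = \bigcup_(v in range (q m) `&` [set v | phi v = w]) (q m @^-1` [set v])).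
    apply: fin_bigcup_measurable; first exact: finite_setIl.
    move=> v _; rewrite -[X in measurable X]setTI; apply: mq => //.
    rewrite (_ : [set v] = \bigcap_(l in [set: 'I_n]) ((fun x : 'rV[R]_n => x 0 l) @^-1` [set v 0 l])).
      apply: fin_bigcap_measurable => // l _; rewrite -[X in measurable X]setTI.
      by apply: measurable_coord => //; exact: measurable_set1.
    apply/seteqP; split => [x -> //|x /= xv]; apply/rowP => l; exact: xv.
  apply/seteqP; split => [x /= xw|x [v [_ /= vw] /= ->]]//.
  by exists (q m x) => //; split => //; exists x.
have sx x : s m x @[m --> \oo] --> phi x by apply: cvg_feature; exact: qx.
have [C kC] := kb.
have L1 : (\int[P]_x `|phi x - s m x|%:E)%E @[m --> \oo] --> 0%E.
  have C0 : 0 <= C by apply: le_trans (kC 0 0); exact: normr_ge0.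
  have phiC x : `|phi x| <= Num.sqrt C.
    rewrite -[leLHS]ger0_norm// -sqrtr_sqr ler_wsqrtr// -innerE inner_feature.
    exact: le_trans (ler_norm _) (kC _ _).
  pose F m x := `|phi x - s m x|%:E.
  have F0 x : F m x @[m --> \oo] --> 0%E.
    apply/fine_cvgP; split; first exact: nearW.
    have -> : fine \o F ^~ x = (fun m => `|phi x - s m x|) by [].
    rewrite -(normr0 H) -(subrr (phi x)); apply: cvg_norm; apply: cvgB => //; exact: cvg_cst.
  have FC x m : (`|F m x| <= (2 * Num.sqrt C)%:E)%E.
    rewrite lee_fin normr_id.
    by apply: le_trans (ler_normB _ _) _; rewrite mulrDl mul1r lerD// phiC.
  have mF m : measurable_fun setT (F m).
    by apply/measurable_EFinP; exact: (measurable_norm_limit ms sx).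
  have iC : P.-integrable setT (cst (2 * Num.sqrt C)%:E).
    by apply: finite_measure_integrable_cst.
  have [_ _] := @dominated_convergence _ _ _ P setT measurableT F (cst 0%E)
    (cst (2 * Num.sqrt C)%:E) mF (measurable_cst _)
    (aeW _ (fun x _ => F0 x)) iC
    (aeW _ (fun x m _ => FC x m)).
  by rewrite integral0.
have [v sv] : exists v, is_bochner_integral P phi v.
  have := @is_cvg_simple_integral _ _ _ H P phi s ms sx L1.
  by move=> /cvg_ex[v sv]; exists v, s; split.
by apply: (@getPex _ [set v | is_bochner_integral P phi v]); exists v.
Qed.

Lemma inner_mean_embedding (P : probability 'rV[R]_n R) u :
  inner (mean_embedding H P) u = \int[P]_x inner (phi x) u.
Proof.
have [s [ms sx L1 sv]] := feature_bochner P.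
exact: (inner_bochner_limit ms sx L1).
Qed.

Lemma measurable_inner_feature u : measurable_fun setT (fun x => inner (phi x) u).
Proof.
have [s [ms sx _ _]] := feature_bochner (dirac (0 : 'rV[R]_n)).
exact: (measurable_inner_limit ms sx).
Qed.

Lemma inner_feature_bounded u : exists C, forall x, `|inner (phi x) u| <= C.
Proof.
have [C kC] := kb; exists (Num.sqrt C * `|u|) => x.
apply: le_trans (ler_norm_inner _ _) _; rewrite ler_wpM2r//.
rewrite -[leLHS]ger0_norm// -sqrtr_sqr ler_wsqrtr// -innerE inner_feature.
exact: le_trans (ler_norm _) (kC _ _).
Qed.

Lemma inner_mean_embedding_feature (P : probability 'rV[R]_n R) y :
  inner (mean_embedding H P) (phi y) = \int[P]_x k x y.
Proof.
by rewrite inner_mean_embedding; apply: eq_Rintegral => x _; rewrite inner_feature.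
Qed.

Lemma inner_mean_embeddings (P Q : probability 'rV[R]_n R) :
  inner (mean_embedding H P) (mean_embedding H Q) = \int[P]_x \int[Q]_y k x y.
Proof.
rewrite inner_mean_embedding; apply: eq_Rintegral => x _.
rewrite innerC inner_mean_embedding_feature.
by apply: eq_Rintegral => y _; rewrite kernel_sym.
Qed.

Lemma eq_mean_embedding (P Q : probability 'rV[R]_n R) :
  (forall y, \int[P]_x k x y = \int[Q]_x k x y) ->
  mean_embedding H P = mean_embedding H Q.
Proof.
move=> PQ; apply: (@rkhs_eval_inj _ _ _ H); apply/funext => y.
by rewrite !reproducing !inner_mean_embedding_feature.
Qed.

End mean_embedding.

(** * Convexity of the Gram function K *)

Section gram_sum.
Context (R : realType) (H : hilbert R) (m : R -> H) (K : R -> R).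
Hypothesis mK : forall a b, a ^+ 2 < 1 -> b ^+ 2 < 1 -> inner (m a) (m b) = K (a + b).
Hypothesis K_even : forall s, s ^+ 2 < 4 -> K (- s) = K s.

(* [K (2 a) + K (2 b) - 2 K (a + b)] is the squared norm of [m a - m b]. *)
Lemma gram_midpoint x h : (x + h) ^+ 2 < 4 -> (x - h) ^+ 2 < 4 ->
  K x - K (x - h) <= K (x + h) - K x.
Proof.
move=> xh1 xh2.
have a1 : ((x + h) / 2) ^+ 2 < 1 by rewrite expr_div_n ltr_pdivrMr//; lra.
have b1 : ((x - h) / 2) ^+ 2 < 1 by rewrite expr_div_n ltr_pdivrMr//; lra.
have := sqr_ge0 `|m ((x + h) / 2) - m ((x - h) / 2)|.
rewrite sqr_normB !mK//.
rewrite (_ : (x + h) / 2 + (x + h) / 2 = x + h); last by field.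
rewrite (_ : (x - h) / 2 + (x - h) / 2 = x - h); last by field.
rewrite (_ : (x + h) / 2 + (x - h) / 2 = x); last by field.
lra.
Qed.

(** By [gram_midpoint] the increments of K along the grid of step h are nondecreasing. The first p
    of them lead from 0 to 1/4 and have mean (K (1/4) - K 0) / p; the two increments adjacent to
    3/4, of index 3 p - 1 and 3 p, are each at least that mean. *)
Lemma gram_increments (p : nat) (h : R) : h = (4 * p%:R)^-1 -> (0 < p)%N ->
  (K 4^-1 - K 0) / p%:R *+ 2 <= K (3 / 4 + h) - K (3 / 4 - h).
Proof.
move=> hE p0.
have p1 : 1 <= p%:R :> R by rewrite ler1n.
have pn0 : p%:R != 0 :> R by apply: lt0r_neq0; lra.
have h0 : 0 < h by rewrite hE invr_gt0; lra.
have ph : p%:R * h = 4^-1 by rewrite hE; field.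
pose Dl (l : nat) := K (l.+1%:R * h) - K (l%:R * h).
have D_step l : (l.+1 <= 3 * p)%N -> Dl l <= Dl l.+1.
  move=> lp; rewrite /Dl.
  have lp' : l%:R + 1 <= 3 * p%:R :> R by rewrite natr1 -natrM ler_nat.
  have l0 : 0 <= l%:R :> R by [].
  have lh : (l%:R + 1) * h <= 3 / 4.
    have -> : 3 / 4 = 3 * (p%:R * h) :> R by rewrite ph.
    by rewrite mulrA ler_pM2r.
  have h4 : h <= 4^-1 by rewrite -ph ler_peMl// ltW.
  have lh0 : 0 <= l%:R * h by rewrite mulr_ge0// ltW.
  have := @gram_midpoint (l.+1%:R * h) h.
  rewrite (_ : l.+1%:R * h - h = l%:R * h); last by rewrite -natr1; ring.
  rewrite (_ : l.+1%:R * h + h = l.+2%:R * h); last by rewrite -!natr1; ring.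
  apply.
    rewrite -!natr1; move: lh; rewrite mulrDl mul1r => lh.
    have -> : (l%:R + 1 + 1) * h = l%:R * h + h + h by ring.
    nra.
  nra.
have D_mono l l' : (l <= l')%N -> (l' <= 3 * p)%N -> Dl l <= Dl l'.
  elim: l' => [|l' IH]; first by rewrite leqn0 => /eqP ->.
  rewrite leq_eqVlt => /predU1P[->//|]; rewrite ltnS => ll' l'p.
  by apply: le_trans (IH ll' (ltnW l'p)) _; exact: D_step.
have sumD : K 4^-1 - K 0 <= p%:R * Dl (3 * p).-1.
  have -> : K 4^-1 - K 0 = \sum_(l < p) Dl l.
    rewrite -(big_mkord xpredT Dl) /Dl telescope_sumr// mul0r ph//.
  apply: (@le_trans _ _ (\sum_(l < p) Dl (3 * p).-1)).
    apply: ler_sum => l _; apply: D_mono; last exact: leq_pred.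
    have := ltn_ord l; lia.
  by rewrite sumr_const card_ord mulr_natl.
have last2 : Dl (3 * p).-1 <= Dl (3 * p)%N by apply: D_mono; [exact: leq_pred|].
have p3 : ((3 * p).-1.+1 = 3 * p)%N by rewrite prednK// muln_gt0.
have E1 : (3 * p)%N%:R * h = 3 / 4 by rewrite natrM -mulrA ph.
have E2 : (3 * p).+1%:R * h = 3 / 4 + h by rewrite -natr1 mulrDl E1 mul1r.
have E3 : (3 * p).-1%:R * h = 3 / 4 - h.
  by rewrite -E1 -[X in X%:R * h - h]p3 -natr1; ring.
have : (K 4^-1 - K 0) / p%:R <= Dl (3 * p).-1.
  by rewrite ler_pdivrMr ?[_ * p%:R]mulrC// ltr0n.
move: last2; rewrite /Dl p3 E1 E2 E3; rewrite mulr2n; lra.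
Qed.

Lemma gram_lower_bound : m 8^-1 != m (- 8^-1) ->
  exists2 c : R, 0 < c & forall p : nat, (0 < p)%N ->
    c / p%:R <= `|m (4 * p%:R)^-1 - m 0|.
Proof.
move=> m8; pose w := m (3 / 4) - m (- (3 / 4)).
(* The squared norm of m (1/8) - m (-1/8) is K (1/4) - 2 K 0 + K (-1/4), which is 2 (K (1/4) - K 0)
   by evenness. *)
have K4 : 0 < K 4^-1 - K 0.
  have : 0 < `|m 8^-1 - m (- 8^-1)| ^+ 2 by rewrite exprn_gt0// normr_gt0 subr_eq0.
  rewrite sqr_normB !mK; try lra.
  rewrite (_ : 8^-1 + 8^-1 = 4^-1); last by field.
  rewrite (_ : - 8^-1 + - 8^-1 = - 4^-1); last by field.
  by rewrite subrr K_even; lra.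
(* Cauchy-Schwarz leads to division by the norm of [w]; adding 1 keeps the divisor positive. *)
exists ((K 4^-1 - K 0) *+ 2 / (1 + `|w|)).
  by rewrite divr_gt0 ?mulrn_wgt0// ltr_pwDl.
move=> p p0; set h := (4 * p%:R)^-1.
have p1 : 1 <= p%:R :> R by rewrite ler1n.
have h0 : 0 < h by rewrite invr_gt0; lra.
have h4 : h <= 4^-1 by rewrite /h lef_pV2 ?posrE; lra.
have := @gram_increments p h erefl p0.
(* The contributions of [m 0] are K (3/4) and K (-3/4), which cancel by evenness. *)
have <- : inner (m h - m 0) w = K (3 / 4 + h) - K (3 / 4 - h).
  rewrite /w innerBr !innerBl !mK; try nra.
  rewrite !add0r K_even; last lra.
  rewrite -(K_even (s := 3 / 4 - h)); last nra.
  by rewrite [- (3 / 4 - h)]opprB [h + 3 / 4]addrC; ring.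
move=> /le_trans/(_ (ler_inner _ _)) le1.
have w0 : 0 <= `|w| by [].
rewrite mulrAC ler_pdivrMr; last by rewrite ltr_pwDl.
rewrite mulrDr mulr1; have := normr_ge0 (m h - m 0).
move: le1; rewrite -mulrnAl; lra.
Qed.

End gram_sum.

(** * Characteristic kernels and signed measures *)

Section integrals_of_probabilities.
Context d (T : measurableType d) (R : realType) (P : probability T R).

Lemma integrable_bounded (f : T -> R) C : measurable_fun setT f ->
  (forall x, `|f x| <= C) -> P.-integrable setT (EFin \o f).
Proof.
move=> mf fC; apply: (@le_integrable _ _ _ _ _ measurableT _ (cst C%:E)) => //.
- exact/measurable_EFinP.
- by move=> x _; rewrite /= lee_fin (le_trans (fC x))// ler_norm.
- by apply: finite_measure_integrable_cst.
Qed.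

Lemma integrable_boundedM (f W : T -> R) C : measurable_fun setT f ->
  (forall x, `|f x| <= C) -> P.-integrable setT (EFin \o W) ->
  P.-integrable setT (EFin \o (fun x => f x * W x)).
Proof.
move=> mf fC iW.
have mW : measurable_fun setT W.
  by apply/measurable_EFinP; exact: (measurable_int P iW).
apply: (@le_integrable _ _ _ _ _ measurableT _ (fun x => C%:E * (W x)%:E)%E).
- by apply/measurable_EFinP; exact: measurable_funM.
- move=> x _; rewrite /= lee_fin !normrM ler_wpM2r//.
  exact: le_trans (fC x) (ler_norm _).
- exact: integrableZl.
Qed.

Lemma cvg_Rintegral_eventually (g_ : nat -> T -> R) (g W : T -> R) C :
  P.-integrable setT (EFin \o W) ->
  (forall m, measurable_fun setT (g_ m)) -> (forall m w, `|g_ m w| <= C) ->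
  (forall w, \forall m \near \oo, g_ m w = g w) ->
  \int[P]_w (g_ m w * W w) @[m --> \oo] --> \int[P]_w (g w * W w).
Proof.
move=> iW mg gC gE.
have mW : measurable_fun setT W by apply/measurable_EFinP; exact: (measurable_int P iW).
pose F m w := (g_ m w * W w)%:E; pose G w := (g w * W w)%:E.
have mF m : measurable_fun setT (F m) by apply/measurable_EFinP; exact: measurable_funM.
have FG w : F m w @[m --> \oo] --> G w.
  apply: cvg_near_cst; apply: filterS (gE w) => m gm.
  by rewrite /F /G gm.
have mG : measurable_fun setT G.
  by apply: (emeasurable_fun_cvg F) => // w _; exact: FG.
have iCW : P.-integrable setT (fun w => (C%:E * `|(W w)%:E|)%E).
  by apply: integrableZl => //; exact: integrable_abse.
have FC w m : (`|F m w| <= C%:E * `|(W w)%:E|)%E.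
  by rewrite lee_fin normrM ler_wpM2r.
have [iG _ cvgF] := @dominated_convergence _ _ _ P setT measurableT F G _ mF mG
  (aeW _ (fun w _ => FG w)) iCW (aeW _ (fun w m _ => FC w m)).
apply: fine_cvg; rewrite fineK; first exact: cvgF.
exact: (integrable_fin_num measurableT iG).
Qed.

End integrals_of_probabilities.

Lemma density_measure d (T : measurableType d) (R : realType)
    (mu : {measure set T -> \bar R}) (g : T -> R) :
  measurable_fun setT g -> (forall x, 0 <= g x) ->
  exists nu : {measure set T -> \bar R},
    forall A, measurable A -> nu A = (\int[mu]_(x in A) (g x)%:E)%E.
Proof.
move=> mg g0; pose m A := (\int[mu]_(x in A) (g x)%:E)%E.
have m0 : m set0 = 0%E by rewrite /m integral_set0.
have m_ge0 A : (0 <= m A)%E by apply: integral_ge0 => x _; rewrite lee_fin.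
have m_sigma : semi_sigma_additive m.
  move=> /= A mA tA mUA; rewrite /m ge0_integral_bigcup//=; last 2 first.
  - by apply: measurable_funTS; exact/measurable_EFinP.
  - by move=> x _; rewrite lee_fin.
  by apply: is_cvg_ereal_nneg_natsum_cond => n _ _; exact: m_ge0.
by exists (HB.pack_for {measure set T -> \bar R} m (isMeasure.Build _ _ _ m m0 m_ge0 m_sigma)).
Qed.

(** The measure is the image under [X1] of [P] weighted by [W1], plus the image under [X2] of [P]
    weighted by [W2]. Its integrals are given as real integrals so that they can later be
    subtracted. *)
Lemma mixture_measure d d' (T : measurableType d) (V : measurableType d') (R : realType)
    (P : probability T R) (X1 X2 : T -> V) (W1 W2 : T -> R) :
  measurable_fun setT X1 -> measurable_fun setT X2 ->
  (forall w, 0 <= W1 w) -> (forall w, 0 <= W2 w) ->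
  P.-integrable setT (EFin \o W1) -> P.-integrable setT (EFin \o W2) ->
  exists mu : {measure set V -> \bar R}, forall (f : V -> R) C,
    measurable_fun setT f -> (forall x, 0 <= f x <= C) ->
    (\int[mu]_x (f x)%:E)%E =
    (\int[P]_w (f (X1 w) * W1 w) + \int[P]_w (f (X2 w) * W2 w))%:E.
Proof.
move=> mX1 mX2 W10 W20 iW1 iW2.
have mW1 : measurable_fun setT W1 by apply/measurable_EFinP; exact: (measurable_int P iW1).
have mW2 : measurable_fun setT W2 by apply/measurable_EFinP; exact: (measurable_int P iW2).
have [nu1 nu1E] := density_measure P mW1 W10.
have [nu2 nu2E] := density_measure P mW2 W20.
exists (measure_add (image_measure nu1 mX1) (image_measure nu2 mX2)) => f C mf fC.
have f0 x : 0 <= f x by case/andP: (fC x).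
have mfE : measurable_fun setT (fun x => (f x)%:E : \bar R) by exact/measurable_EFinP.
have f0E x : (0 <= (f x)%:E :> \bar R)%E by rewrite lee_fin.
have E (X : T -> V) (W : T -> R) (nu : {measure set T -> \bar R}) : measurable_fun setT X -> measurable_fun setT W ->
    (forall w, 0 <= W w) -> P.-integrable setT (EFin \o W) ->
    (forall A, measurable A -> nu A = (\int[P]_(x in A) (W x)%:E)%E) ->
    forall mX : measurable_fun setT X,
    (\int[image_measure nu mX]_x (f x)%:E = (\int[P]_w (f (X w) * W w))%:E)%E.
  move=> _ mW W0 iW nuE mX.
  have fM : P.-integrable setT (EFin \o (fun w => f (X w) * W w)).
    apply: (@integrable_boundedM _ _ _ P (f \o X) W C) => //.
      exact: (measurableT_comp mf mX).
    by move=> w; rewrite ger0_norm ?f0//; case/andP: (fC (X w)).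
  etransitivity.
    apply: (ge0_integral_pushforward mX nu measurableT mfE) => x _; exact: f0E.
  rewrite preimage_setT.
  etransitivity.
    apply: (ge0_integral_density mW W0 nuE (f := fun w => (f (X w))%:E)).
      exact: (measurableT_comp mfE mX).
    by move=> w; exact: f0E.
  rewrite /Rintegral fineK//; exact: integrable_fin_num.
rewrite ge0_integral_measure_add//.
by rewrite (E X1 W1)// (E X2 W2)// EFinD.
Qed.

(** The hypothesis on [k] concerns probabilities, so both measures are divided by their common mass
    [m]. Adding [C] keeps the integrands nonnegative, and equal masses let it cancel. *)
Lemma characteristic_finite_measures (R : realType) n
    (k : 'rV[R]_n -> 'rV[R]_n -> R) (Hk : rkhs k) (C m : R)
    (al be : {measure set 'rV[R]_n -> \bar R}) :
  kernel_continuous k -> kernel_measurable k -> characteristic_kernel Hk ->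
  (forall x y, `|k x y| <= C) -> 0 < m -> al setT = m%:E -> be setT = m%:E ->
  (forall y, \int[al]_x (k x y + C)%:E = \int[be]_x (k x y + C)%:E)%E ->
  forall A, measurable A -> al A = be A.
Proof.
move=> kc km kchar kC m0 al1 be1 albe.
have kb : kernel_bounded k by exists C.
have r0 : 0 <= m^-1 by rewrite invr_ge0 ltW.
pose r : {nonneg R} := NngNum r0.
have prob (mu : {measure set 'rV[R]_n -> \bar R}) : mu setT = m%:E -> mscale r mu setT = 1%E.
  by move=> mu1; rewrite /mscale /= mu1 -EFinM mulVf// gt_eqF.
have mk y : measurable_fun setT (fun x => k x y).
  exact: (measurableT_comp km (pair2_measurable y)).
have scaled (mu : {measure set 'rV[R]_n -> \bar R}) : mu setT = m%:E ->
    exists Q : probability 'rV[R]_n R, (forall A, Q A = ((m^-1)%:E * mu A)%E) /\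
    forall y, (\int[Q]_x (k x y + C)%:E = (m^-1)%:E * \int[mu]_x (k x y + C)%:E)%E.
  move=> mu1.
  exists (HB.pack_for (probability 'rV[R]_n R) (mscale r mu)
    (Measure_isProbability.Build _ _ _ (mscale r mu) (prob mu mu1))); split => // y.
  rewrite ge0_integral_mscale//.
    apply/measurable_EFinP; apply: measurable_funD; [exact: mk|exact: measurable_cst].
  by move=> x _; rewrite lee_fin; have := kC x y; rewrite ler_norml => /andP[]; lra.
have [Qa [QaE Qak]] := scaled al al1.
have [Qb [QbE Qbk]] := scaled be be1.
have QQ : mean_embedding Hk Qa = mean_embedding Hk Qb.
  apply: eq_mean_embedding => // y.
  have kE (Q : probability 'rV[R]_n R) : \int[Q]_x (k x y + C) = \int[Q]_x k x y + C.
    have ik := @integrable_bounded _ _ _ Q _ C (mk y) (fun x => kC x y).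
    have ic : Q.-integrable setT (EFin \o cst C) by apply: finite_measure_integrable_cst.
    rewrite (RintegralD measurableT ik ic); congr (_ + _).
    transitivity (C * fine (Q setT)); first exact: Rintegral_cst.
    by rewrite probability_setT mulr1.
  apply: (addIr C); rewrite -!kE /Rintegral; congr fine.
  by rewrite Qak Qbk albe.
move=> A mA; have := kchar _ _ QQ A mA; rewrite QaE QbE.
move=> /(congr1 (mule m%:E)); rewrite !muleA -EFinM divff ?mul1e//.
exact: lt0r_neq0.
Qed.

Section shift_argument.
Context (R : realType) (n : nat) (k : 'rV[R]_n -> 'rV[R]_n -> R) (Hk : rkhs k).
Hypotheses (n0 : (0 < n)%N) (kc : kernel_continuous k) (kb : kernel_bounded k)
  (km : kernel_measurable k) (kt : translation_invariant k)
  (kchar : characteristic_kernel Hk).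
Context d (T : measurableType d) (P : probability T R).
Variables (X : T -> 'rV[R]_n) (W : T -> R).
Hypotheses (mX : measurable_fun setT X) (iW : P.-integrable setT (EFin \o W)).
Hypothesis kW : forall y, \int[P]_w (k (X w) y * W w) = 0.

Lemma measurable_shift (a : 'rV[R]_n) : measurable_fun setT (fun x : 'rV[R]_n => x + a).
Proof.
apply: measurable_mxP => i j.
apply: (eq_measurable_fun (fun x : 'rV[R]_n => x i j + a i j)).
  by move=> x _; rewrite mxE.
by apply: measurable_funD; [exact: measurable_coord|exact: measurable_cst].
Qed.

(* The law of [X] under the positive part of [W] plus the law of [X + a] under
   the negative part, and the same with the two parts exchanged, are positive
   measures of equal mass and equal embedding; being characteristic, [k]
   identifies them. *)
Lemma shift_law (a : 'rV[R]_n) A : measurable A ->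
  \int[P]_w (\1_A (X w) * W w) = \int[P]_w (\1_A (X w + a) * W w).
Proof.
move=> mA.
have mW : measurable_fun setT W.
  by apply/measurable_EFinP; exact: (measurable_int P iW).
have mXa : measurable_fun setT (fun w => X w + a).
  exact: (measurableT_comp (measurable_shift a) mX).
pose Wp w := Num.max (W w) 0; pose Wn w := Num.max (- W w) 0.
have WE w : W w = Wp w - Wn w by rewrite /Wp /Wn; case: (lerP (W w) 0); case: (lerP (- W w) 0); lra.
have Wp0 w : 0 <= Wp w by rewrite le_max lexx orbT.
have Wn0 w : 0 <= Wn w by rewrite le_max lexx orbT.
have mWp : measurable_fun setT Wp by exact: measurable_maxr.
have mWn : measurable_fun setT Wn.
  by apply: measurable_maxr; [exact: measurable_funN|exact: measurable_cst].
have iWp : P.-integrable setT (EFin \o Wp).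
  apply: (le_integrable measurableT _ _ iW); first exact/measurable_EFinP.
  move=> w _; rewrite /= lee_fin (ger0_norm (Wp0 w)) /Wp.
  by rewrite ge_max normr_ge0 ler_norm.
have iWn : P.-integrable setT (EFin \o Wn).
  apply: (le_integrable measurableT _ _ iW); first exact/measurable_EFinP.
  move=> w _; rewrite /= lee_fin (ger0_norm (Wn0 w)) /Wn.
  by rewrite ge_max normr_ge0 -normrN ler_norm.
have split_W (f : 'rV[R]_n -> R) C Y : measurable_fun setT f ->
    (forall x, 0 <= f x <= C) -> measurable_fun setT Y ->
    \int[P]_w (f (Y w) * W w) = \int[P]_w (f (Y w) * Wp w) - \int[P]_w (f (Y w) * Wn w).
  move=> mf fC mY.
  have bf x : `|f x| <= C by have /andP[? ?] := fC x; rewrite ger0_norm.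
  have mfY : measurable_fun setT (f \o Y) by exact: (measurableT_comp mf mY).
  have i1 := @integrable_boundedM _ _ _ P (f \o Y) Wp C mfY (fun w => bf (Y w)) iWp.
  have i2 := @integrable_boundedM _ _ _ P (f \o Y) Wn C mfY (fun w => bf (Y w)) iWn.
  rewrite -(RintegralB measurableT i1 i2); apply: eq_Rintegral => w _.
  by rewrite WE mulrBr.
have [al alE] := mixture_measure mX mXa Wp0 Wn0 iWp iWn.
have [be beE] := mixture_measure mX mXa Wn0 Wp0 iWn iWp.
have indE (B : set 'rV[R]_n) (mu : {measure set 'rV[R]_n -> \bar R}) : measurable B ->
    mu B = (\int[mu]_x (\1_B x)%:E)%E by move=> mB; rewrite integral_indic// setIT.
have ind1 (B : set 'rV[R]_n) x : 0 <= (\1_B x : R) <= 1 by rewrite indicE; case: (_ \in _); rewrite /= ?lexx ler01.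
have mind (B : set 'rV[R]_n) : measurable B -> measurable_fun setT (\1_B : 'rV[R]_n -> R).
  by move=> mB; exact: measurable_indic.
have main (B : set 'rV[R]_n) : measurable B ->
    (al B = be B) -> \int[P]_w (\1_B (X w) * W w) = \int[P]_w (\1_B (X w + a) * W w).
  move=> mB; rewrite !indE// (alE _ 1 (mind _ mB) (ind1 B)) (beE _ 1 (mind _ mB) (ind1 B)).
  move=> [] h; rewrite (split_W _ 1 X (mind _ mB) (ind1 B) mX).
  rewrite (split_W _ 1 (fun w => X w + a) (mind _ mB) (ind1 B) mXa).
  by move: h; lra.
apply: main => //.
pose m := \int[P]_w Wp w + \int[P]_w Wn w.
have allE (V1 V2 : T -> R) : \int[P]_w (\1_[set: 'rV[R]_n] (X w) * V1 w) +
    \int[P]_w (\1_[set: 'rV[R]_n] (X w + a) * V2 w) = \int[P]_w V1 w + \int[P]_w V2 w.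
  by congr (_ + _); apply: eq_Rintegral => w _; rewrite indicT mul1r.
have al1 : al setT = m%:E.
  by rewrite indE// (alE _ 1 (mind _ measurableT) (ind1 _)) allE.
have be1 : be setT = m%:E.
  by rewrite indE// (beE _ 1 (mind _ measurableT) (ind1 _)) allE addrC.
have m0 : 0 <= m by rewrite addr_ge0// Rintegral_ge0.
have [C kC] := kb.
have [kappa _ kE] := kt.
have {m0} : 0 < m \/ m = 0 by move: m0; rewrite le_eqVlt => /predU1P[->|]; [right|left].
(* With zero total mass normalization is impossible, but both measures are then null. *)
move=> [m0|m0]; last first.
  have z (mu : {measure set 'rV[R]_n -> \bar R}) : mu setT = 0%E -> mu A = 0%E.
    move=> mu0; apply/eqP; rewrite eq_le measure_ge0 andbT -mu0.
    by rewrite le_measure ?inE.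
  by rewrite (z al) ?(z be) ?al1 ?be1 ?m0.
apply: (@characteristic_finite_measures _ _ _ Hk C m al be) => // y.
have mk z : measurable_fun setT (fun x => k x z).
  exact: (measurableT_comp km (pair2_measurable z)).
pose f z x := k x z + C.
have mf z : measurable_fun setT (f z) by apply: measurable_funD; [exact: mk|exact: measurable_cst].
have fC z x : 0 <= f z x <= C + C.
  by have := kC x z; rewrite /f ler_norml => /andP[? ?]; apply/andP; split; lra.
rewrite (alE _ _ (mf y) (fC y)) (beE _ _ (mf y) (fC y)); congr EFin.
have fW z : \int[P]_w (f z (X w) * W w) = C * \int[P]_w W w.
  have i1 := @integrable_boundedM _ _ _ P (fun w => k (X w) z) W C
    (measurableT_comp (mk z) mX) (fun w => kC (X w) z) iW.
  have i2 := @integrable_boundedM _ _ _ P (cst C) W `|C| (measurable_cst _) (fun=> lexx _) iW.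
  rewrite -(RintegralZl C measurableT iW).
  transitivity (\int[P]_w (k (X w) z * W w + C * W w)).
    by apply: eq_Rintegral => w _; rewrite /f mulrDl.
  by rewrite (RintegralD measurableT i1 i2) kW add0r.
have := fW y; rewrite (split_W _ _ X (mf y) (fC y) mX) => h1.
(* Translation invariance turns k (X + a) y into k X (y - a), so [kW] at y - a controls the shifted
   variable. *)
have := fW (y - a); rewrite (_ : \int[P]_w _ = \int[P]_w (f y (X w + a) * W w)); last first.
  by apply: eq_Rintegral => w _; rewrite /f !kE opprB addrA.
rewrite (split_W _ _ (fun w => X w + a) (mf y) (fC y) mXa) => h2.
by move: h1 h2; lra.
Qed.

(* A finite signed measure invariant under translations vanishes: it has no
   mass left on a slab once the slab is translated far away. *)
Lemma separates_signed A : measurable A -> \int[P]_w (\1_A (X w) * W w) = 0.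
Proof.
move=> mA; pose i0 : 'I_n := Ordinal n0.
pose S (m : nat) := [set x : 'rV[R]_n | `|x 0 i0| <= m%:R].
have mS m : measurable (A `&` S m).
  apply: measurableI => //.
  rewrite (_ : S m = setT `&` (fun x : 'rV[R]_n => x 0 i0) @^-1` `[- m%:R, m%:R]).
    by apply: measurable_coord => //; exact: measurable_itv.
  by apply/seteqP; split => x /=; rewrite in_itv /= -ler_norml // => -[].
have u_lim : \int[P]_w (\1_(A `&` S m) (X w) * W w) @[m --> \oo] -->
    \int[P]_w (\1_A (X w) * W w).
  apply: (cvg_Rintegral_eventually iW (C := 1)).
  - by move=> m; apply: (measurableT_comp _ mX); exact: measurable_indic.
  - by move=> m w; rewrite indicE; case: (_ \in _); rewrite /= ?normr1 ?normr0 ?ler01.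
  move=> w; have [N NX] : exists N, `|X w 0 i0| <= N%:R.
    by exists (Num.truncn `|X w 0 i0|).+1; rewrite ltW// truncnS_gt.
  exists N => // m /= Nm; rewrite !indicE; congr (nat_of_bool _)%:R.
  apply/idP/idP; rewrite !inE; first by case.
  move=> AX; split => //=.
  by apply: le_trans NX _; rewrite ler_nat.
(* A shift by 3 m empties the slab: for a coordinate x with |x| < m, the bound |x + 3 m| <= m is
   impossible. *)
pose a m : 'rV[R]_n := const_mx (3 * m%:R).
have u_lim0 : \int[P]_w (\1_(A `&` S m) (X w) * W w) @[m --> \oo] -->
    \int[P]_w ((cst 0 : T -> R) w * W w).
  under eq_cvg => m do rewrite (shift_law (a m) (mS m)).
  apply: (cvg_Rintegral_eventually iW (C := 1)).
  - move=> m.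
    have mi : measurable_fun setT (\1_(A `&` S m) : 'rV[R]_n -> R).
      exact: measurable_indic.
    exact: (measurableT_comp mi (measurableT_comp (measurable_shift (a m)) mX)).
  - by move=> m w; rewrite indicE; case: (_ \in _); rewrite /= ?normr1 ?normr0 ?ler01.
  move=> w; have [N NX] : exists N, `|X w 0 i0| < N%:R.
    by exists (Num.truncn `|X w 0 i0|).+1; rewrite truncnS_gt.
  exists N => // m /= Nm; rewrite indicE memNset// => -[_].
  rewrite /S /= !mxE ler_norml => /andP[_]; apply/negP; rewrite -ltNge.
  have Nm' : N%:R <= m%:R :> R by rewrite ler_nat.
  by move: NX; rewrite ltr_norml => /andP[? ?]; lra.
rewrite (cvg_unique (@Rhausdorff R) u_lim u_lim0).
by under eq_Rintegral do rewrite mul0r; rewrite Rintegral_cst// mul0r.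
Qed.

End shift_argument.

Section product_separation.
Context (R : realType) (M : nat) (d : 'I_M -> nat).
Variables (k : forall m, 'rV[R]_(d m) -> 'rV[R]_(d m) -> R) (Hk : forall m, rkhs (@k m)).
Hypotheses (d0 : forall m, (0 < d m)%N) (kc : forall m, kernel_continuous (@k m))
  (kb : forall m, kernel_bounded (@k m)) (km : forall m, kernel_measurable (@k m))
  (kt : forall m, translation_invariant (@k m))
  (kchar : forall m, characteristic_kernel (Hk m)).
Context dT (T : measurableType dT) (P : probability T R).
Variables (X : forall m, T -> 'rV[R]_(d m)) (W : T -> R).
Hypotheses (mX : forall m, measurable_fun setT (@X m))
  (iW : P.-integrable setT (EFin \o W)).
Hypothesis kW : forall y : (forall m, 'rV[R]_(d m)),
  \int[P]_w (\prod_m @k m (@X m w) (y m) * W w) = 0.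

(* The blocks are converted from kernel sections to indicators one at a time. *)
Lemma product_separates (A : forall m, set 'rV[R]_(d m)) :
  (forall m, measurable (A m)) ->
  \int[P]_w (\prod_m \1_(A m) (@X m w) * W w) = 0.
Proof.
move=> mA.
(* Hybrid product: the first [t] factors are indicators, the others are kernel sections. *)
pose F (t : nat) (y : forall m, 'rV[R]_(d m)) (m : 'I_M) (w : T) : R :=
  if (m < t)%N then \1_(A m) (@X m w) else @k m (@X m w) (y m).
suff H : forall t, (t <= M)%N -> forall y, \int[P]_w (\prod_m F t y m w * W w) = 0.
  rewrite -(H M (leqnn M) (fun=> 0)); apply: eq_Rintegral => w _; congr (_ * _).
  by apply: eq_bigr => m _; rewrite /F ltn_ord.
have mF t y (m : 'I_M) : measurable_fun setT (F t y m).
  rewrite /F; case: (m < t)%N.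
    have mi : measurable_fun setT (\1_(A m) : 'rV[R]_(d m) -> R) by exact: measurable_indic.
    exact: (measurableT_comp mi (@mX m)).
  have mk : measurable_fun setT (fun x => @k m x (y m)).
    exact: (measurableT_comp (@km m) (pair2_measurable (y m))).
  exact: (measurableT_comp mk (@mX m)).
pose C (m : 'I_M) := Num.max 1 (sval (cid (@kb m))).
have FC t y (m : 'I_M) w : `|F t y m w| <= C m.
  rewrite /F /C; case: (m < t)%N.
    by rewrite indicE le_max; case: (_ \in _); rewrite ?normr1 ?normr0 ?lexx ?ler01.
  by rewrite le_max; case: cid => c /= kc'; rewrite kc' orbT.
elim=> [_ y|t IH tM y].
  by rewrite -[RHS](kW y); apply: eq_Rintegral.
pose m0 := Ordinal tM.
(* All factors but that of [m0] are absorbed into the weight. Changing [y] at [m0] alone leaves [V]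
   as it is, so the induction hypothesis says that [V] is orthogonal to every section of the kernel
   of block [m0]. *)
pose V w := \prod_(m : 'I_M | m != m0) F t y m w * W w.
have iV : P.-integrable setT (EFin \o V).
  apply: (@integrable_boundedM _ _ _ P (fun w => \prod_(m : 'I_M | m != m0) F t y m w) W
    (\prod_(m : 'I_M | m != m0) C m)) => //.
    apply: (eq_measurable_fun (fun w => \prod_(m < M) if m != m0 then F t y m w else 1)).
      by move=> w _; rewrite [RHS]big_mkcond.
    apply: measurable_prod => m _; case: (m != m0); [exact: mF|exact: measurable_cst].
  by move=> w; rewrite normr_prod; apply: ler_prod => m _; rewrite normr_ge0 FC.
have kV z : \int[P]_w (@k m0 (@X m0 w) z * V w) = 0.
  rewrite -(IH (ltnW tM) (@eqtype.dfwith _ _ y m0 z)); apply: eq_Rintegral => w _.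
  rewrite (bigD1 m0)//= /V mulrA; congr (_ * _ * _).
    by rewrite /F ltnn eqtype.dfwith_in.
  by apply: eq_bigr => m mm0; rewrite /F; case: ifP => // _; rewrite eqtype.dfwith_out// eq_sym.
have := separates_signed (d0 m0) (@kc m0) (@kb m0) (@km m0) (@kt m0)
  (@kchar m0) (@mX m0) iV kV (mA m0).
move=> <-; apply: eq_Rintegral => w _.
rewrite (bigD1 m0)//= /V mulrA; congr (_ * _ * _); first by rewrite /F ltnSn.
apply: eq_bigr => m mm0; rewrite /F ltnS leq_eqVlt.
by rewrite -[X in X == t]/(nat_of_ord m) (_ : (m == t :> nat) = (m == m0))// (negbTE mm0).
Qed.

End product_separation.

(** * Embeddings of the correlated Gaussian laws *)

Section bounded_integrals.
Context (R : realType) (n : nat) (i j : 'I_n) (ij : i != j).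
Local Notation P := (@corr_gauss R n i j).

Lemma integrable_corr_ratio a : a ^+ 2 < 1 ->
  (P 0).-integrable setT (EFin \o corr_ratio i j a).
Proof.
move=> a1; apply/integrableP; split.
  by apply/measurable_EFinP; exact: measurable_corr_ratio.
under eq_integral do rewrite /= ger0_norm ?corr_ratio_ge0//.
have := corr_gaussE ij a1 measurableT; rewrite probability_setT => <-.
by rewrite ltry.
Qed.

(** The identity for nonnegative functions is applied to f + C; the ratio has integral 1, so C
    contributes equally to both sides and cancels. *)
Lemma Rintegral_corr_ratio a (f : 'rV[R]_n -> R) C : a ^+ 2 < 1 ->
  measurable_fun setT f -> (forall x, `|f x| <= C) ->
  \int[P a]_x f x = \int[P 0]_x (f x * corr_ratio i j a x).
Proof.
move=> a1 mf fC.
have f0 x : (0 <= (f x + C)%:E :> \bar R)%E.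
  by rewrite lee_fin; have := fC x; rewrite ler_norml => /andP[]; lra.
have mfC : measurable_fun setT (fun x => (f x + C)%:E : \bar R).
  by apply/measurable_EFinP; apply: measurable_funD.
have E0 : \int[P a]_x (f x + C) = \int[P 0]_x ((f x + C) * corr_ratio i j a x).
  apply: (congr1 fine).
  exact: (@ge0_integral_corr_ratio R n i j ij a (fun x => (f x + C)%:E) a1 mfC f0).
have iL := integrable_corr_ratio a1.
have iL1 : \int[P 0]_x corr_ratio i j a x = 1.
  have := congr1 fine (corr_gaussE ij a1 measurableT).
  by rewrite probability_setT => h; symmetry; exact: h.
have i1 := @integrable_bounded _ _ _ (P a) f C mf fC.
have i2 : (P a).-integrable setT (EFin \o cst C) by apply: finite_measure_integrable_cst.
have i3 := @integrable_boundedM _ _ _ (P 0) f _ C mf fC iL.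
have i4 := @integrable_boundedM _ _ _ (P 0) (cst C) _ `|C| (measurable_cst _) (fun=> lexx _) iL.
have E1 : \int[P a]_x (f x + C) = \int[P a]_x f x + C.
  rewrite (RintegralD measurableT i1 i2); congr (_ + _).
  transitivity (C * fine (P a setT)); first exact: Rintegral_cst.
  by rewrite probability_setT mulr1.
have E2 : \int[P 0]_x ((f x + C) * corr_ratio i j a x) =
    \int[P 0]_x (f x * corr_ratio i j a x) + C.
  transitivity (\int[P 0]_x (f x * corr_ratio i j a x + C * corr_ratio i j a x)).
    by apply: eq_Rintegral => x _; rewrite mulrDl.
  rewrite (RintegralD measurableT i3 i4); congr (_ + _).
  by rewrite (RintegralZl C measurableT iL) iL1 mulr1.
by apply: (addIr C); exact: etrans (esym E1) (etrans E0 E2).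
Qed.

Lemma measurable_flip_row (S : pred 'I_n) : measurable_fun setT (@flip_row R n S).
Proof.
apply: measurable_mxP => l m.
apply: (eq_measurable_fun (fun x : 'rV[R]_n => if S m then - x 0 m else x 0 m)).
  by move=> x _; rewrite mxE.
by case: (S m); [apply: measurable_funN|]; exact: measurable_coord.
Qed.

Lemma Rintegral_corr_gauss_flip (S : pred 'I_n) a (f : 'rV[R]_n -> R) C :
  ~~ S i -> S j -> measurable_fun setT f -> (forall x, `|f x| <= C) ->
  \int[P (- a)]_x f x = \int[P a]_x f (flip_row S x).
Proof.
move=> Si Sj mf fC; apply: (congr1 fine).
have mS := @measurable_flip_row S.
transitivity (\int[image_measure (P a) mS]_x (f x)%:E)%E.
  by apply: eq_measure_integral => A mA _; exact: (corr_gauss_flip ij _ Si Sj mA).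
etransitivity; first apply: (integral_pushforward mS).
- by apply/measurable_EFinP.
- exact: (@integrable_bounded _ _ _ (P a) (f \o flip_row S) C (measurableT_comp mf mS)
    (fun x => fC _)).
- exact: measurableT.
by rewrite preimage_setT.
Qed.

(** The fourfold integral of [ge0_integral_corr_gauss_sub] contains a and b only through a + b; it
    serves as [K] once the shift by [C] is undone. *)
Lemma Rintegral_sub_corr_gauss (kap : 'rV[R]_n -> R) C :
  measurable_fun setT kap -> (forall x, `|kap x| <= C) ->
  exists K : R -> R, forall a b, a ^+ 2 < 1 -> b ^+ 2 < 1 ->
    \int[P a]_x \int[P b]_y kap (x - y) = K (a + b).
Proof.
move=> mk kC.
pose f x : \bar R := (kap x + C)%:E.
have mf : measurable_fun setT f by apply/measurable_EFinP; exact: measurable_funD.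
have f0 x : (0 <= f x)%E.
  by rewrite lee_fin; have := kC x; rewrite ler_norml => /andP[]; lra.
pose I s := (\int[iid (@normal_prob R 0 1) n]_t \int[iid (@normal_prob R 0 1) n]_t'
    \int[@normal_prob R 0 1]_u \int[@normal_prob R 0 1]_w
    f (put i j (row_of_tuple t - row_of_tuple t') (Num.sqrt 2 * u)
      (s / Num.sqrt 2 * u + Num.sqrt (2 - s ^+ 2 / 2) * w))%R)%E.
exists (fun s => fine (I s) - C) => a b a1 b1.
transitivity (fine (\int[P a]_x \int[P b]_y f (x - y)%R)%E - C); last first.
  apply: (congr1 (fun I => fine I - C)).
  exact: (ge0_integral_corr_gauss_sub ij a1 b1 mf f0).
have mkB x : measurable_fun setT (fun y : 'rV[R]_n => kap (x - y)).
  exact: (measurableT_comp mk (measurableT_comp (@measurable_rowB R n) (pair1_measurable x))).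
have C_int (Q : probability 'rV[R]_n R) : \int[Q]_x C = C.
  transitivity (C * fine (Q setT)); first exact: Rintegral_cst.
  by rewrite probability_setT mulr1.
have iC (Q : probability 'rV[R]_n R) : Q.-integrable setT (EFin \o cst C).
  by apply: finite_measure_integrable_cst.
have ik x := @integrable_bounded _ _ _ (P b) _ C (mkB x) (fun y => kC (x - y)).
pose h x := \int[P b]_y kap (x - y).
have hE x : (\int[P b]_y f (x - y)%R = (h x + C)%:E)%E.
  have := RintegralD measurableT (ik x) (iC (P b)); rewrite C_int => <-.
  rewrite /Rintegral fineK//.
  exact: (integrable_fin_num measurableT (integrableD measurableT (ik x) (iC (P b)))).
have mh : measurable_fun setT h.
  have mI : measurable_fun setT (fun x : 'rV[R]_n => \int[P b]_y f (x - y)%R)%E.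
    pose F (z : 'rV[R]_n * 'rV[R]_n) := f (z.1 - z.2).
    apply: (measurable_fun_fubini_tonelli_F F) => [|z]; last exact: f0.
    exact: (measurableT_comp mf (@measurable_rowB R n)).
  have : measurable_fun setT (fun x : 'rV[R]_n => fine (\int[P b]_y f (x - y)%R)%E - C).
    apply: measurable_funB => //; exact: (measurableT_comp (fine_measurable measurableT) mI).
  apply: eq_measurable_fun => x _; by rewrite hE /= addrK.
have hC x : `|h x| <= C.
  apply: le_trans (le_normr_Rintegral measurableT (ik x)) _.
  rewrite -(C_int (P b)).
  exact: (le_Rintegral measurableT (integrable_norm (ik x)) (iC (P b)) (fun y _ => kC _)).
have ih := @integrable_bounded _ _ _ (P a) _ C mh hC.
have := RintegralD measurableT ih (iC (P a)); rewrite C_int => hh.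
apply: (addIr C); rewrite subrK -[LHS]hh; apply: (congr1 fine).
by apply: eq_integral => x _; rewrite hE.
Qed.

End bounded_integrals.

Lemma continuous_prod (R : realType) (T : topologicalType) (I : Type) (r : seq I)
    (F : I -> T -> R) :
  (forall m, continuous (F m)) -> continuous (fun x => \prod_(m <- r) F m x).
Proof.
move=> cF; elim: r => [|m r IH].
  rewrite (_ : (fun _ => _) = cst 1); last by apply/funext => x; rewrite big_nil.
  by move=> x; exact: cvg_cst.
rewrite (_ : (fun _ => _) = (fun x => F m x * \prod_(m <- r) F m x)).
  by move=> x; apply: cvgM; [exact: cF|exact: IH].
by apply/funext => x; rewrite big_cons.
Qed.

Section product_kernel.
Context (R : realType) (M : nat) (d : 'I_M -> nat).
Local Notation D := (\sum_(m < M) d m)%N.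
Variable k : forall m, 'rV[R]_(d m) -> 'rV[R]_(d m) -> R.
Hypotheses (kc : forall m, kernel_continuous (@k m)) (kb : forall m, kernel_bounded (@k m))
  (km : forall m, kernel_measurable (@k m)).

Lemma continuous_block m : continuous (@block R M d m).
Proof.
move=> x; apply: (@cvg_row _ _ _ (nbhs x) (nbhs_filter x)) => l; rewrite blockE.
under eq_cvg do rewrite blockE.
exact: (@coord_continuous R 1 D 0 (tagnat.Rank m l) x).
Qed.

Lemma prod_kernel_continuous : kernel_continuous (prod_kernel k).
Proof.
apply: (continuous_prod (F := fun m (z : 'rV[R]_D * 'rV[R]_D) => @k m (block m z.1) (block m z.2))).
move=> m z.
have c1 : block m z'.1 @[z' --> z] --> block m z.1.
  by apply: (cvg_comp fst (@block R M d m)); [exact: cvg_fst|exact: continuous_block].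
have c2 : block m z'.2 @[z' --> z] --> block m z.2.
  by apply: (cvg_comp snd (@block R M d m)); [exact: cvg_snd|exact: continuous_block].
exact: (cvg_comp _ (fun z => @k m z.1 z.2) (cvg_pair c1 c2) (@kc m (_, _))).
Qed.

Lemma prod_kernel_bounded : kernel_bounded (prod_kernel k).
Proof.
exists (\prod_m sval (cid (@kb m))) => x y; rewrite normr_prod.
by apply: ler_prod => m _; rewrite normr_ge0; case: cid => C /= ->.
Qed.

Lemma prod_kernel_measurable : kernel_measurable (prod_kernel k).
Proof.
apply: measurable_prod => m _.
have mb : measurable_fun setT (fun z : 'rV[R]_D * 'rV[R]_D => (block m z.1, block m z.2)).
  apply: measurable_fun_pair.
    exact: (measurableT_comp (@measurable_block R M d m) measurable_fst).
  exact: (measurableT_comp (@measurable_block R M d m) measurable_snd).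
exact: (measurableT_comp (@km m) mb).
Qed.

End product_kernel.

Section embeddings.
Context (R : realType) (M : nat) (d : 'I_M -> nat).
Local Notation D := (\sum_(m < M) d m)%N.
Variables (k : forall m, 'rV[R]_(d m) -> 'rV[R]_(d m) -> R) (H : rkhs (prod_kernel k)).
Hypotheses (kc : forall m, kernel_continuous (@k m)) (kb : forall m, kernel_bounded (@k m))
  (km : forall m, kernel_measurable (@k m)).
Variable kappa : forall m, 'rV[R]_(d m) -> R.
Hypotheses (kE : forall m x y, @k m x y = @kappa m (x - y))
  (ksym : forall m x y, @k m x y = @k m y x).
Variables (i j : 'I_D).
Hypothesis bij : tagnat.sig1 i != tagnat.sig1 j.
Let ij : i != j := neq_sig1 bij.
Local Notation P := (@corr_gauss R D i j).
Let pc := prod_kernel_continuous kc.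
Let pb := prod_kernel_bounded kb.
Let pm := prod_kernel_measurable km.

Definition corr_embedding a : H := mean_embedding H (P a).
Local Notation mu := corr_embedding.

Lemma blockB m (x y : 'rV[R]_D) : block m (x - y) = block m x - block m y.
Proof. by apply/rowP => l; rewrite !mxE. Qed.

Lemma kappa_sym m z : @kappa m (- z) = @kappa m z.
Proof. by rewrite -[- z]sub0r -kE ksym kE subr0. Qed.

Lemma HSIC_corr_gauss a : a ^+ 2 < 1 -> HSIC H (P a) = `|mu a - mu 0|.
Proof.
move=> a1; rewrite /HSIC; congr (`|_ - _|).
apply: eq_mean_embedding => // y; apply: (congr1 fine).
by apply: eq_measure_integral => A mA _; exact: (prod_marginals_corr_gauss bij a1 mA).
Qed.

Lemma corr_embedding_sum : exists K : R -> R, forall a b, a ^+ 2 < 1 -> b ^+ 2 < 1 ->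
  inner (mu a) (mu b) = K (a + b).
Proof.
pose kap (z : 'rV[R]_D) := prod_kernel k z 0.
have kapE x y : prod_kernel k x y = kap (x - y).
  by apply: eq_bigr => m _; rewrite !kE -!blockB subr0.
have mkap : measurable_fun setT kap.
  exact: (measurableT_comp pm (pair2_measurable (0 : 'rV[R]_D))).
have [C kC] := pb.
have [K KE] := Rintegral_sub_corr_gauss ij mkap (fun x => kC x 0).
exists K => a b a1 b1; rewrite -(KE a b a1 b1).
etransitivity; first exact: (inner_mean_embeddings H pc pb).
by apply: eq_Rintegral => x _; apply: eq_Rintegral => y _.
Qed.

(** Flipping every coordinate in the block of [j] exchanges [P a] and [P (- a)]. It preserves the
    product kernel because each [kappa m] is even, which requires negating a block as a whole and
    not [j] alone. *)
Lemma corr_embedding_even a : inner (mu (- a)) (mu (- a)) = inner (mu a) (mu a).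
Proof.
pose S (l : 'I_D) := tagnat.sig1 l == tagnat.sig1 j.
have Si : ~~ S i by exact: bij.
have Sj : S j by rewrite /S.
have kS x y : prod_kernel k (flip_row S x) (flip_row S y) = prod_kernel k x y.
  apply: eq_bigr => m _; rewrite !kE -!blockB.
  have [mj|mj] := boolP (m == tagnat.sig1 j).
    rewrite -[RHS]kappa_sym; congr (kappa _); apply/rowP => l.
    by rewrite !mxE /S tagnat.Rank1K mj; ring.
  congr (kappa _); apply/rowP => l.
  by rewrite !mxE /S tagnat.Rank1K (negbTE mj).
have [C kC] := pb.
set u := mu (- a).
have mu_flip z : inner (@feature R _ _ H z) u = \int[P a]_y prod_kernel k (flip_row S y) z.
  have mk : measurable_fun setT (fun x => prod_kernel k x z).
    exact: (measurableT_comp pm (pair2_measurable (z : 'rV[R]_D))).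
  rewrite innerC (inner_mean_embedding_feature H pc pb).
  exact: (Rintegral_corr_gauss_flip ij a Si Sj mk (fun x => kC x z)).
have [Cu uC] := inner_feature_bounded pb u.
transitivity (\int[P (- a)]_x inner (@feature R _ _ H x) u).
  exact: (inner_mean_embedding pc pb).
rewrite (Rintegral_corr_gauss_flip ij a Si Sj (measurable_inner_feature pc pb u) uC).
etransitivity; last (symmetry; exact: (inner_mean_embeddings H pc pb)).
apply: eq_Rintegral => x _; rewrite mu_flip; apply: eq_Rintegral => y _.
by rewrite kS (kernel_sym H).
Qed.

End embeddings.

(** * From a lower bound on HSIC to a lower bound on the risk *)

Section two_gaussians.
Context (R : realType) (M : nat) (d : 'I_M -> nat).
Local Notation D := (\sum_(m < M) d m)%N.
Variables (k : forall m, 'rV[R]_(d m) -> 'rV[R]_(d m) -> R) (H : rkhs (prod_kernel k)).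
Hypotheses (kc : forall m, kernel_continuous (@k m)) (kb : forall m, kernel_bounded (@k m)).
Variables (i j : 'I_D).
Hypothesis bij : tagnat.sig1 i != tagnat.sig1 j.
Let ij : i != j := neq_sig1 bij.
Local Notation P := (@corr_gauss R D i j).
Variable PP : set (probability 'rV[R]_D R).
Hypothesis hPP : forall mu A, A \in unitmx -> PP (gaussian mu A).

Lemma minimax_corr_gauss n a eps : (2 <= n)%N -> a ^+ 2 <= n%:R^-1 ->
  2 * eps <= HSIC H (P a) ->
  (((1 - Num.sqrt (5 / 8)) / 2)%:E <= minimax_risk n PP (HSIC H) eps)%E.
Proof.
move=> n2 an epsa.
have n1 : n%:R^-1 < 1 :> R by rewrite invf_lt1 ?ltr1n// ltr0n ltnW.
have a1 : a ^+ 2 < 1 by exact: le_lt_trans n1.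
have PPa c : c ^+ 2 < 1 -> PP (P c).
  by move=> c1; apply: hPP; apply: shear_mx_unit => //; rewrite gt_eqF// cocorr_gt0.
have g2 : (\int[P 0]_x (corr_ratio i j a x ^+ 2)%:E <= ((1 - n%:R^-1)^-1)%:E)%E.
  rewrite (integral_corr_ratio_sqr ij a1) lee_fin lef_pV2 ?posrE ?subr_gt0//.
  by rewrite lerD2l lerN2.
apply: (minimax_two_points (measurable_corr_ratio i j a) (corr_ratio_ge0 i j a)
  (fun A => @corr_gaussE R D i j ij a A a1) n2 g2 _ _ _ epsa).
- by apply: PPa; exact: sqr0_lt1.
- exact: PPa.
- by rewrite (HSIC_corr_gauss H kc kb bij (sqr0_lt1 R)) subrr normr0.
Qed.

End two_gaussians.

(** * Characteristic kernels: distinct embeddings and the bound of part (ii) *)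

Lemma Rintegral_indic_eq0 d (T : measurableType d) (R : realType) (P : probability T R)
    (S : set T) (W : T -> R) : measurable S -> P.-integrable setT (EFin \o W) ->
  (forall x, S x -> 0 < W x) -> \int[P]_x (\1_S x * W x) = 0 -> P S = 0%E.
Proof.
move=> mS iW W0 int0; pose f x := \1_S x * W x.
have iF : P.-integrable setT (EFin \o f).
  have mI : measurable_fun setT (\1_S : T -> R) by exact: measurable_indic.
  have bI x : `|\1_S x : R| <= 1.
    by rewrite indicE; case: (_ \in _); rewrite ?normr1 ?normr0.
  exact: (integrable_boundedM mI bI iW).
have f0 x : 0 <= f x.
  rewrite /f indicE; case: (boolP (x \in S)) => [/set_mem/W0/ltW|_]; first by rewrite mul1r.
  by rewrite mul0r.
have : (\int[P]_x `|(f x)%:E| = 0)%E.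
  under eq_integral do rewrite abse_EFin ger0_norm//.
  by rewrite -(fineK (integrable_fin_num measurableT iF)); congr (_%:E); exact: int0.
move/(ae_eq_integral_abs _ measurableT (measurable_int _ iF)).
case=> Z [mZ Z0 sZ].
apply/eqP; rewrite -measure_le0 -Z0; apply: le_measure; rewrite ?inE// => x Sx.
apply: sZ => /= /(_ I)/eqP.
by rewrite eqe /f indicE mem_set// mul1r gt_eqF// W0.
Qed.

(** The two open half-lines have equal mass by symmetry and the origin is null; were the half-lines
    null, the whole line would be. *)
Lemma normal_prob_pos_gt0 (R : realType) :
  (0 < @normal_prob R 0 1 [set x : measurableTypeR R | (0 < x)%R])%E.
Proof.
set N := normal_prob 0 1; set S := [set _ | _].
have SE : S = `]0, +oo[%classic by apply/seteqP; split => x /=; rewrite in_itv/= andbT.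
have mS : measurable S by rewrite SE; exact: measurable_itv.
have mSN : measurable (-%R @^-1` S).
  by rewrite -[X in measurable X]setTI; apply: oppr_measurable.
rewrite lt0e measure_ge0 andbT; apply/eqP => S0.
have N0 : N [set 0] = 0%E.
  have := @normal_prob_dominates R 0 1 => /null_content_dominatesP; apply => //.
  exact: lebesgue_measure_set1.
have : N setT = 1%E by exact: probability_setT.
have -> : [set: measurableTypeR R] = S `|` (-%R @^-1` S) `|` [set 0].
  apply/seteqP; split => // x _; rewrite /S /=.
  by have [x0|x0|->] := ltrgtP x 0; [left; right; rewrite oppr_gt0|left; left|right].
apply/eqP; rewrite lt_eqF//.
have S1 : N (-%R @^-1` S) = 0%E by etransitivity; [exact: (normal_probN mS)|exact: S0].
have N3 : (N S + N (-%R @^-1` S) + N [set 0%R] = 0)%E by rewrite S0 S1 N0 !adde0.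
apply: (@le_lt_trans _ _ (N S + N (-%R @^-1` S) + N [set 0%R])%E); last by rewrite N3 lte01.
apply: le_trans (measureU2 _ _ _) _ => //; first exact: measurableU.
by apply: leeD => //; exact: measureU2.
Qed.

Section distinct_embeddings.
Context (R : realType) (M : nat) (d : 'I_M -> nat).
Local Notation D := (\sum_(m < M) d m)%N.
Variables (k : forall m, 'rV[R]_(d m) -> 'rV[R]_(d m) -> R) (H : rkhs (prod_kernel k)).
Variables (Hk : forall m, rkhs (@k m)).
Hypotheses (d0 : forall m, (0 < d m)%N)
  (kc : forall m, kernel_continuous (@k m)) (kb : forall m, kernel_bounded (@k m))
  (km : forall m, kernel_measurable (@k m)) (kt : forall m, translation_invariant (@k m))
  (kchar : forall m, characteristic_kernel (Hk m)).
Variables (i j : 'I_D).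
Hypothesis bij : tagnat.sig1 i != tagnat.sig1 j.
Let ij : i != j := neq_sig1 bij.
Local Notation P := (@corr_gauss R D i j).

(** The two exponents differ by 2 r x y / (1 - r^2). *)
Lemma corr_density_lt r x y : 0 < r -> r ^+ 2 < 1 -> 0 < x -> 0 < y ->
  corr_density (- r) x y < corr_density r x y :> R.
Proof.
move=> r0 r1 x0 y0; rewrite /corr_density.
have -> : cocorr (- r) = cocorr r :> R by rewrite /cocorr sqrrN.
have c0 := cocorr_gt0 r1.
rewrite ltr_pM2l ?invr_gt0// ltr_expR ltr_pM2r ?invr_gt0// ltrN2 ltrD2r.
rewrite ltr_pM2r ?invr_gt0 ?exprn_gt0//.
by have := mulr_gt0 (mulr_gt0 r0 x0) y0; nra.
Qed.

(** If the embeddings agreed, the difference [W] of the two densities would be orthogonal to all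
    sections of the product kernel, hence to all products of block indicators. But [W] is positive
    wherever the coordinates [i] and [j] are both positive, and this quadrant is such a product and
    has positive mass under [P 0]. *)
Lemma corr_embedding_neq r : 0 < r -> r ^+ 2 < 1 ->
  corr_embedding H i j r != corr_embedding H i j (- r).
Proof.
move=> r0 r1; apply/eqP => mu_eq.
have r1' : (- r) ^+ 2 < 1 by rewrite sqrrN.
have pc := prod_kernel_continuous kc; have pb := prod_kernel_bounded kb.
have pm := prod_kernel_measurable km.
pose W x := corr_ratio i j r x - corr_ratio i j (- r) x.
have iL1 := integrable_corr_ratio ij r1; have iL2 := integrable_corr_ratio ij r1'.
have iW : (P 0).-integrable setT (EFin \o W) by exact: (integrableB measurableT iL1 iL2).
have [C kC] := pb.
have kW (y : forall m, 'rV[R]_(d m)) :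
    \int[P 0]_x (\prod_m @k m (block m x) (y m) * W x) = 0.
  pose Y : 'rV[R]_D := \mxrow_m y m.
  have mk : measurable_fun setT (fun x => prod_kernel k x Y).
    exact: (measurableT_comp pm (pair2_measurable Y)).
  have kE x : \prod_m @k m (block m x) (y m) = prod_kernel k x Y.
    by apply: eq_bigr => m _; rewrite /Y [block m (\mxrow__ _)]mxrowK.
  have i1 := @integrable_boundedM _ _ _ (P 0) _ _ C mk (fun x => kC x Y) iL1.
  have i2 := @integrable_boundedM _ _ _ (P 0) _ _ C mk (fun x => kC x Y) iL2.
  transitivity (\int[P 0]_x (prod_kernel k x Y * corr_ratio i j r x -
      prod_kernel k x Y * corr_ratio i j (- r) x)).
    by apply: eq_Rintegral => x _; rewrite kE /W mulrBr.
  rewrite (RintegralB measurableT i1 i2).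
  rewrite -(Rintegral_corr_ratio ij r1 mk (fun x => kC x Y)).
  rewrite -(Rintegral_corr_ratio ij r1' mk (fun x => kC x Y)).
  rewrite -!(inner_mean_embedding_feature H pc pb) -/(corr_embedding H i j r).
  by rewrite mu_eq subrr.
pose B l : set (measurableTypeR R) := if l \in [:: i; j] then [set x | 0 < x] else setT.
have mpos : measurable [set x : measurableTypeR R | 0 < x].
  rewrite (_ : [set _ | _] = `]0, +oo[%classic); first exact: measurable_itv.
  by apply/seteqP; split => x /=; rewrite in_itv/= andbT.
have mB l : measurable (B l) by rewrite /B; case: ifP.
pose A m : set 'rV[R]_(d m) := [set z | forall l, B (tagnat.Rank m l) (z 0 l)].
have mA m : measurable (A m).
  exact: (@measurable_row_box R (d m) (fun l => B (tagnat.Rank m l)) (fun l => mB _)).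
pose S := [set x : 'rV[R]_D | forall l, B l (x 0 l)].
have PS : (0 < P 0 S)%E.
  have B0 l : (0 < @normal_prob R 0 1 (B l))%E.
    rewrite /B; case: ifP => _; first exact: normal_prob_pos_gt0.
    have -> : @normal_prob R 0 1 setT = 1%E by exact: probability_setT.
    exact: lte01.
  have -> : P 0 S = (\prod_(l < D) @normal_prob R 0 1 (B l))%E by exact: (corr_gauss0_box ij mB).
  by elim/big_ind: _ => [|x y|l _]; [exact: lte01|exact: mule_gt0|exact: B0].
have blA m x : (block m x \in A m) = `[< forall l, B (tagnat.Rank m l) (x 0 (tagnat.Rank m l)) >].
  by apply/idP/asboolP => [/set_mem h l|h]; [|apply/mem_set => l];
    have := h l; rewrite blockE.
have ind x : \prod_m \1_(A m) (block m x) = \1_S x :> R.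
  under eq_bigr do rewrite indicE blA.
  rewrite indicE; have [xS|xS] := boolP (x \in S).
    rewrite big1 => [|m _]; first by [].
    rewrite asboolT; [exact: mulr1n|move=> l; exact: (set_mem xS)].
  have /existsNP[m xm] : ~ forall m l, B (tagnat.Rank m l) (x 0 (tagnat.Rank m l)).
    move=> h; move/negP: xS; apply; apply/mem_set => l.
    by have := h (tagnat.sig1 l) (tagnat.sig2 l); rewrite tagnat.sig2K.
  rewrite (bigD1 m) => [|//]; rewrite (asboolF xm); exact: mul0r.
have := product_separates d0 kc kb km kt kchar (@measurable_block R M d) iW kW mA.
under eq_Rintegral do rewrite ind.
move=> int0.
have W0 x : S x -> 0 < W x.
  move=> Sx.
  have xi : 0 < x 0 i by have := Sx i; rewrite /B mem_head.
  have xj : 0 < x 0 j by have := Sx j; rewrite /B !inE eqxx orbT.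
  by rewrite subr_gt0; exact: corr_density_lt r0 r1 xi xj.
have mS : measurable S by exact: (measurable_row_box mB).
by move: PS; rewrite (Rintegral_indic_eq0 mS iW W0 int0) ltxx.
Qed.

End distinct_embeddings.

Section part_ii.
Context (R : realType) (M : nat) (d : 'I_M -> nat).
Local Notation D := (\sum_(m < M) d m)%N.
Hypotheses (hM : (2 <= M)%N) (hd : forall m, (0 < d m)%N).
Variable PP : set (probability 'rV[R]_D R).
Hypothesis hPP : forall mu A, A \in unitmx -> PP (gaussian mu A).
Variables (k : forall m, 'rV[R]_(d m) -> 'rV[R]_(d m) -> R) (H : rkhs (prod_kernel k)).

Lemma two_blocks : exists i j : 'I_D, tagnat.sig1 i != tagnat.sig1 j.
Proof.
have h0 : (0 < M)%N by exact: ltn_trans hM.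
pose pt m := tagnat.Rank m (Ordinal (hd m)).
exists (pt (Ordinal h0)), (pt (Ordinal hM)).
by rewrite !tagnat.Rank1K.
Qed.

Lemma minimax_characteristic (Hk : forall m, rkhs (@k m)) :
  (forall m, kernel_measurable (@k m)) ->
  (forall m,
      [/\ kernel_continuous (@k m), kernel_bounded (@k m),
          translation_invariant (@k m) & characteristic_kernel (Hk m)]) ->
  exists2 c : R, 0 < c &
    forall n, (2 <= n)%N ->
      (((1 - Num.sqrt (5 / 8)) / 2)%:E <=
         minimax_risk n PP (HSIC H) (c / Num.sqrt n%:R))%E.
Proof.
move=> km h.
have kc m : kernel_continuous (@k m) by case: (h m).
have kb m : kernel_bounded (@k m) by case: (h m).
have kt m : translation_invariant (@k m) by case: (h m).
have kchar m : characteristic_kernel (Hk m) by case: (h m).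
have [i [j bij]] := two_blocks.
have [kappa kE] : exists kappa : forall m, 'rV[R]_(d m) -> R,
    forall m x y, @k m x y = kappa m (x - y).
  have kt' m : {kappa : 'rV[R]_(d m) -> R & forall x y, @k m x y = kappa (x - y)}.
    by have [kap _ e] := cid2 (kt m); exists kap.
  by exists (fun m => projT1 (kt' m)) => m; exact: (projT2 (kt' m)).
have ksym m x y : @k m x y = @k m y x by exact: kernel_sym (Hk m) x y.
have [K KE] := corr_embedding_sum H kc kb km kE bij.
(* K s is the squared norm of the embedding of [P (s / 2)], so this is [corr_embedding_even] at s /
   2. *)
have K_even s : s ^+ 2 < 4 -> K (- s) = K s.
  move=> s4.
  have s1 : (s / 2) ^+ 2 < 1 by rewrite expr_div_n ltr_pdivrMr//; lra.
  have s1' : (- (s / 2)) ^+ 2 < 1 by rewrite sqrrN.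
  have e := corr_embedding_even H kc kb km kE ksym bij (s / 2).
  have e1 := KE _ _ s1' s1'; have e2 := KE _ _ s1 s1.
  move: e1 e2; rewrite -opprD -splitr => e1 e2.
  exact: (etrans (esym e1) (etrans e e2)).
have r8 : (8^-1 : R) ^+ 2 < 1 by rewrite exprVn invf_lt1 ?exprn_gt0//; lra.
have r80 : (0 : R) < 8^-1 by rewrite invr_gt0.
have [c c0 Kc] := gram_lower_bound KE K_even
  (corr_embedding_neq H hd kc kb km kt kchar bij r80 r8).
exists (c / 4) => [|n n2]; first by rewrite divr_gt0.
have sn0 : 0 < Num.sqrt n%:R :> R by rewrite sqrtr_gt0 ltr0n ltnW.
(* This p satisfies sqrt n < p <= 2 sqrt n. The first inequality gives (4 p)^-2 <= 1 / n, as the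
   two-point bound requires; the second gives c / p >= c / (2 sqrt n), twice the threshold (c / 4) /
   sqrt n. *)
pose p := (Num.truncn (Num.sqrt (n%:R : R))).+1.
have p0 : 0 < p%:R :> R by rewrite ltr0n.
have p1 : Num.sqrt n%:R < p%:R :> R by exact: truncnS_gt.
have p2 : p%:R <= 2 * Num.sqrt n%:R :> R.
  rewrite /p -natr1 mulr_natl mulr2n lerD ?truncn_le ?sqrtr_ge0//.
  by rewrite -[leLHS]sqrtr1 ler_sqrt ?ler1n ?ler0n// ltnW.
set r := Num.sqrt n%:R in sn0 p1 p2 *.
have r2 : r ^+ 2 = n%:R by rewrite sqr_sqrtr.
have an : ((4 * p%:R)^-1 : R) ^+ 2 <= n%:R^-1.
  by rewrite exprVn lef_pV2 ?posrE ?exprn_gt0 ?mulr_gt0 ?ltr0n// -?r2; [nra|exact: ltnW].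
have a1 : ((4 * p%:R)^-1 : R) ^+ 2 < 1.
  by apply: le_lt_trans an _; rewrite invf_lt1 ?ltr1n// ltr0n ltnW.
apply: (minimax_corr_gauss kc kb bij hPP n2 an).
rewrite (HSIC_corr_gauss H kc kb bij a1); apply: le_trans (Kc p _) => //.
rewrite (_ : 2 * _ = c * (2 * r)^-1); last by field; rewrite gt_eqF.
by rewrite ler_wpM2l ?(ltW c0)// lef_pV2 ?posrE// mulr_gt0.
Qed.
End part_ii.

(** * Gaussian kernels: the explicit K and the constant of part (i) *)

Section gaussian_integrals.
Context (R : realType).
Local Notation T := (measurableTypeR R).
Local Notation N := (@normal_prob R 0 1).
Variable g : R.
Hypothesis g0 : 0 < g.
Local Notation A := (1 + 2 * g).
Local Notation e u := (expR (- (g / 2) * u ^+ 2)).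

Lemma measurable_expR_quad (A B C : R) :
  measurable_fun setT (fun u : T => (expR (- (A * u ^+ 2 + 2 * B * u + C) / 2))%:E).
Proof.
apply/measurable_EFinP; apply: measurableT_comp => //.
apply: measurable_funM => //; apply: measurableT_comp => //; meas.
Qed.

(** The two arguments of [e] form a centered Gaussian pair with covariance matrix Sigma having 2 on
    the diagonal and s off it. The value is det (1 + g Sigma)^(-1/2), with determinant (1 + 2 g)^2 -
    g^2 s^2. *)
Lemma integral_gauss_pair (s : R) : s ^+ 2 < 4 ->
  (\int[N]_u \int[N]_w (e (Num.sqrt 2 * u) *
     e (s / Num.sqrt 2 * u + Num.sqrt (2 - s ^+ 2 / 2) * w))%:E =
   ((Num.sqrt (A ^+ 2 - g ^+ 2 * s ^+ 2))^-1)%:E)%E.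
Proof.
move=> s4; set r := Num.sqrt 2; set t := Num.sqrt (2 - s ^+ 2 / 2).
have r2 : r ^+ 2 = 2 by rewrite sqr_sqrtr.
have t2 : t ^+ 2 = 2 - s ^+ 2 / 2 by rewrite sqr_sqrtr//; lra.
have r0 : r != 0 by rewrite gt_eqF// sqrtr_gt0.
pose C := 1 + g * t ^+ 2.
have C0 : 0 < C by rewrite /C ltr_pwDl// mulr_ge0 ?sqr_ge0// ltW.
pose B := 2 * g + g * s ^+ 2 / (2 * C).
have B0 : 0 < 1 + B.
  rewrite /B; apply: ltr_pwDl => //; apply: addr_ge0.
    by apply: mulr_ge0 => //; exact: ltW.
  by apply: divr_ge0; apply: mulr_ge0; rewrite ?sqr_ge0//; exact: ltW.
transitivity (\int[N]_u ((Num.sqrt C)^-1%:E * (expR (- (B * u ^+ 2 + 2 * 0 * u + 0) / 2))%:E))%E.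
  apply: eq_integral => u _; pose m := s / r * u.
  transitivity (\int[N]_w (expR (- ((g * t ^+ 2) * w ^+ 2 + 2 * (g * t * m) * w +
      (g * m ^+ 2 + 2 * g * u ^+ 2)) / 2))%:E)%E.
    apply: eq_integral => w _; congr EFin; rewrite -expRD; congr expR.
    by rewrite -/m exprMn r2; field.
  rewrite (integral_normal_expR _ _ C0) -EFinM; congr ((_ * expR _)%:E).
  have m2 : m ^+ 2 = s ^+ 2 / 2 * u ^+ 2 by rewrite /m exprMn expr_div_n r2.
  have -> : (g * t * m) ^+ 2 = g * (C - 1) * (s ^+ 2 / 2 * u ^+ 2).
    by rewrite exprMn m2 /C; ring.
  by rewrite -/C m2 /B; field; rewrite gt_eqF.
rewrite ge0_integralZl_EFin//; last exact: measurable_expR_quad.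
rewrite (integral_normal_expR _ _ B0) expr0n mul0r mul0r subrr expR0 mulr1 -EFinM -invfM -sqrtrM ?(ltW C0)//.
congr ((Num.sqrt _)^-1%:E); rewrite /B.
rewrite (_ : C * _ = C * (1 + 2 * g) + g * s ^+ 2 / 2); last by field; rewrite gt_eqF.
by rewrite /C t2; field.
Qed.

(** The null terms 2 * 0 * x + 0 keep the result in the shape that [integral_normal_expR] integrates
    next. *)
Lemma integral_gauss_sub (x : R) :
  (\int[N]_y (e (x - y))%:E =
   ((Num.sqrt (1 + g))^-1 * expR (- (g / (1 + g) * x ^+ 2 + 2 * 0 * x + 0) / 2))%:E)%E.
Proof.
have g1 : 0 < 1 + g by rewrite addr_gt0.
transitivity (\int[N]_y (expR (- (g * y ^+ 2 + 2 * (- g * x) * y + g * x ^+ 2) / 2))%:E)%E.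
  by apply: eq_integral => y _; congr ((expR _)%:E); field.
rewrite (integral_normal_expR _ _ g1); congr ((_ * expR _)%:E).
by field; rewrite gt_eqF.
Qed.

Lemma integral_gauss_sub2 :
  (\int[N]_x ((Num.sqrt (1 + g))^-1 *
     expR (- (g / (1 + g) * x ^+ 2 + 2 * 0 * x + 0) / 2))%:E = ((Num.sqrt A)^-1)%:E)%E.
Proof.
have g1 : 0 < 1 + g by rewrite addr_gt0.
have g2 : 0 < 1 + g / (1 + g) by rewrite addr_gt0// divr_gt0.
under eq_integral do rewrite EFinM.
rewrite ge0_integralZl_EFin//; last exact: measurable_expR_quad.
rewrite (integral_normal_expR _ _ g2) expr0n mul0r mul0r subrr expR0 mulr1 -EFinM -invfM -sqrtrM ?(ltW g1)//.
by congr ((Num.sqrt _)^-1%:E); field; rewrite gt_eqF.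
Qed.

End gaussian_integrals.

Lemma inv_sqrt_ge (R : realType) (u v : R) : 0 < u -> 0 <= v ->
  u * v ^+ 2 <= 1 -> v <= (Num.sqrt u)^-1.
Proof.
move=> u0 v0 uv; rewrite -ler_sqr ?nnegrE ?invr_ge0 ?sqrtr_ge0//.
by rewrite exprVn sqr_sqrtr ?(ltW u0)// -[leRHS]mul1r ler_pdivlMr// mulrC.
Qed.

Lemma inv_sqrt_le (R : realType) (u v : R) : 0 < u -> 0 <= v ->
  1 <= u * v ^+ 2 -> (Num.sqrt u)^-1 <= v.
Proof.
move=> u0 v0 uv; rewrite -ler_sqr ?nnegrE ?invr_ge0 ?sqrtr_ge0//.
by rewrite exprVn sqr_sqrtr ?(ltW u0)// -[leLHS]mul1r ler_pdivrMr// mulrC.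
Qed.

(** Put t = x / A^2, so t <= 1/8. The lower bound 1 + 2 t + 6 t^2 on (1 - 4 t)^(-1/2) is its Taylor
    polynomial. The upper bound 1 + t / 2 + 3 t^2 on (1 - t)^(-1/2) takes 3 instead of the Taylor
    coefficient 3/8, so that the quadratic terms cancel and exactly t remains. *)
Lemma inv_sqrt_second_diff (R : realType) (A x : R) : 0 < A -> 0 <= x -> 8 * x <= A ^+ 2 ->
  x / A ^+ 3 <= (Num.sqrt (A ^+ 2 - 4 * x))^-1 - 2 * (Num.sqrt (A ^+ 2 - x))^-1 + A^-1.
Proof.
move=> A0 x0 xA; pose t := x / A ^+ 2.
have An0 : A != 0 by rewrite gt_eqF.
have xE : x = t * A ^+ 2 by rewrite /t; field.
have t0 : 0 <= t by rewrite divr_ge0// sqr_ge0.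
have t2 := sqr_ge0 t.
have t3 : 0 <= t ^+ 3 by exact: exprn_ge0.
have t1 : t <= 8^-1 by rewrite /t ler_pdivrMr ?exprn_gt0//; lra.
have A2 : 0 < A ^+ 2 by rewrite exprn_gt0.
have h1 : (1 + 2 * t + 6 * t ^+ 2) / A <= (Num.sqrt (A ^+ 2 - 4 * x))^-1.
  apply: inv_sqrt_ge; first nra.
    by apply: divr_ge0; [lra|exact: ltW].
  rewrite (_ : _ * _ = 1 - t ^+ 3 * (40 + 60 * t + 144 * t ^+ 2)); last by rewrite xE; field.
  by rewrite gerBl; apply: mulr_ge0 => //; lra.
have h2 : (Num.sqrt (A ^+ 2 - x))^-1 <= (1 + t / 2 + 3 * t ^+ 2) / A.
  apply: inv_sqrt_le; first nra.
    by apply: divr_ge0; [lra|exact: ltW].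
  rewrite (_ : _ * _ = 1 + t ^+ 2 * (21 / 4 - 13 / 4 * t + 6 * t ^+ 2 - 9 * t ^+ 3)); last by rewrite xE; field.
  rewrite lerDl; apply: mulr_ge0 => //.
  have : t ^+ 3 <= 8^-1 * t ^+ 2 by rewrite exprS ler_wpM2r.
  have : t ^+ 2 <= 8^-1 * t by rewrite expr2 ler_wpM2r.
  lra.
rewrite (_ : x / A ^+ 3 = t / A); last by rewrite xE; field.
have -> : t / A = (1 + 2 * t + 6 * t ^+ 2) / A - 2 * ((1 + t / 2 + 3 * t ^+ 2) / A) + A^-1.
  by field.
lra.
Qed.

Lemma ge0_integral2Zl d1 d2 (T1 : measurableType d1) (T2 : measurableType d2) (R : realType)
    (m1 : probability T1 R) (m2 : probability T2 R) (r : R) (h : T1 -> T2 -> R) :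
  0 <= r -> measurable_fun setT (fun z : T1 * T2 => h z.1 z.2) -> (forall x y, 0 <= h x y) ->
  (\int[m1]_x \int[m2]_y (r * h x y)%:E = r%:E * \int[m1]_x \int[m2]_y (h x y)%:E)%E.
Proof.
move=> r0 mh h0; pose F (z : T1 * T2) := (h z.1 z.2)%:E.
have mF : measurable_fun setT F by apply/measurable_EFinP.
have F0 z : (0 <= F z)%E by rewrite lee_fin.
transitivity (\int[m1]_x (r%:E * fubini_F m2 F x))%E.
  apply: eq_integral => x _.
  rewrite -ge0_integralZl_EFin//; first exact: (measurableT_comp mF (pair1_measurable x)).
rewrite ge0_integralZl_EFin//.
  by move=> x _; apply: integral_ge0.
exact: (measurable_fun_fubini_tonelli_F F mF F0).
Qed.

Section gaussian_embeddings.
Context (R : realType) (M : nat) (d : 'I_M -> nat).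
Local Notation D := (\sum_(m < M) d m)%N.
Variable PP : set (probability 'rV[R]_D R).
Hypothesis hPP : forall mu A, A \in unitmx -> PP (gaussian mu A).
Variables (k : forall m, 'rV[R]_(d m) -> 'rV[R]_(d m) -> R) (H : rkhs (prod_kernel k)).
Hypotheses (kb : forall m, kernel_bounded (@k m)).
Variable g : R.
Hypotheses (g0 : 0 < g) (kE : forall m x y, @k m x y = gaussian_kernel g x y).
Local Notation A := (1 + 2 * g).
Local Notation T := (measurableTypeR R).
Local Notation N := (@normal_prob R 0 1).
Local Notation e u := (expR (- (g / 2) * u ^+ 2)).

Lemma gaussian_kernelE n (x y : 'rV[R]_n) :
  gaussian_kernel g x y = \prod_(l < n) e (x 0 l - y 0 l).
Proof.
rewrite /gaussian_kernel /enorm sqr_sqrtr; last by apply: sumr_ge0 => l _; exact: sqr_ge0.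
rewrite mulr_sumr expR_sum; apply: eq_bigr => l _; by rewrite !mxE.
Qed.

Lemma gaussian_prod_kernelE (x y : 'rV[R]_D) :
  prod_kernel k x y = \prod_(l < D) e (x 0 l - y 0 l).
Proof.
transitivity (\prod_(m < M) \prod_(l < d m)
  e (x 0 (tagnat.Rank m l) - y 0 (tagnat.Rank m l))).
  apply: eq_bigr => m _; rewrite kE gaussian_kernelE; apply: eq_bigr => l _.
  by rewrite !blockE.
rewrite sig_big_dep/= (reindex _ tagnat.sig_bij_on)/=; apply: eq_bigr => l _.
by rewrite -[in RHS](tagnat.sig2K l).
Qed.

Lemma continuous_expR_sqr (S : topologicalType) (f : S -> R) (x : S) :
  f z @[z --> x] --> f x -> e (f z) @[z --> x] --> e (f x).
Proof.
move=> cf; apply: (@continuous_comp _ _ _ f (fun u => e u)) => //.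
apply: continuous_comp; last exact: continuous_expR.
by apply: cvgM; [exact: cvg_cst|exact: exprn_continuous].
Qed.

Lemma gaussian_kernel_continuous m : kernel_continuous (@k m).
Proof.
move=> z; rewrite (_ : (fun _ => _) =
  (fun z : 'rV[R]_(d m) * 'rV[R]_(d m) => \prod_(l < d m) e (z.1 0 l - z.2 0 l))).
  apply: continuous_prod => l {}z; apply: continuous_expR_sqr; apply: cvgB.
    by apply: (cvg_comp fst (fun x : 'rV[R]_(d m) => x 0 l)); [exact: cvg_fst|exact: coord_continuous].
  by apply: (cvg_comp snd (fun x : 'rV[R]_(d m) => x 0 l)); [exact: cvg_snd|exact: coord_continuous].
by apply/funext => u; rewrite kE gaussian_kernelE.
Qed.

Variables (i j : 'I_D).
Hypothesis bij : tagnat.sig1 i != tagnat.sig1 j.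
Let ij : i != j := neq_sig1 bij.
Local Notation P := (@corr_gauss R D i j).
Let pc := prod_kernel_continuous gaussian_kernel_continuous.
Let pb := prod_kernel_bounded kb.

Lemma measurable_expR_sqr d' (S : measurableType d') (f : S -> R) :
  measurable_fun setT f -> measurable_fun setT (fun x => e (f x)).
Proof.
move=> mf; apply: measurableT_comp => //; apply: measurable_funM => //.
exact: measurable_funX.
Qed.

(** Each of the D - 2 coordinates other than [i] and [j] contributes (1 + 2 g)^(-1/2); the factor
    [A] compensates for the two missing ones. *)
Lemma integral_gauss_prod :
  (\int[iid N D]_t \int[iid N D]_t'
     (\prod_(l < D) (if (l != i) && (l != j) then e (tnth t l - tnth t' l) else 1))%:E =
   ((Num.sqrt A)^-1 ^+ D * A)%:E)%E.
Proof.
pose f (l : 'I_D) (x y : T) := if (l != i) && (l != j) then e (x - y) else 1.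
pose c (l : 'I_D) (x : T) := if (l != i) && (l != j) then
  (Num.sqrt (1 + g))^-1 * expR (- (g / (1 + g) * x ^+ 2 + 2 * 0 * x + 0) / 2) else 1.
have int1 : (\int[N]_y 1%:E = 1)%E by rewrite integral_cst// mul1e; exact: probability_setT.
transitivity (\int[iid N D]_t (\prod_(l < D) c l (tnth t l))%:E)%E.
  apply: eq_integral => t _.
  rewrite (@ge0_integral_iid_prod _ T R N D (fun l => f l (tnth t l))).
  - rewrite -prodEFin; apply: eq_bigr => l _; rewrite /f /c; case: ifP => // _.
    exact: integral_gauss_sub.
  - move=> l; rewrite /f; case: (_ && _); last exact: measurable_cst.
    by apply: measurable_expR_sqr; meas.
  - by move=> l y; rewrite /f; case: ifP.
rewrite (@ge0_integral_iid_prod _ T R N D c).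
- transitivity (\prod_(l < D) (if (l != i) && (l != j) then (Num.sqrt A)^-1 else 1)%:E)%E.
    apply: eq_bigr => l _; rewrite /c; case: ifP => // _.
    exact: integral_gauss_sub2.
  rewrite prodEFin; congr EFin; rewrite -big_mkcond /=.
  have A0 : 0 < A by rewrite addr_gt0// mulr_gt0.
  have : \prod_(l < D) (Num.sqrt A)^-1 = (Num.sqrt A)^-1 ^+ D by rewrite prodr_const card_ord.
  rewrite (bigD1 i)//= (bigD1 j)/=; last by rewrite eq_sym.
  move=> <-; rewrite mulrA -expr2 exprVn sqr_sqrtr ?(ltW A0)// mulrAC mulVf ?mul1r//.
  by rewrite gt_eqF.
- move=> l; rewrite /c; case: (_ && _); last exact: measurable_cst.
  have := @measurable_expR_quad R (g / (1 + g)) 0 0 => /measurable_EFinP h.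
  exact: measurable_funM.
- by move=> l y; rewrite /c; case: ifP.
Qed.

Lemma inner_gaussian_embeddings a b : a ^+ 2 < 1 -> b ^+ 2 < 1 ->
  inner (corr_embedding H i j a) (corr_embedding H i j b) =
  (Num.sqrt A)^-1 ^+ D * A * (Num.sqrt (A ^+ 2 - g ^+ 2 * (a + b) ^+ 2))^-1.
Proof.
move=> a1 b1; set s := a + b.
have s4 : s ^+ 2 < 4.
  by have := sqr_ge0 (a - b); rewrite sqrrB sqrrD; lra.
pose kap (z : 'rV[R]_D) := \prod_(l < D) e (z 0 l).
have kapE x y : prod_kernel k x y = kap (x - y).
  by rewrite gaussian_prod_kernelE; apply: eq_bigr => l _; rewrite !mxE.
have mkap : measurable_fun setT kap.
  apply: measurable_prod => l _; apply: measurable_expR_sqr; exact: measurable_coord.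
have kap0 z : 0 <= kap z by apply: prodr_ge0 => l _; exact: expR_ge0.
have mf : measurable_fun setT (EFin \o kap) by apply/measurable_EFinP.
have f0 z : (0 <= (kap z)%:E)%E by rewrite lee_fin.
have [C kC] := pb.
have kapC z : `|kap z| <= C by have := kC z 0; rewrite kapE subr0.
rewrite (inner_mean_embeddings H pc pb).
transitivity (fine (\int[P a]_x \int[P b]_y (kap (x - y)%R)%:E)%E).
  apply: (congr1 fine); apply: eq_integral => x _.
  transitivity ((\int[P b]_y kap (x - y))%:E).
    by congr EFin; apply: eq_Rintegral => y _.
  have mkB : measurable_fun setT (fun y : 'rV[R]_D => kap (x - y)).
    exact: (measurableT_comp mkap (measurableT_comp (@measurable_rowB R D) (pair1_measurable x))).
  have ik := @integrable_bounded _ _ _ (P b) _ C mkB (fun y => kapC (x - y)).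
  exact: (fineK (integrable_fin_num measurableT ik)).
(* The Gaussian kernel factors over coordinates: [G] collects those other than [i] and [j], so the
   integral splits into [integral_gauss_prod] and [integral_gauss_pair]. *)
pose G (t t' : D.-tuple T) :=
  \prod_(l < D) (if (l != i) && (l != j) then e (tnth t l - tnth t' l) else 1).
have G0 t t' : 0 <= G t t' by apply: prodr_ge0 => l _; case: ifP => _; rewrite ?expR_ge0.
have kap_put t t' x y : kap (put i j (row_of_tuple t - row_of_tuple t') x y) =
    G t t' * (e x * e y).
  rewrite /kap /G -big_mkcond (bigD1 i)//= (bigD1 j)/=; last by rewrite eq_sym.
  rewrite put_i (put_j ij) mulrA mulrC; congr (_ * _); apply: eq_bigr => l /andP[li lj].
  by rewrite !mxE (negbTE li) (negbTE lj).
have mG : measurable_fun setT (fun z : D.-tuple T * D.-tuple T => G z.1 z.2).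
  apply: measurable_prod => l _; case: (_ && _); last exact: measurable_cst.
  apply: measurable_expR_sqr; apply: measurable_funB.
    exact: (measurableT_comp (measurable_tnth l) measurable_fst).
  exact: (measurableT_comp (measurable_tnth l) measurable_snd).
pose h (u w : T) := e (Num.sqrt 2 * u) *
  e (s / Num.sqrt 2 * u + Num.sqrt (2 - s ^+ 2 / 2) * w).
have mh : measurable_fun setT (fun z : T * T => h z.1 z.2).
  by apply: measurable_funM; apply: measurable_expR_sqr; meas.
have h0 u w : 0 <= h u w by rewrite mulr_ge0 ?expR_ge0.
set c := (Num.sqrt (A ^+ 2 - _))^-1.
have c0 : 0 <= c by rewrite invr_ge0 sqrtr_ge0.
rewrite -[RHS]/(fine (_%:E)); apply: (congr1 fine).
etransitivity; first exact: (ge0_integral_corr_gauss_sub ij a1 b1 mf f0).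
transitivity (\int[iid N D]_t \int[iid N D]_t' (c * G t t')%:E)%E.
  apply: eq_integral => t _; apply: eq_integral => t' _.
  transitivity (\int[N]_u \int[N]_w (G t t' * h u w)%:E)%E.
    apply: eq_integral => u _; apply: eq_integral => w _.
    by rewrite /comp kap_put.
  by rewrite (ge0_integral2Zl _ _ (G0 t t') mh h0) (integral_gauss_pair g0 s4) -EFinM mulrC.
rewrite (ge0_integral2Zl _ _ c0 mG G0) [X in (_ * X)%E]integral_gauss_prod -EFinM.
by rewrite mulrC.
Qed.

End gaussian_embeddings.

Lemma sqr_normB_eq (R : realType) (H : hilbert R) (u v : H) p q r :
  inner u u = p -> inner u v = q -> inner v v = r -> `|u - v| ^+ 2 = p - 2 * q + r.
Proof. by move=> <- <- <-; rewrite sqr_normB. Qed.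

Lemma sqr_powR_quarter (R : realType) (A : R) n : 0 < A ->
  (A `^ (n%:R / 4 + 1)) ^+ 2 = Num.sqrt A ^+ n * A ^+ 2.
Proof.
move=> A0; rewrite powRD ?(gt_eqF A0) ?implybT//.
rewrite powRr1 ?(ltW A0)// exprMn; congr (_ * _).
have -> : Num.sqrt A = A `^ 2^-1 by rewrite powR12_sqrt// ltW.
rewrite -(powR_mulrn 2 (powR_ge0 _ _)) -(powR_mulrn n (powR_ge0 _ _)).
by rewrite -!powRrM; congr (_ `^ _); field.
Qed.

Section part_i.
Context (R : realType) (M : nat) (d : 'I_M -> nat).
Local Notation D := (\sum_(m < M) d m)%N.
Variable PP : set (probability 'rV[R]_D R).
Hypothesis hPP : forall mu A, A \in unitmx -> PP (gaussian mu A).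
Variables (k : forall m, 'rV[R]_(d m) -> 'rV[R]_(d m) -> R) (H : rkhs (prod_kernel k)).
Hypotheses (kb : forall m, kernel_bounded (@k m)).
Variable g : R.
Hypotheses (g0 : 0 < g) (kE : forall m x y, @k m x y = gaussian_kernel g x y).
Variables (i j : 'I_D).
Hypothesis bij : tagnat.sig1 i != tagnat.sig1 j.

(** With x = (g a)^2, the squared HSIC is A^(1 - D/2) times the second difference bounded in
    [inv_sqrt_second_diff], hence at least x / A^(D/2 + 2); the square root produces the exponent
    D/4 + 1. The assumption 2 a^2 <= 1 yields 8 x <= 4 g^2 <= A^2. *)
Lemma HSIC_gaussian_ge a : 2 * a ^+ 2 <= 1 -> 0 < a ->
  g * a / (2 * g + 1) `^ (D%:R / 4 + 1) <= HSIC H (corr_gauss i j a).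
Proof.
move=> a2 a0; have a1 : a ^+ 2 < 1 by lra.
have kc := gaussian_kernel_continuous kE.
rewrite (HSIC_corr_gauss H kc kb bij a1).
set A := 1 + 2 * g.
have A0 : 0 < A by rewrite addr_gt0// mulr_gt0.
have An0 : A != 0 by rewrite gt_eqF.
have s0 : 0 < Num.sqrt A by rewrite sqrtr_gt0.
have z1 := sqr0_lt1 R.
have B0 : 0 <= g * a / (2 * g + 1) `^ (D%:R / 4 + 1).
  by apply: divr_ge0; [rewrite mulr_ge0 ?(ltW g0) ?(ltW a0)|exact: powR_ge0].
rewrite -ler_sqr ?nnegrE ?normr_ge0//.
rewrite (sqr_normB_eq (inner_gaussian_embeddings H kb g0 kE bij a1 a1)
  (inner_gaussian_embeddings H kb g0 kE bij a1 z1)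
  (inner_gaussian_embeddings H kb g0 kE bij z1 z1)) -/A.
pose x := (g * a) ^+ 2.
have -> : g ^+ 2 * (a + a) ^+ 2 = 4 * x by rewrite /x; ring.
have -> : g ^+ 2 * (a + 0) ^+ 2 = x by rewrite /x; ring.
have -> : A ^+ 2 - g ^+ 2 * (0 + 0) ^+ 2 = A ^+ 2 by ring.
rewrite sqrtr_sqr (gtr0_norm A0) expr_div_n -/x [2 * g + 1]addrC -/A sqr_powR_quarter//.
have x0 : 0 <= x by exact: sqr_ge0.
have xA : 8 * x <= A ^+ 2.
  rewrite /x exprMn.
  have : 8 * (g ^+ 2 * a ^+ 2) <= 4 * g ^+ 2 * 1.
    rewrite (_ : 8 * _ = 4 * g ^+ 2 * (2 * a ^+ 2)); last by ring.
    by apply: ler_wpM2l => //; apply: mulr_ge0 => //; exact: sqr_ge0.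
  move=> /le_trans; apply.
  rewrite (_ : A ^+ 2 = 4 * g ^+ 2 * 1 + (1 + 4 * g)); last by rewrite /A; ring.
  by rewrite lerDl addr_ge0// mulr_ge0// ltW.
have := inv_sqrt_second_diff A0 x0 xA.
set u := (Num.sqrt (_ - 4 * x))^-1; set v := (Num.sqrt (_ - x))^-1 => uv.
pose Q := (Num.sqrt A)^-1 ^+ D * A.
have Q0 : 0 <= Q by rewrite mulr_ge0 ?exprn_ge0 ?invr_ge0 ?ltW.
have := ler_wpM2l Q0 uv; rewrite -/Q.
rewrite (_ : Q * (x / A ^+ 3) = x / (Num.sqrt A ^+ D * A ^+ 2)).
  by lra.
by rewrite /Q exprVn; field; rewrite An0 expf_neq0 ?gt_eqF.
Qed.

Lemma minimax_gaussian : let c := g / (2 * (2 * g + 1) `^ (D%:R / 4 + 1)) in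
  0 < c /\ forall n, (2 <= n)%N ->
    (((1 - Num.sqrt (5 / 8)) / 2)%:E <=
       minimax_risk n PP (HSIC H) (c / Num.sqrt n%:R))%E.
Proof.
move=> c; have c0 : 0 < c.
  by rewrite divr_gt0// mulr_gt0// powR_gt0// addr_gt0// mulr_gt0.
split=> // n n2; have n0 : 0 < n%:R :> R by rewrite ltr0n ltnW.
have s0 : 0 < Num.sqrt n%:R :> R by rewrite sqrtr_gt0.
(* The largest correlation that the two-point bound allows; 2 a^2 <= 1 because n >= 2. The 2 in the
   denominator of [c] is the one lost to halving the distance between the two values of HSIC. *)
pose a := (Num.sqrt n%:R : R)^-1.
have a2 : a ^+ 2 = n%:R^-1 by rewrite exprVn sqr_sqrtr// ltW.
have a0 : 0 < a by rewrite invr_gt0.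
have n2' : 2 <= n%:R :> R by rewrite ler_nat.
have an : 2 * a ^+ 2 <= 1 by rewrite a2 ler_pdivrMr// mul1r.
have a3 : a ^+ 2 <= n%:R^-1 by rewrite a2.
apply: (minimax_corr_gauss (gaussian_kernel_continuous kE) kb bij hPP n2 a3).
apply: le_trans (HSIC_gaussian_ge an a0); rewrite -/a /c.
set w := (_ `^ _); have w0 : w != 0 by rewrite gt_eqF// powR_gt0// addr_gt0// mulr_gt0.
by rewrite le_eqVlt; apply/orP; left; apply/eqP; field.
Qed.

End part_i.

Theorem theorem1 (R : realType) (M : nat) (hM : (2 <= M)%N)
    (d : 'I_M -> nat) (hd : forall m, (0 < d m)%N)
    (PP : set (probability 'rV[R]_(\sum_(m < M) d m)%N R))
    (hPP : forall mu A, A \in unitmx -> PP (gaussian mu A))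
    (k : forall m : 'I_M, 'rV[R]_(d m) -> 'rV[R]_(d m) -> R)
    (hk : forall m,
      [/\ hilbert_kernel (k m), kernel_measurable (k m) & kernel_bounded (k m)])
    (Hk : forall m, rkhs (k m)) (H : rkhs (prod_kernel k)) :
  (forall gamma : R, 0 < gamma ->
    (forall m x y, k m x y = gaussian_kernel gamma x y) ->
    let c := gamma /
      (2 * (2 * gamma + 1) `^ ((\sum_(m < M) d m)%N%:R / 4 + 1)) in
    0 < c /\
    forall n, (2 <= n)%N ->
      (((1 - Num.sqrt (5 / 8)) / 2)%:E <=
         minimax_risk n PP (HSIC H) (c / Num.sqrt n%:R))%E) /\
  ((forall m,
      [/\ kernel_continuous (k m), kernel_bounded (k m),
          translation_invariant (k m) & characteristic_kernel (Hk m)]) ->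
    exists2 c : R, 0 < c &
      forall n, (2 <= n)%N ->
        (((1 - Num.sqrt (5 / 8)) / 2)%:E <=
           minimax_risk n PP (HSIC H) (c / Num.sqrt n%:R))%E).
Proof.
have kb m : kernel_bounded (k m) by case: (hk m).
have km m : kernel_measurable (k m) by case: (hk m).
split=> [g g0 kE|]; last exact: (minimax_characteristic hM hd hPP H km).
have [i [j bij]] := two_blocks hM hd.
exact: (minimax_gaussian hPP H kb g0 kE bij).
Qed.
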